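(* Let $f \in \mathrm{Homeo}^+(\mathbb{S}^1)$. The conjugacy class of $f$ in $\mathrm{Homeo}^+(\mathbb{S}^1)$ is non-Haar null if and only if $\tau(f)\in\mathbb{Q}$, $f$ has finitely many periodic points, and all of them are crossing. Every homeomorphism belonging to such a (non-Haar null) conjugacy class has an even number of periodic orbits, and for every rational number $0\le r<1$ and every positive integer $k$ there is a unique non-Haar null conjugacy class whose elements have rotation number $r$ and exactly $2k$ periodic orbits. Moreover, the union of the non-Haar null conjugacy classes and the set $\{f\in \mathrm{Homeo}^+(\mathbb{S}^1): \tau(f)\notin\mathbb{Q}\}$ is co-Haar null.
   Context: $\mathbb{S}^1=\mathbb{R}/\mathbb{Z}$, and $\mathrm{Homeo}^+(\mathbb{S}^1)$ is the Polish group (under composition) of orientation preserving homeomorphisms of $\mathbb{S}^1$ with the uniform topology. A lift of $f\in\mathrm{Homeo}^+(\mathbb{S}^1)$ is an increasing homeomorphism $F$ of $\mathbb{R}$ with $F(x)\equiv f(x) \pmod 1$ and $F(x+1)=F(x)+1$ for all $x$; any two lifts differ by an integer constant. The rotation number is $\tau(f)\equiv\tau(F)\pmod 1$, where $\tau(F)=\lim_{n\to\infty}\frac1n(F^n(x)-x)$ (independent of $x\in\mathbb{R}$); it is an element of $\mathbb{R}/\mathbb{Z}$, identified with its representative in $[0,1)$, and $\tau(f)\in\mathbb{Q}$ means that this representative is rational. A point $x\in\mathbb{S}^1$ is a periodic point of $f$ if $f^n(x)=x$ for some integer $n\ge1$; a periodic orbit is the orbit $\{f^n(x):n\in\mathbb{Z}\}$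 of a periodic point $x$. If $x$ is a fixed point of $f$, $F$ is a lift of $f$, $x'\in\mathbb{R}$ represents $x$ and $F(x')=x'+k$ with $k\in\mathbb{Z}$, then $x$ is a crossing fixed point of $f$ if every neighbourhood $U\subset\mathbb{R}$ of $x'$ contains a point $y_1$ with $F(y_1)<y_1+k$ and a point $y_2$ with $F(y_2)>y_2+k$. A periodic point $x$ of $f$ is crossing if $x$ is a crossing fixed point of $f^n$, where $n$ is the smallest positive integer with $f^n(x)=x$. Haar null sets (Christensen): in a Polish group $G$, a Borel set $B\subset G$ is Haar null if there is a Borel probability measure $\mu$ on $G$ such that $\mu(gBh)=0$ for all $g,h\in G$; an arbitrary set $S \subset G$ is Haar null if it is contained in a Borel Haar null set; a set is non-Haar null if it is not Haar null, and co-Haar null if its complement is Haar null. *)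

(* Defs.v *)
From HB Require Import structures.
From mathcomp Require Import all_boot all_order all_algebra.
From mathcomp Require Import all_classical all_reals all_analysis.

Set Implicit Arguments.
Unset Strict Implicit.
Unset Printing Implicit Defensive.

Import Order.TTheory GRing.Theory Num.Theory.
Import numFieldNormedType.Exports.

Local Open Scope classical_set_scope.
Local Open Scope ring_scope.
Local Open Scope quotient_scope.

(* Join of the group and topological structures, without compatibility axioms
   (as for [PreTopologicalZmodule] in MathComp-Analysis). *)
#[short(type="preTopologicalGroupType")]
HB.structure Definition PreTopologicalGroup :=
  {G of Topological G & Pointed G & Group G}.

Notation borelType G := (g_sigma_algebraType (@open G)).

Section haar_null.
Context (R : realType) (G : preTopologicalGroupType).
Local Open Scope group_scope.

Definition translate (g h : G) (B : set G) : set G := [set g * b * h | b in B].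

Definition borel_haar_null (B : set G) : Prop :=
  measurable (B : set (borelType G)) /\
  exists mu : probability (borelType G) R,
    forall g h : G, mu (translate g h B) = 0%E.

Definition haar_null (S : set G) : Prop :=
  exists B : set G, borel_haar_null B /\ S `<=` B.

Definition co_haar_null (S : set G) : Prop := haar_null (~` S).

End haar_null.

Section conjugacy.
Context (G : groupType).
Local Open Scope group_scope.

Definition conjugacy_class (f : G) : set G :=
  [set h * f * h^-1 | h in [set: G]].

Definition conjugacy_classes : set (set G) := range conjugacy_class.

End conjugacy.

Section circle.
Context (R : realType).

(* R / Z; [int_num_subdef] is the bare predicate behind [Num.int], the one that
   carries the [zmodClosed] structure. *)
Definition circle : Type := Quotient.quot (Num.int_num_subdef : {pred R}).

HB.instance Definition _ := GRing.Zmodule.on circle.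

Definition circle_of (x : R) : circle :=
  \pi_(Quotient.quot (Num.int_num_subdef : {pred R})) x.

Lemma circle_of_surj (x : circle) : exists a, circle_of a = x.
Proof. by exists (repr x); exact: reprK. Qed.

Lemma circle_ofB a b : circle_of (a - b) = circle_of a - circle_of b.
Proof. by rewrite /circle_of !piE. Qed.

Lemma circle_of_eq a b : circle_of a = circle_of b <-> a - b \is a Num.int.
Proof.
have -> : (a - b \is a Num.int) = (circle_of a == circle_of b).
  exact: Quotient.idealrBE.
by split => [->|/eqP].
Qed.

Definition circle_gaps (x y : circle) : set R :=
  [set d | exists a b, [/\ circle_of a = x, circle_of b = y & d = `|a - b|]].

Definition circle_dist (x y : circle) : R := inf (circle_gaps x y).

Let gaps_has_inf x y : has_inf (circle_gaps x y).
Proof.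
split; last by exists 0 => _ [a [b [_ _ ->]]].
have [a ax] := circle_of_surj x; have [b yb] := circle_of_surj y.
by exists `|a - b|, a, b.
Qed.

Let dist_le a b : circle_dist (circle_of a) (circle_of b) <= `|a - b|.
Proof.
apply: ge_inf; last by exists a, b.
by case: (gaps_has_inf (circle_of a) (circle_of b)).
Qed.

Let dist_adherent x y (e : R) : 0 < e ->
  exists a b, [/\ circle_of a = x, circle_of b = y &
                 `|a - b| < circle_dist x y + e].
Proof.
move=> e0; have [_ [a [b [ax yb ->]]] ?] := inf_adherent e0 (gaps_has_inf x y).
by exists a, b.
Qed.

Let dist_ge0 x y : 0 <= circle_dist x y.
Proof.
by apply: lb_le_inf; [case: (gaps_has_inf x y)|move=> _ [a [b [_ _ ->]]]].
Qed.

Lemma circle_distxx x : circle_dist x x = 0.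
Proof.
have [a <-] := circle_of_surj x; apply/eqP; rewrite eq_le dist_ge0 andbT.
by rewrite (le_trans (dist_le a a))// subrr normr0.
Qed.

Lemma circle_dist_sym x y : circle_dist x y = circle_dist y x.
Proof.
rewrite /circle_dist; congr inf; apply/seteqP.
by split=> d [a [b [? ? ->]]]; exists b, a; rewrite distrC.
Qed.

Lemma circle_dist_eq0 x y : circle_dist x y = 0 -> x = y.
Proof.
move=> d0.
have /(dist_adherent x y) [a [b [ax yb]]] : 0 < 2^-1 :> R by rewrite invr_gt0.
rewrite d0 add0r => ab; have [/eqP|abN0] := eqVneq (a - b) 0.
  by rewrite subr_eq0 -ax -yb => /eqP ->.
have /(dist_adherent x y) [a' [b' [ax' yb']]] : 0 < `|a - b|.
  by rewrite normr_gt0.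
rewrite d0 add0r => ab'.
have /circle_of_eq/intrP[k kE] : circle_of (a - b) = circle_of (a' - b').
  by rewrite !circle_ofB ax yb ax' yb'.
have : `|a - b - (a' - b')| < 1.
  rewrite (le_lt_trans (ler_normB _ _))// (splitr 1) ltrD// ?div1r//.
  exact: lt_trans ab' ab.
rewrite kE -intr_norm -[1]/(1%:~R) ltr_int => k1.
have k0 : k = 0 by apply/eqP; rewrite -normr_le0 -ltzD1 add0r.
by move: kE ab'; rewrite k0 => /eqP; rewrite subr_eq0 => /eqP ->; rewrite ltxx.
Qed.

Lemma circle_dist_triangle y x z :
  circle_dist x z <= circle_dist x y + circle_dist y z.
Proof.
apply/ler_addgt0Pr => e e0.
have e20 : 0 < e / 2 by rewrite divr_gt0.
have [a [b [ax yb ab]]] := dist_adherent x y e20.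
have [b' [c [yb' zc bc]]] := dist_adherent y z e20.
have zE : circle_of (b - (b' - c)) = z by rewrite !circle_ofB yb yb' zc subKr.
have := dist_le a (b - (b' - c)); rewrite zE ax => /le_trans; apply.
rewrite (_ : a - _ = (a - b) + (b' - c)).
  by rewrite (le_trans (ler_normD _ _))// (splitr e) addrACA ltW// ltrD.
by rewrite opprB [_ - b]addrC addrA.
Qed.

HB.instance Definition _ := isMetric.Build R circle
  circle_distxx circle_dist_eq0 circle_dist_sym circle_dist_triangle.

End circle.

Definition homeomorphism (T U : topologicalType) (f : T -> U) : Prop :=
  exists g : U -> T,
    [/\ cancel f g, cancel g f, continuous f & continuous g].

Lemma homeomorphism_id (T : topologicalType) : homeomorphism (@id T).
Proof. by exists id; split => // x; exact: cvg_id. Qed.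

Lemma homeomorphism_comp (T U V : topologicalType) (f : U -> V) (g : T -> U) :
  homeomorphism f -> homeomorphism g -> homeomorphism (f \o g).
Proof.
move=> [f' [fK f'K cf cf']] [g' [gK g'K cg cg']]; exists (g' \o f').
split; [exact: can_comp | exact: can_comp | |] => x; apply: continuous_comp.
- exact: cg.
- exact: cf.
- exact: cf'.
- exact: cg'.
Qed.

Section homeo_circle.
Context (R : realType).
Local Notation S1 := (circle R).

Definition is_lift (f : S1 -> S1) (F : R -> R) : Prop :=
  [/\ homeomorphism F, {homo F : x y / x < y},
      (forall x, circle_of (F x) = f (circle_of x)) &
      (forall x, F (x + 1) = F x + 1)].

Definition orientation_preserving_homeo : set {uniform S1 -> S1} :=
  [set f : S1 -> S1 | homeomorphism f /\ exists F, is_lift f F].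

(* Homeo^+(S^1), with the topology induced by that of uniform convergence. *)
Definition homeoS1 : Type := set_type orientation_preserving_homeo.

HB.instance Definition _ := Uniform.on homeoS1.

Definition homeo_fun (f : homeoS1) : S1 -> S1 := set_val f.
Coercion homeo_fun : homeoS1 >-> Funclass.

Lemma homeoS1P (f : homeoS1) : homeomorphism f /\ exists F, is_lift f F.
Proof. exact: (set_valP f). Qed.

Definition mk_homeo (f : S1 -> S1)
    (fP : homeomorphism f /\ exists F, is_lift f F) : homeoS1 :=
  SigSub (mem_set fP).

Lemma homeo_inj (f g : homeoS1) : f =1 g -> f = g.
Proof. by move=> /funext fg; exact: val_inj. Qed.

Fact homeo_one_subproof :
  homeomorphism (@id S1) /\ exists F, is_lift (@id S1) F.
Proof. by split; [|exists id; split => //]; exact: homeomorphism_id. Qed.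

Fact homeo_mul_subproof (f g : homeoS1) :
  homeomorphism (f \o g) /\ exists F, is_lift (f \o g) F.
Proof.
have [hf [F [hF mF lF F1]]] := homeoS1P f.
have [hg [G [hG mG lG G1]]] := homeoS1P g.
split; first exact: homeomorphism_comp.
exists (F \o G); split => [|x y xy|x|x] /=.
- exact: homeomorphism_comp.
- by apply: mF; exact: mG.
- by rewrite lF lG.
- by rewrite G1 F1.
Qed.

Fact homeo_inv_subproof (f : homeoS1) : exists g : homeoS1,
  cancel f g /\ cancel g f.
Proof.
have [[g [fK gK cf cg]] [F [[G [FK GK cF cG]] mF lF F1]]] := homeoS1P f.
suff gP : homeomorphism g /\ exists F, is_lift g F by exists (mk_homeo gP).
split; first by exists f.
exists G; split => [|x y xy|x|x]; first by exists F.
- rewrite ltNge; apply/negP; rewrite le_eqVlt => /predU1P[/(congr1 F)|/mF].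
    by rewrite !GK => yx; rewrite yx ltxx in xy.
  by rewrite !GK => /(lt_trans xy); rewrite ltxx.
- by rewrite -{2}(GK x) lF fK.
- by apply: (can_inj FK); rewrite GK F1 GK.
Qed.

Definition homeo_one : homeoS1 := mk_homeo homeo_one_subproof.

Definition homeo_mul (f g : homeoS1) : homeoS1 :=
  mk_homeo (homeo_mul_subproof f g).

Definition homeo_inv (f : homeoS1) : homeoS1 :=
  projT1 (cid (homeo_inv_subproof f)).

Lemma homeo_invK (f : homeoS1) : cancel f (homeo_inv f).
Proof. by rewrite /homeo_inv; case: cid => g []. Qed.

Lemma homeo_invVK (f : homeoS1) : cancel (homeo_inv f) f.
Proof. by rewrite /homeo_inv; case: cid => g []. Qed.

Fact homeo_mulA : associative homeo_mul.
Proof. by move=> f g h; exact: homeo_inj. Qed.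

Fact homeo_mul1 : left_id homeo_one homeo_mul.
Proof. by move=> f; exact: homeo_inj. Qed.

Fact homeo_mulr1 : right_id homeo_one homeo_mul.
Proof. by move=> f; exact: homeo_inj. Qed.

Fact homeo_mulV : left_inverse homeo_one homeo_inv homeo_mul.
Proof. by move=> f; apply: homeo_inj => x; exact: homeo_invK. Qed.

Fact homeo_mulrV : right_inverse homeo_one homeo_inv homeo_mul.
Proof. by move=> f; apply: homeo_inj => x; exact: homeo_invVK. Qed.

HB.instance Definition _ := isGroup.Build homeoS1
  homeo_mulA homeo_mul1 homeo_mulr1 homeo_mulV homeo_mulrV.

HB.instance Definition _ := isPointed.Build homeoS1 homeo_one.

End homeo_circle.

Section dynamics.
Context (R : realType).
Implicit Types (f : homeoS1 R) (x y : circle R).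

(* The limit does not depend on the starting point, here 0. *)
Definition translation_number (F : R -> R) : R :=
  lim ((iter n F 0 - 0) / n%:R @[n --> \oo]).

(* Any two lifts of f differ by an integer constant. *)
Definition lift_of f : R -> R := projT1 (cid (homeoS1P f).2).

(* Representative in [0, 1[ of the class modulo 1. *)
Definition rotation_number f : R :=
  let t := translation_number (lift_of f) in t - (Num.floor t)%:~R.

Definition periodic_points f : set (circle R) :=
  [set x | exists2 n : nat, (0 < n)%N & homeo_fun (f ^+ n)%g x = x].

Definition full_orbit f x : set (circle R) :=
  [set y | exists n : nat,
     y = homeo_fun (f ^+ n)%g x \/ y = homeo_fun (f ^- n)%g x].

Definition periodic_orbits f : set (set (circle R)) :=
  [set full_orbit f x | x in periodic_points f].

(* The condition does not depend on the choice of F and x' (k is determined by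
   them). *)
Definition crossing_fixed_point f x : Prop :=
  f x = x /\
  exists (F : R -> R) (x' : R) (k : int),
    [/\ is_lift f F, circle_of x' = x, F x' = x' + k%:~R &
      forall U : set R, nbhs x' U ->
        (exists2 y1, U y1 & F y1 < y1 + k%:~R) /\
        (exists2 y2, U y2 & F y2 > y2 + k%:~R)].

Definition minimal_period f x (n : nat) : Prop :=
  [/\ (0 < n)%N, homeo_fun (f ^+ n)%g x = x &
      forall m : nat, (0 < m)%N -> homeo_fun (f ^+ m)%g x = x -> (n <= m)%N].

Definition crossing_periodic_point f x : Prop :=
  exists2 n : nat, minimal_period f x n & crossing_fixed_point (f ^+ n)%g x.

End dynamics.

(* Main.v *)
Require Import Defs.
From HB Require Import structures.
From mathcomp Require Import all_boot all_order all_algebra.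
From mathcomp Require Import all_classical all_reals all_analysis.
From mathcomp Require Import measurable_realfun zify ring lra.

(** Let f have a lift F, and call f degenerate if for some q > 0 and integer p
the solutions of F^q x = x + p accumulate, or some solution has a neighbourhood
on which F^q x - x - p does not change sign.

Null part. The witness measure is Lebesgue measure on the rotations R_t,
0 <= t <= 1. For fixed q and p the solution t = psi x of
(F + t)^q x = x + p satisfies psi y - psi x <= y - x for x <= y, so psi has total
variation at most 2 over a period and, by the Banach indicatrix (Fatou's lemma),
almost every level has finitely many preimages; a one-sided level over a given
rational interval occurs for at most one t. Hence R_t f is almost surely not
degenerate. An irrational translation number a is taken by F + t for at most one
t: if it were taken on [s, t], a return F^q y - p close to y for the midpoint would
force q a = p.

Classification. If the rotation number is p/q and the periodic points are finitely
many and crossing, G = F^q - p and W = F^a - v, with a p = v q + 1, commute and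
generate the same group as F and the unit translation. Abel's equation, solved first
for G between consecutive fixed points and then for W on the line, conjugates (G, W)
to a model depending only on the number l of fixed points of G modulo W; l is the
number of periodic orbits, and it is even because fixed points alternate between
attracting and repelling.

Non-null part. Given a probability P, some small ball around an element f1 has
positive measure. For k near f1, compose k f1^-1 with a map close to a step function
with N = q m steps and with R_(p/q), then with R_t. For t in a window of length
greater than 2/(2N+1) there are at least 2N solutions per period, while the indicatrix
has integral at most 2: so for a set of t of positive measure there are exactly 2N, and
the product lies in the class with 2m periodic orbits. By Tonelli's theorem some
translate of the class has positive P-measure. *)

Set Implicit Arguments.
Unset Strict Implicit.
Unset Printing Implicit Defensive.

Import Order.TTheory GRing.Theory Num.Theory.
Import numFieldNormedType.Exports.

Local Open Scope classical_set_scope.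
Local Open Scope ring_scope.

(** * Lifts and translation numbers *)

(** Conjugating F directly would mean matching solutions on the intervals that it permutes. The pair
    (G, W) avoids this: G preserves each interval between its consecutive fixed points, while W
    shifts these intervals, so a solution on one fundamental interval of W extends by equivariance.
    On the fixed points of G, W^q is the unit translation and W^p is F. Haar nullity concerns
    two-sided translates. A lift of g R_t h is x |-> A (B x + t), with A and B lifts of g and h. It
    is conjugate by A to B A + t, and this conjugacy does not depend on t; so the families F + t are
    enough. Conjugacy classes are not known here to be Borel. On the null side they are enclosed in
    sets given by countably many conditions over rational intervals, read on the lift with F 0 in
    [0, 1). On the other side the argument runs inside an arbitrary Borel set that contains the
    class. The same measure estimate shows that the class with 2m periodic orbits is not empty; no
    member of it is written down. *)

Section liftings.
Context {R : realType}.
Implicit Types (F G H : R -> R) (x y a b : R).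

Lemma itv_ivt F a b v : continuous F -> a <= b -> F a <= v <= F b ->
  exists2 c, a <= c <= b & F c = v.
Proof.
move=> cF ab /andP[Fav vFb]; have Fab := le_trans Fav vFb.
have [||c cab <-] := @IVT _ F a b v ab.
- exact: continuous_subspaceT.
- by rewrite min_l// max_r// Fav.
- by exists c => //; move: cab; rewrite in_itv.
Qed.

Lemma itv_ivt_opp F a b v : continuous F -> a <= b -> F b <= v <= F a ->
  exists2 c, a <= c <= b & F c = v.
Proof.
move=> cF ab /andP[Fbv vFa].
have [||c cab /oppr_inj <-] := @itv_ivt (fun x => - F x) a b (- v) _ ab.
- by move=> x; apply: cvgN; exact: cF.
- by rewrite !lerN2 vFa.
- by exists c.
Qed.

Lemma incr_mono F : {homo F : x y / x < y} -> {mono F : x y / x < y}.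
Proof. by move=> iF; apply: leW_mono; exact: le_mono. Qed.

Lemma incr_surj_continuous F : {homo F : x y / x < y} ->
  (forall y, exists x, F x = y) -> continuous F.
Proof.
move=> iF sF x; apply/cvgrPdist_lt => e e0.
have [a Fa] := sF (F x - e); have [b Fb] := sF (F x + e).
have ax : a < x by rewrite -(incr_mono iF) Fa gtrBl.
have xb : x < b by rewrite -(incr_mono iF) Fb ltrDl.
near=> y.
have ay : a < y by near: y; exact: lt_nbhsr.
have yb : y < b by near: y; exact: lt_nbhsl.
by move: (iF _ _ ay) (iF _ _ yb); rewrite Fa Fb ltr_distlC => -> ->.
Unshelve. all: by end_near. Qed.

Lemma incr_surj_inv F : {homo F : x y / x < y} ->
  (forall y, exists x, F x = y) ->
  exists G, [/\ cancel F G, cancel G F & {homo G : x y / x < y}].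
Proof.
move=> iF /choice[G FG]; exists G; split=> //.
  by move=> x; apply: (inc_inj (le_mono iF)); rewrite FG.
by move=> x y xy; rewrite -(incr_mono iF) !FG.
Qed.

Definition lifting F :=
  [/\ {homo F : x y / x < y}, (forall y, exists x, F x = y) &
      forall x, F (x + 1) = F x + 1].

Lemma lifting_homeo F : lifting F -> homeomorphism F.
Proof.
move=> [iF sF _]; have [G [FG GF iG]] := incr_surj_inv iF sF.
exists G; split=> //; apply: incr_surj_continuous => //.
by move=> y; exists (F y).
Qed.

Lemma lifting_continuous F : lifting F -> continuous F.
Proof. by move=> [iF sF _]; exact: incr_surj_continuous. Qed.

Lemma lifting_lt F : lifting F -> {mono F : x y / x < y}.
Proof. by move=> [? _ _]; exact: incr_mono. Qed.

Lemma lifting_le F : lifting F -> {mono F : x y / x <= y}.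
Proof. by move=> [? _ _]; exact: le_mono. Qed.

Lemma lifting_inj F : lifting F -> injective F.
Proof. by move=> /lifting_le; exact: inc_inj. Qed.

Lemma lifting_nat F x n : lifting F -> F (x + n%:R) = F x + n%:R.
Proof.
move=> [_ _ F1]; elim: n => [|n ih]; first by rewrite !addr0.
by rewrite -natr1 !addrA F1 ih.
Qed.

Lemma lifting_int F x (k : int) : lifting F -> F (x + k%:~R) = F x + k%:~R.
Proof.
move=> lF; case: k => n; first by rewrite -pmulrn lifting_nat.
by rewrite NegzE mulrNz -pmulrn -{2}(subrK n.+1%:R x) lifting_nat// addrK.
Qed.

Lemma lifting_inv F : lifting F ->
  exists G, [/\ lifting G, cancel F G & cancel G F].
Proof.
move=> lF; have [iF sF F1] := lF; have [G [FG GF iG]] := incr_surj_inv iF sF.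
exists G; split=> //; split=> // [y|x]; first by exists (F y).
by apply: (lifting_inj lF); rewrite F1 !GF.
Qed.

Lemma lifting_id : lifting idfun.
Proof. by split => // y; exists y. Qed.

Lemma lifting_comp F G : lifting F -> lifting G -> lifting (F \o G).
Proof.
move=> [iF sF F1] [iG sG G1]; split=> [x y xy|y|x] /=.
- by apply: iF; exact: iG.
- by have [x <-] := sF y; have [z <-] := sG x; exists z.
- by rewrite G1 F1.
Qed.

Lemma lifting_addr c : lifting (fun x => x + c).
Proof.
by split=> [x y|y|x]; rewrite ?ltrD2r//; [exists (y - c); rewrite subrK|
  rewrite addrAC].
Qed.

Lemma lifting_shift F c : lifting F -> lifting (fun x => F x + c).
Proof. by move=> lF; exact: (lifting_comp (lifting_addr c) lF). Qed.

Lemma lifting_iter F n : lifting F -> lifting (iter n F).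
Proof.
move=> lF; elim: n => [|n ih]; first exact: lifting_id.
exact: (lifting_comp lF ih).
Qed.

Lemma iter_shift F n c x :
  (forall y, F (y + c) = F y + c) ->
  iter n (fun y => F y + c) x = iter n F x + c *+ n.
Proof.
move=> Fc; have FcM m y : F (y + c *+ m) = F y + c *+ m.
  elim: m y => [|m ih] y; first by rewrite !addr0.
  by rewrite mulrS !addrA ih Fc.
by elim: n => [|n ih] /=; rewrite ?addr0// ih FcM mulrS addrA addrAC.
Qed.

Lemma iter_shift_int F n (k : int) x : lifting F ->
  iter n (fun y => F y + k%:~R) x = iter n F x + (k *+ n)%:~R.
Proof.
by move=> lF; rewrite iter_shift => [|y]; rewrite ?mulrMn// ?rmorphMn// lifting_int.
Qed.

Lemma lifting_ler_iter F c q k x : lifting F -> (forall y, F (y + c) = F y + c) ->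
  x + c <= iter q F x -> x + c *+ k <= iter (k * q) F x.
Proof.
move=> lF Fc xc; elim: k => [|k ih]; first by rewrite addr0.
have FcM m y : iter m F (y + c) = iter m F y + c.
  by elim: m => //= m ->; rewrite Fc.
rewrite mulSn addnC iterD mulrSr addrA (le_trans (lerD ih (lexx c)))//.
by rewrite -FcM (lifting_le (lifting_iter _ lF)).
Qed.

Lemma lifting_ger_iter F c q k x : lifting F -> (forall y, F (y + c) = F y + c) ->
  iter q F x <= x + c -> iter (k * q) F x <= x + c *+ k.
Proof.
move=> lF Fc xc; elim: k => [|k ih]; first by rewrite addr0.
have FcM m y : iter m F (y + c) = iter m F y + c.
  by elim: m => //= m ->; rewrite Fc.
rewrite mulSn addnC iterD mulrSr addrA (le_trans _ (lerD ih (lexx c)))//.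
by rewrite -FcM (lifting_le (lifting_iter _ lF)).
Qed.

Lemma int_floor x : exists k : int, k%:~R <= x < k%:~R + 1.
Proof. by exists (Num.floor x); have := floor_itv x; rewrite intrD. Qed.

(** The displacement [F x - x] has period 1 and [F] is increasing, so it oscillates by at most 1.
    The error bounds on translation numbers all come from this. *)
Lemma lifting_disp F x y : lifting F -> `|F x - x - (F y - y)| <= 1.
Proof.
move=> lF; have [k /andP[k1 k2]] := int_floor (y - x).
have h1 : F x + k%:~R <= F y.
  by rewrite -lifting_int// (lifting_le lF) addrC -lerBrDr.
have h2 : F y <= F x + k%:~R + 1.
  have [_ _ F1] := lF; rewrite -lifting_int// -F1 (lifting_le lF); lra.
by rewrite ler_norml; apply/andP; split; lra.
Qed.

Lemma lifting_quasi_morph F m n : lifting F ->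
  `|iter (m + n) F 0 - iter m F 0 - iter n F 0| <= 1.
Proof.
move=> lF; have := lifting_disp (iter n F 0) 0 (lifting_iter m lF).
by rewrite -iterD subr0 -!addrA [- _ - _]addrC.
Qed.

Lemma lifting_quasi_mul F m n : lifting F ->
  `|iter (m * n) F 0 - m%:R * iter n F 0| <= m%:R.
Proof.
move=> lF; elim: m => [|m ih]; first by rewrite mul0r subr0 normr0.
rewrite mulSn -natr1 mulrDl mul1r.
have := lifting_quasi_morph n (m * n) lF.
rewrite !ler_norml => /andP[? ?]; move: ih; rewrite !ler_norml => /andP[? ?].
by apply/andP; split; lra.
Qed.

Lemma natr_mul_bounded (d C : R) : (forall n : nat, n%:R * d <= C) -> d <= 0.
Proof.
move=> h; rewrite leNgt; apply/negP => d0.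
have := h (Num.bound `|C / d|); apply/negP; rewrite -ltNge -ltr_pdivrMr//.
by rewrite (le_lt_trans (ler_norm _))// archi_boundP// normr_ge0.
Qed.

(** The translation number without a limit: [n |-> iter n F 0] is a quasimorphism of defect 1, hence
    stays within 1 of a linear map. Each inequality is a closed condition on [F], which later gives
    measurability. *)
Definition rot F a := forall n, `|iter n F 0 - n%:R * a| <= 1.

(** The closed intervals of radius 1/n about F^n 0 / n meet pairwise, as a comparison of F^(mn) 0
    with m F^n 0 and with n F^m 0 shows; the supremum of their left ends lies in all of them. *)
Lemma rot_exists F : lifting F -> exists a, rot F a.
Proof.
move=> lF; pose S := [set (iter n.+1 F 0 - 1) / n.+1%:R | n in [set: nat]].
have ubS m : ubound S ((iter m.+1 F 0 + 1) / m.+1%:R).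
  move=> _ [n _ <-]; rewrite ler_pdivrMr ?ltr0n// mulrAC ler_pdivlMr ?ltr0n//.
  have := lifting_quasi_mul m.+1 n.+1 lF; have := lifting_quasi_mul n.+1 m.+1 lF.
  rewrite [(n.+1 * _)%N]mulnC !ler_norml => /andP[? ?] /andP[? ?]; lra.
have supS : has_sup S.
  by split; [exists ((iter 1 F 0 - 1) / 1%:R), 0%N | eexists; exact: (ubS 0%N)].
exists (sup S) => -[|n]; first by rewrite mul0r subr0 normr0.
have h1 : (iter n.+1 F 0 - 1) / n.+1%:R <= sup S.
  by apply: ub_le_sup; [case: supS|exists n].
have h2 : sup S <= (iter n.+1 F 0 + 1) / n.+1%:R.
  by apply: ge_sup; [case: supS|exact: ubS].
move: h1 h2; rewrite ler_pdivrMr ?ltr0n// ler_pdivlMr ?ltr0n// => ? ?.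
by rewrite ler_norml; apply/andP; split; lra.
Qed.

Lemma rot_translation_number F a : rot F a -> translation_number F = a.
Proof.
move=> ra; apply/cvg_lim => //; apply/cvgrPdist_le => e e0.
near=> n; have n0 : (0 < n%:R :> R).
  by rewrite ltr0n; near: n; exact: nbhs_infty_gt.
have := ra n; rewrite subr0 distrC => h.
rewrite (_ : a - _ = (n%:R * a - iter n F 0) / n%:R); last by field; lra.
rewrite normrM normfV (gtr0_norm n0) ler_pdivrMr// (le_trans h)//.
rewrite -ler_pdivrMl// mulr1.
by near: n; exact: nbhs_infty_ger.
Unshelve. all: by end_near. Qed.

Lemma rot_point F a x n : lifting F -> rot F a ->
  `|iter n F x - x - n%:R * a| <= 2.
Proof.
move=> lF /(_ n); have := lifting_disp x 0 (lifting_iter n lF).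
by rewrite !ler_norml => /andP[? ?] /andP[? ?]; apply/andP; split; lra.
Qed.

Lemma rot_le F G a b C : lifting F -> lifting G -> rot F a -> rot G b ->
  (forall n, iter n F 0 <= iter n G 0 + C) -> a <= b.
Proof.
move=> lF lG ra rb FG; rewrite -subr_le0; apply: (@natr_mul_bounded _ (C + 2)) => n.
move: (ra n) (rb n) (FG n); rewrite !ler_norml => /andP[? ?] /andP[? ?] ?; lra.
Qed.

Lemma rot_ge_ratio F a x q (p : int) : lifting F -> rot F a ->
  x + p%:~R <= iter q F x -> p%:~R <= q%:R * a.
Proof.
move=> lF ra h; rewrite -subr_le0; apply: (@natr_mul_bounded _ 2) => k.
have := lifting_ler_iter k lF (fun y => lifting_int y p lF) h.
have := rot_point x (k * q) lF ra; rewrite natrM -mulr_natl ler_norml.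
by move=> /andP[? ?] ?; lra.
Qed.

Lemma rot_le_ratio F a x q (p : int) : lifting F -> rot F a ->
  iter q F x <= x + p%:~R -> q%:R * a <= p%:~R.
Proof.
move=> lF ra h; rewrite -subr_le0; apply: (@natr_mul_bounded _ 2) => k.
have := lifting_ger_iter k lF (fun y => lifting_int y p lF) h.
have := rot_point x (k * q) lF ra; rewrite natrM -mulr_natl ler_norml.
by move=> /andP[? ?] ?; lra.
Qed.

Lemma rot_periodic F a x q (p : int) : lifting F -> rot F a ->
  iter q F x = x + p%:~R -> q%:R * a = p%:~R.
Proof.
move=> lF ra h; apply/eqP; rewrite eq_le.
by rewrite (@rot_le_ratio F _ x)// ?h// (@rot_ge_ratio F _ x)// h.
Qed.

Lemma rot_shift_int F a (k : int) : lifting F -> rot F a ->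
  rot (fun x => F x + k%:~R) (a + k%:~R).
Proof.
move=> lF ra n; rewrite iter_shift_int// mulrDr.
by rewrite rmorphMn -mulr_natl opprD addrACA subrr addr0.
Qed.

Lemma rot_conj F F' H a : lifting F -> lifting F' -> lifting H ->
  (forall x, H (F x) = F' (H x)) -> rot F a -> rot F' a.
Proof.
move=> lF lF' lH HF ra; have [b rb] := rot_exists lF'.
have HFn n x : H (iter n F x) = iter n F' (H x).
  by elim: n => //= n <-; rewrite HF.
suff -> : a = b by [].
have hb n : `|iter n F' 0 - iter n F 0| <= 2 + `|H 0|.
  have := lifting_disp (iter n F 0) 0 lH.
  have := lifting_disp (H 0) 0 (lifting_iter n lF').
  rewrite -HFn !ler_norml !subr0 => /andP[? ?] /andP[? ?].
  by have := ler_norm (H 0); have := ler_norm (- H 0); rewrite normrN => ? ?;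
    apply/andP; split; lra.
apply/eqP; rewrite eq_le (rot_le (C := 2 + `|H 0|) lF lF')//.
  rewrite (rot_le (C := 2 + `|H 0|) lF' lF)// => n.
  by have := hb n; rewrite ler_norml => /andP[? ?]; lra.
by move=> n; have := hb n; rewrite ler_norml => /andP[? ?]; lra.
Qed.

Lemma lifting_ivt_zero F q (p : int) x y : lifting F ->
  iter q F x <= x + p%:~R -> y + p%:~R <= iter q F y ->
  exists z, iter q F z = z + p%:~R.
Proof.
move=> lF hx hy; have [k /andP[k1 k2]] := int_floor (x - y).
have lq := lifting_iter q lF.
pose h z := iter q F z - z; have ch : continuous h.
  by move=> z; apply: cvgB; [exact: lifting_continuous|exact: cvg_id].
have [||z _ hz] := @itv_ivt_opp h (y + k%:~R) x p%:~R ch.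
- lra.
- by rewrite /h lifting_int//; apply/andP; split; lra.
by exists z; rewrite -hz /h addrC subrK.
Qed.

(** A displacement [F^q x - x] that never equals [p] stays on one side of it by a uniform [e > 0],
    by compactness of a period. Then F^(kq) 0 drifts away from k p by at least k e, against the
    bound of [rot_point]. *)
Lemma rot_rational_periodic F a q (p : int) : lifting F -> rot F a -> (0 < q)%N ->
  q%:R * a = p%:~R -> exists x, iter q F x = x + p%:~R.
Proof.
move=> lF ra q0 qa; apply: contrapT => nox.
have lq := lifting_iter q lF.
pose h z := iter q F z - z; have ch : continuous h.
  by move=> z; apply: cvgB; [exact: lifting_continuous|exact: cvg_id].
have h1 z (k : int) : h (z + k%:~R) = h z by rewrite /h lifting_int//; ring.
have gap e : 0 < e -> ~ (forall x, h x + e <= p%:~R) /\ ~ (forall x, p%:~R + e <= h x).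
  move=> e0; have key k : `|iter (k * q) F 0 - k%:R * p%:~R| <= 2.
    have := rot_point 0 (k * q) lF ra; rewrite natrM -mulrA qa subr0//.
  split=> hx.
    suff : e <= 0 by rewrite leNgt e0.
    apply: (@natr_mul_bounded _ 2) => k.
    suff : iter (k * q) F 0 <= k%:R * (p%:~R - e).
      by have := key k; rewrite ler_norml => /andP[? ?] ?; lra.
    elim: k => [|k ih]; first by rewrite mul0r.
    rewrite mulSn iterD -natr1; have := hx (iter (k * q) F 0).
    by rewrite /h => ?; lra.
  suff : e <= 0 by rewrite leNgt e0.
  apply: (@natr_mul_bounded _ 2) => k.
  suff : k%:R * (p%:~R + e) <= iter (k * q) F 0.
    by have := key k; rewrite ler_norml => /andP[? ?] ?; lra.
  elim: k => [|k ih]; first by rewrite mul0r.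
  rewrite mulSn iterD -natr1; have := hx (iter (k * q) F 0).
  by rewrite /h => ?; lra.
have [|m m01 hm] := EVT_min (@ler01 R) (f := h); first exact: continuous_subspaceT.
have [|M M01 hM] := EVT_max (@ler01 R) (f := h); first exact: continuous_subspaceT.
have fr x : exists2 y, y \in `[0, 1] & h y = h x.
  have [k /andP[k1 k2]] := int_floor x; exists (x - k%:~R).
    by rewrite in_itv/=; apply/andP; split; lra.
  by rewrite -mulrNz h1.
have hmx x : h m <= h x by have [y /hm hy <-] := fr x.
have hMx x : h x <= h M by have [y /hM hy <-] := fr x.
have [hMp|hMp] := ltP (h M) p%:~R.
  apply: (gap (p%:~R - h M) _).1; rewrite ?subr_gt0// => x.
  by have := hMx x; lra.
have [hmp|hmp] := ltP p%:~R (h m).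
  apply: (gap (h m - p%:~R) _).2; rewrite ?subr_gt0// => x.
  by have := hmx x; lra.
apply: nox; apply: (lifting_ivt_zero (x := m) (y := M)) => //.
  by rewrite addrC -lerBlDr.
by rewrite addrC -lerBrDr.
Qed.

End liftings.

(** * Irrational translation numbers in the family F + t *)

Section irrational_rotation.
Context {R : realType}.
Implicit Types (F G : R -> R) (x y : R).

Lemma iter_le_mono F G n x y : lifting F -> (forall z, F z <= G z) -> x <= y ->
  iter n F x <= iter n G y.
Proof.
move=> lF FG xy; elim: n => //= n ih.
by rewrite (le_trans _ (FG _))// (lifting_le lF).
Qed.

(** Dirichlet's box principle for fractional parts, with more than 1/e boxes. *)
Lemma pigeonhole_mod1 (u : nat -> R) (e : R) : 0 < e ->
  exists m n, (m < n)%N /\ exists p : int, `|u n - u m - p%:~R| < e.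
Proof.
move=> e0; pose N := Num.bound e^-1.
have eN : e^-1 < N.+1%:R.
  rewrite (@lt_trans _ _ N%:R) ?ltr_nat// archi_boundP// invr_ge0 ltW//.
pose fr x := x - (Num.floor x)%:~R.
have fr01 x : 0 <= fr x < 1.
  by have := floor_itv x; rewrite intrD /fr => /andP[? ?]; apply/andP; split; lra.
pose c (i : nat) := Num.truncn (N.+1%:R * fr (u i)).
have hc i : (c i)%:R <= N.+1%:R * fr (u i) < (c i)%:R + 1.
  rewrite /c natr1; apply: truncn_itv.
  by rewrite mulr_ge0//; case/andP: (fr01 (u i)).
have cN i : (c i < N.+1)%N.
  rewrite -(ltr_nat R); have /andP[h _] := hc i; apply: (le_lt_trans h).
  by rewrite gtr_pMr ?ltr0n//; case/andP: (fr01 (u i)).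
pose f (i : 'I_N.+2) : 'I_N.+1 := Ordinal (cN i).
have : ~~ injectiveb f.
  apply/negP => /injectiveP /leq_card; by rewrite !card_ord ltnn.
have close i j : c i = c j -> `|u j - u i - (Num.floor (u j) - Num.floor (u i))%:~R| < e.
  move=> cij; have := hc i; have := hc j; rewrite cij => /andP[a1 a2] /andP[b1 b2].
  rewrite intrB (_ : _ - _ = fr (u j) - fr (u i)); last by rewrite /fr; ring.
  have : N.+1%:R * `|fr (u j) - fr (u i)| < 1.
    rewrite -[X in X * _](@ger0_norm R)// -normrM ltr_norml mulrBr.
    by apply/andP; split; lra.
  rewrite -ltr_pdivlMl ?ltr0n// mulr1 => /lt_trans; apply.
  by rewrite invf_plt ?posrE ?ltr0n.
move=> /injectivePn[i [j ij /(congr1 val)/= cij]].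
have [lij|lij|/val_inj eij] := ltngtP i j; last by rewrite eij eqxx in ij.
  by exists i, j; split=> //; eexists; exact: close.
by exists j, i; split=> //; eexists; exact: close.
Qed.

Lemma rot_irrational_strict F a s t : lifting F ->
  (forall q (p : int), (0 < q)%N -> q%:R * a <> p%:~R) -> s < t ->
  rot (fun x => F x + s) a -> rot (fun x => F x + t) a -> False.
Proof.
move=> lF irr st ras rat.
set m := (s + t) / 2; pose G x := F x + m; pose d := (t - s) / 2.
have d0 : 0 < d by rewrite divr_gt0// subr_gt0.
have [lFs lFt lG] : [/\ lifting (fun x => F x + s), lifting (fun x => F x + t) &
  lifting G] by split; exact: lifting_shift.
have sm : s <= m by rewrite /m; lra.
have mt : m <= t by rewrite /m; lra.
have sG n x : iter n (fun x => F x + s) x <= iter n G x.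
  by apply: iter_le_mono => // z; rewrite lerD2l.
have Gt n x : iter n G x <= iter n (fun x => F x + t) x.
  by apply: iter_le_mono => // z; rewrite lerD2l.
have [b rb] := rot_exists lG.
have ab : a = b.
  apply/eqP; rewrite eq_le (rot_le (C := 0) lFs lG)//=; last first.
    by move=> n; rewrite addr0.
  by rewrite (rot_le (C := 0) lG lFt)// => n; rewrite addr0.
rewrite -{}ab {b} in rb.
have [i [j [ij [p hp]]]] := pigeonhole_mod1 (fun n => iter n G 0) d0.
pose q := (j - i)%N; pose y := iter i G 0.
have q0 : (0 < q)%N by rewrite subn_gt0.
have {}hp : `|iter q G y - y - p%:~R| < d.
  by rewrite /y -iterD subnK// ltnW.
have qs k x : iter k.+1 (fun x => F x + s) x + d <= iter k.+1 G x.
  have : F (iter k (fun x => F x + s) x) <= F (iter k G x) by rewrite (lifting_le lF).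
  have -> : iter k.+1 G x = F (iter k G x) + m by [].
  by rewrite /= /d /m => ?; lra.
have qt k x : iter k.+1 G x + d <= iter k.+1 (fun x => F x + t) x.
  have : F (iter k G x) <= F (iter k (fun x => F x + t) x) by rewrite (lifting_le lF).
  have -> : iter k.+1 G x = F (iter k G x) + m by [].
  by rewrite /= /d /m => ?; lra.
have qE : q = q.-1.+1 by rewrite prednK.
apply: (irr q p q0); apply/eqP; rewrite eq_le.
(* The point [y] returns within [d], and [s], [t] lie at distance [d] from the midpoint [m]. If the
   return falls short, the parameter [t] carries it to [y + p] or beyond; otherwise [s] brings it
   down to [y + p] or below. The two parameters then bound [q a] from opposite sides. *)
have [h|h] := leP (iter q G y) (y + p%:~R).
  rewrite (rot_le_ratio lG rb h)//; apply: (rot_ge_ratio (x := y) lFt rat).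
  have := qt q.-1 y; rewrite -qE; move: hp; rewrite ltr_norml => /andP[? ?] ?; lra.
rewrite (rot_ge_ratio (x := y) lG rb (ltW h)) andbT.
apply: (rot_le_ratio (x := y) lFs ras).
by have := qs q.-1 y; rewrite -qE; move: hp; rewrite ltr_norml => /andP[? ?] ?; lra.
Qed.

End irrational_rotation.

(** * Abel's equation *)

Section abel_equation.
Context {R : realType}.
Implicit Types (U V : R -> R) (x y : R).

Definition zpow U V (k : int) x :=
  match k with Posz n => iter n U x | Negz n => iter n.+1 V x end.

Lemma zpowD1 U V k x : cancel V U -> zpow U V (k + 1) x = U (zpow U V k x).
Proof.
move=> VU; case: k => [n|[|n]]; first by rewrite -PoszD addn1.
  by rewrite NegzE addNr /= VU.
rewrite !NegzE (_ : - n.+2%:Z + 1 = - n.+1%:Z); first by rewrite -!NegzE /= VU.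
by rewrite -[n.+2]addn1 PoszD opprD subrK.
Qed.

Lemma zpowB1 U V k x : cancel U V -> cancel V U ->
  zpow U V (k - 1) x = V (zpow U V k x).
Proof. by move=> UV VU; rewrite -{2}(subrK 1 k) zpowD1// UV. Qed.

Lemma zpow_add U V k l x : cancel U V -> cancel V U ->
  zpow U V (k + l) x = zpow U V k (zpow U V l x).
Proof.
move=> UV VU; elim/int_rec: k => [|n ih|n ih]; first by rewrite add0r.
  by rewrite -addn1 PoszD addrAC !zpowD1// ih.
by rewrite -addn1 PoszD opprD addrAC !zpowB1// ih.
Qed.

Lemma zpow_lt U V k : {homo U : x y / x < y} -> {homo V : x y / x < y} ->
  {homo zpow U V k : x y / x < y}.
Proof. by move=> iU iV x y xy; case: k => n /=; elim: n => /=; auto. Qed.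

Lemma zpow_comm U V (H : R -> R) k x : cancel U V -> cancel V U ->
  (forall y, H (U y) = U (H y)) -> H (zpow U V k x) = zpow U V k (H x).
Proof.
move=> UV VU HU; have HV y : H (V y) = V (H y) by rewrite -{2}(VU y) HU UV.
elim/int_rec: k => [//|n ih|n ih]; first by rewrite -addn1 PoszD !zpowD1// HU ih.
by rewrite -addn1 PoszD opprD !zpowB1// HV ih.
Qed.

Section extension.
Context (U V : R -> R) (c lam : R) (th : R -> R)
  (iU : {homo U : x y / x < y}) (iV : {homo V : x y / x < y})
  (UV : cancel U V) (VU : cancel V U) (cU : c < U c) (lam0 : 0 < lam).

Notation "U ^: k" := (zpow U V k) (at level 30).

Lemma zpow_base_lt (k l : int) : k < l -> (U ^: k) c < (U ^: l) c.
Proof.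
have step (m : int) : (U ^: m) c < (U ^: (m + 1)) c.
  by rewrite zpow_add//; apply: zpow_lt.
move=> kl; have [n ->] : exists n : nat, l = k + n.+1%:Z.
  exists `|l - k|.-1%N; rewrite prednK ?absz_gt0 ?subr_eq0 ?gt_eqF//.
  by rewrite gez0_abs ?subr_ge0 1?ltW// addrCA subrr addr0.
elim: n => [|n ih]; first exact: step.
by rewrite (lt_trans ih)// -[n.+2]addn1 PoszD addrA step.
Qed.

Lemma zpow_base_le (k l : int) : k <= l -> (U ^: k) c <= (U ^: l) c.
Proof. by rewrite le_eqVlt => /predU1P[->//|/zpow_base_lt/ltW]. Qed.

(** The orbit of [c] need not be unbounded: for a map of an interval it only fills that interval, so
    the set it spans has to be named. *)
Definition zspan : set R :=
  [set x | exists m n, (U ^: m) c <= x < (U ^: n) c].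

Lemma zspan_cell x : zspan x -> exists k, (U ^: k) c <= x < (U ^: (k + 1)) c.
Proof.
move=> [m [n /andP[mx xn]]].
have mn : m < n by rewrite ltNge; apply/negP => /zpow_base_le; lra.
suff h (d : nat) (e : int) : (U ^: e) c <= x -> x < (U ^: (e + d%:Z)) c ->
    exists k, (U ^: k) c <= x < (U ^: (k + 1)) c.
  apply: (h `|n - m|%N m mx); rewrite gez0_abs ?subr_ge0 ?ltW//.
  by rewrite addrCA subrr addr0.
elim: d e => [|d ih] e ex xe; first by move: xe; rewrite addr0; lra.
have [h|h] := ltP x ((U ^: (e + 1)) c); first by exists e; rewrite ex h.
by apply: (ih (e + 1)) => //; rewrite -addrA -PoszD add1n.
Qed.

Lemma zcell_unique x k l : (U ^: k) c <= x < (U ^: (k + 1)) c ->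
  (U ^: l) c <= x < (U ^: (l + 1)) c -> k = l.
Proof.
move=> /andP[k1 k2] /andP[l1 l2]; have [kl|kl|//] := ltgtP k l.
  have /zpow_base_le : k + 1 <= l by rewrite lezD1.
  by move=> h; exfalso; lra.
have /zpow_base_le : l + 1 <= k by rewrite lezD1.
by move=> h; exfalso; lra.
Qed.

Context (th_incr : forall x y, c <= x -> x < y -> y < U c -> th x < th y)
  (th_range : forall x, c <= x < U c -> 0 <= th x < lam)
  (th_surj : forall y, 0 <= y < lam -> exists2 x, c <= x < U c & th x = y).

Lemma zpow_cell0 x k : (U ^: k) c <= x < (U ^: (k + 1)) c ->
  c <= (U ^: (- k)) x < U c.
Proof.
have hk y : (U ^: (- k)) ((U ^: k) y) = y by rewrite -zpow_add// addNr.
have le_k := le_mono (@zpow_lt U V (- k) iU iV).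
have lt_k := incr_mono (@zpow_lt U V (- k) iU iV).
move=> /andP[k1 k2]; apply/andP; split; first by rewrite -(hk c) le_k.
by rewrite -(hk (U c)) lt_k -(_ : (U ^: 1) c = U c)// -zpow_add.
Qed.

(** The interval [c, U c) is a fundamental domain: a point of [zspan] is U^k x0 for a unique [k] and
    a unique x0 in it, and the value th x0 + k lam is forced. The range [0, lam) of [th] gives
    monotonicity across cells. *)
Lemma abel_extension : exists Th : R -> R,
  [/\ forall x, c <= x < U c -> Th x = th x,
      forall x, zspan x -> Th (U x) = Th x + lam,
      (forall x y, zspan x -> zspan y -> x < y -> Th x < Th y) &
      forall y, exists2 x, zspan x & Th x = y].
Proof.
(* Keeping the hypothesis inside the existential leaves [Th] arbitrary off [zspan]. *)
have ex x : exists y, zspan x -> exists k,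
    (U ^: k) c <= x < (U ^: (k + 1)) c /\ y = th ((U ^: (- k)) x) + k%:~R * lam.
  have [/zspan_cell[k hk]|nx] := pselect (zspan x).
    by exists (th ((U ^: (- k)) x) + k%:~R * lam) => _; exists k.
  by exists 0.
have [Th hTh] := choice ex; exists Th.
have ThE x k : (U ^: k) c <= x < (U ^: (k + 1)) c ->
    Th x = th ((U ^: (- k)) x) + k%:~R * lam.
  move=> hx; have [|l [hl ->]] := hTh x; first by exists k, (k + 1).
  by rewrite (zcell_unique hx hl).
have cellU x k : (U ^: k) c <= x < (U ^: (k + 1)) c ->
    (U ^: (k + 1)) c <= U x < (U ^: (k + 1 + 1)) c.
  by rewrite !(zpowD1 _ _ VU) (le_mono iU) (incr_mono iU).
split.
- move=> x hx; rewrite (ThE x 0); first by rewrite mul0r addr0.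
  by rewrite add0r.
- move=> x /zspan_cell[k hx]; rewrite (ThE _ _ (cellU _ _ hx)) (ThE _ _ hx).
  rewrite intrD mulrDl mul1r addrA; congr (th _ + _ + _).
  by rewrite opprD zpow_add//= UV.
- move=> x y /zspan_cell[k hx] /zspan_cell[l hy] xy.
  rewrite (ThE _ _ hx) (ThE _ _ hy).
  have /andP[kx1 kx2] := zpow_cell0 hx; have /andP[ly1 ly2] := zpow_cell0 hy.
  have [kl|kl|kl] := ltgtP k l; last first.
  + by subst l; rewrite ltrD2r; apply: th_incr => //; exact: zpow_lt.
  + have /zpow_base_le : l + 1 <= k by rewrite lezD1.
    move: hx hy => /andP[hx _] /andP[_ hy]; lra.
  + have /andP[_ h1] := th_range (zpow_cell0 hx).
    have /andP[h2 _] := th_range (zpow_cell0 hy).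
    have : (k + 1)%:~R * lam <= l%:~R * lam.
      by rewrite ler_pM2r// ler_int lezD1.
    by rewrite intrD mulrDl mul1r; lra.
- move=> y; have [k /andP[k1 k2]] := int_floor (y / lam).
  have hk : 0 <= y - k%:~R * lam < lam.
    by move: k1 k2; rewrite ler_pdivlMr// ltr_pdivrMr// mulrDl mul1r => ? ?; lra.
  have [x /andP[x1 x2] hx] := th_surj hk.
  have hc : (U ^: k) c <= (U ^: k) x < (U ^: (k + 1)) c.
    rewrite zpow_add// (le_mono (@zpow_lt U V k iU iV)) (incr_mono (@zpow_lt U V k iU iV)).
    by rewrite x1.
  exists ((U ^: k) x); first by exists k, (k + 1).
  by rewrite (ThE _ _ hc) -zpow_add// addNr/= hx subrK.
Qed.

End extension.

(** The orbit of the midpoint exhausts the open interval: its infimum, if larger than [z], would be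
    moved up by [U], so the preimage of some orbit point would lie below it; likewise for the
    supremum. Any increasing bijection of a fundamental domain onto [0, 1) then works, and the
    affine one is taken. *)
Lemma interval_abel U V z w : {homo U : x y / x < y} -> {homo V : x y / x < y} ->
  cancel U V -> cancel V U -> z < w -> U z = z -> U w = w ->
  (forall x, z < x < w -> x < U x) ->
  exists A : R -> R,
  [/\ forall x, z < x < w -> A (U x) = A x + 1,
      (forall x y, z < x -> x < y -> y < w -> A x < A y) &
      forall y, exists2 x, z < x < w & A x = y].
Proof.
move=> iU iV UV VU zw Uz Uw Ux; pose c := (z + w) / 2.
have Vz : V z = z by rewrite -{1}Uz UV.
have Vw : V w = w by rewrite -{1}Uw UV.
have zcw : z < c < w by rewrite /c; apply/andP; split; lra.
have cU := Ux _ zcw; have cUc : 0 < U c - c by rewrite subr_gt0.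
have Vx x : z < x < w -> V x < x.
  move=> /andP[zx xw]; rewrite -{2}(VU x) Ux//.
  by rewrite -Vz -Vw !(incr_mono iV) zx.
have zpow_in k : z < zpow U V k c < w.
  case: k => n /=; elim: n => /= [|n /andP[ih1 ih2]] //.
  - by rewrite -Uz -Uw !(incr_mono iU) ih1.
  - by case/andP: zcw => ? ?; rewrite -Vz -Vw !(incr_mono iV); apply/andP.
  - by rewrite -Vz -Vw !(incr_mono iV) ih1.
have spanE x : z < x < w -> zspan U V c x.
  move=> /andP[zx xw].
  have [m hm] : exists m, zpow U V m c <= x.
    apply: contrapT => /forallNP nom.
    have {}nom m : x < zpow U V m c by rewrite ltNge; apply/negP/nom.
    pose S := range (zpow U V ^~ c).
    have infS : has_inf S.
      by split; [exists (zpow U V 0 c), 0 | exists x => _ [m _ <-]; exact: ltW].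
    have xi : x <= inf S by apply: lb_le_inf; [case: infS|move=> _ [m _ <-]; exact: ltW].
    have iSw : z < inf S < w.
      rewrite (lt_le_trans zx xi)/=; case/andP: (zpow_in 0) => _; apply: le_lt_trans.
      by apply: ge_inf; [case: infS|exists 0].
    have e0 : 0 < U (inf S) - inf S by rewrite subr_gt0 Ux.
    have [_ [m _ <-] hm] := inf_adherent e0 infS.
    rewrite addrCA subrr addr0 in hm.
    have : inf S <= zpow U V (m - 1) c by apply: ge_inf; [case: infS|exists (m - 1)].
    by rewrite zpowB1// leNgt -(incr_mono iU) VU hm.
  have [n hn] : exists n, x < zpow U V n c.
    apply: contrapT => /forallNP nom.
    have {}nom k : zpow U V k c <= x by rewrite leNgt; apply/negP/nom.
    pose S := range (zpow U V ^~ c).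
    have supS : has_sup S.
      by split; [exists (zpow U V 0 c), 0 | exists x => _ [m' _ <-]].
    have xi : sup S <= x by apply: ge_sup; [case: supS|move=> _ [m' _ <-]].
    have iSw : z < sup S < w.
      rewrite (le_lt_trans xi xw) andbT; case/andP: (zpow_in 0) => + _.
      move=> /lt_le_trans; apply.
      by apply: ub_le_sup; [case: supS|exists 0].
    have e0 : 0 < sup S - V (sup S) by rewrite subr_gt0 Vx.
    have [_ [k _ <-] hk] := sup_adherent e0 supS.
    rewrite opprB addrCA subrr addr0 in hk.
    have : zpow U V (k + 1) c <= sup S by apply: ub_le_sup; [case: supS|exists (k + 1)].
    by rewrite zpowD1// leNgt -(incr_mono iV) UV hk.
  by exists m, n; rewrite hm.
pose th x := (x - c) / (U c - c).
have [|||A [_ AU Ai As]] := @abel_extension U V c 1 th iU iV UV VU cU ltr01.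
- by move=> x y cx xy yU; rewrite ltr_pM2r ?invr_gt0// ltrD2r.
- move=> x /andP[cx xU]; rewrite /th divr_ge0 ?subr_ge0 ?(ltW cU)//=.
  by rewrite ltr_pdivrMr// mul1r ltrD2r.
- move=> y /andP[y0 y1]; exists (c + y * (U c - c)).
    rewrite lerDl mulr_ge0 ?(ltW cUc)//= -ltrBrDl gtr_pMl//.
  by rewrite /th addrC addKr mulfK// gt_eqF.
have spanI x : zspan U V c x -> z < x < w.
  move=> [m [n /andP[h1 h2]]]; case/andP: (zpow_in m); case/andP: (zpow_in n); lra.
exists A; split.
- by move=> x /spanE; exact: AU.
- move=> x y zx xy yw; apply: Ai => //; apply: spanE.
    by rewrite zx (lt_trans xy).
  by rewrite yw (lt_trans zx).
- by move=> y; have [x /spanI ? <-] := As y; exists x.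
Qed.

End abel_equation.

(** * Normal form of commuting pairs *)

Section normal_form.
Context {R : realType}.
Implicit Types (x y r : R).

(** The map that multiplies r / (1 - r) by [c]; in the logistic coordinate it is the translation by
    ln c. With [parity_rate] the translation is by 1 or by -1. *)
Definition mob (c r : R) := c * r / (1 - r + c * r).

Definition parity_rate (b : bool) : R := expR ((-1) ^+ b).

(* A model of a homeomorphism with crossing fixed points exactly at the
   integers, repelling at the even ones and attracting at the odd ones. *)
Definition model (y : R) : R :=
  (Num.floor y)%:~R +
  mob (parity_rate (odd `|Num.floor y|%N)) (y - (Num.floor y)%:~R).

Lemma model_int_add (n : int) r : 0 <= r < 1 ->
  model (n%:~R + r) = n%:~R + mob (parity_rate (odd `|n|%N)) r.
Proof.
move=> r01; have fl : Num.floor (n%:~R + r) = n.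
  by apply: floor_def; rewrite intrD lerDl ltrD2l.
by rewrite /model fl [X in mob _ X]addrAC subrr add0r.
Qed.

Lemma odd_absz_add (m n : int) : odd (absz (m + n)) = odd (absz m) (+) odd (absz n).
Proof. lia. Qed.

Lemma odd_absz_even (m : int) (n : nat) : ~~ odd n -> odd (absz (m * n%:Z)) = false.
Proof. by move=> en; rewrite abszM oddM (negbTE en) andbF. Qed.

Definition logistic x : R := expR x / (1 + expR x).

Lemma logistic_itv x : 0 < logistic x < 1.
Proof.
have := expR_gt0 x => e0; rewrite /logistic divr_gt0 ?addr_gt0//=.
by rewrite ltr_pdivrMr ?addr_gt0// mul1r ltrDr.
Qed.

Lemma logistic_incr : {homo logistic : x y / x < y}.
Proof.
move=> x y; rewrite -ltr_expR => xy; have := expR_gt0 x; have := expR_gt0 y.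
move=> y0 x0; rewrite /logistic ltr_pdivrMr ?addr_gt0// mulrAC.
by rewrite ltr_pdivlMr ?addr_gt0//; nra.
Qed.

Lemma logistic_surj r : 0 < r < 1 -> exists x, logistic x = r.
Proof.
move=> /andP[r0 r1]; exists (ln (r / (1 - r))).
have r1' : 0 < 1 - r by rewrite subr_gt0.
by rewrite /logistic lnK ?posrE ?divr_gt0//; field; lra.
Qed.

Lemma logistic_mob x c : logistic (x + c) = mob (expR c) (logistic x).
Proof.
rewrite /logistic /mob expRD; have := expR_gt0 x; have := expR_gt0 c => c0 x0.
have xc0 : 0 < expR x * expR c by rewrite mulr_gt0.
by field; apply/andP; split; apply: lt0r_neq0; lra.
Qed.

Lemma interval_conj (U V : R -> R) z w (b : bool) :
  {homo U : x y / x < y} -> {homo V : x y / x < y} ->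
  cancel U V -> cancel V U -> z < w -> U z = z -> U w = w ->
  (forall x, z < x < w -> if b then U x < x else x < U x) ->
  exists h : R -> R,
  [/\ h z = 0, (forall x, z < x < w -> 0 < h x < 1),
      (forall x y, z < x -> x < y -> y < w -> h x < h y),
      (forall r, 0 < r < 1 -> exists2 x, z < x < w & h x = r) &
      forall x, z <= x < w -> h (U x) = mob (parity_rate b) (h x)].
Proof.
move=> iU iV UV VU zw Uz Uw Ux.
have Vz : V z = z by rewrite -{1}Uz UV.
have Vw : V w = w by rewrite -{1}Uw UV.
have Uin x : z < x < w -> z < U x < w.
  by move=> ?; rewrite -Uz -Uw !(incr_mono iU).
have [A [AU Ai As]] : exists A : R -> R,
  [/\ forall x, z < x < w -> A (U x) = A x + (-1) ^+ b,
      (forall x y, z < x -> x < y -> y < w -> A x < A y) &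
      forall y, exists2 x, z < x < w & A x = y].
  (* When [U] moves points down, Abel's equation is solved for the inverse [V]; its step 1 becomes
     -1 for [U]. *)
  case: b Ux => Ux; last exact: (interval_abel iU iV UV VU zw Uz Uw Ux).
  have Vx x : z < x < w -> x < V x.
    move=> xzw; rewrite -{1}(VU x) Ux//.
    by rewrite -Vz -Vw !(incr_mono iV).
  have [A [AV Ai As]] := interval_abel iV iU VU UV zw Vz Vw Vx.
  by exists A; split=> // x /Uin/AV; rewrite UV expr1 => ->; rewrite addrK.
exists (fun x => if x == z then 0 else logistic (A x)); split.
- by rewrite eqxx.
- by move=> x /andP[zx _]; rewrite gt_eqF// logistic_itv.
- move=> x y zx xy yw; rewrite !gt_eqF ?(lt_trans zx xy)//.
  by apply: logistic_incr; exact: Ai.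
- move=> r /logistic_surj[y <-]; have [x xzw <-] := As y; exists x => //.
  by case/andP: xzw => zx _; rewrite gt_eqF.
- move=> x /andP[]; rewrite le_eqVlt => /predU1P[<- _|zx xw].
    by rewrite Uz eqxx /mob mulr0 mul0r.
  have xzw : z < x < w by rewrite zx.
  have /andP[zUx _] := Uin _ xzw.
  by rewrite !gt_eqF// AU// logistic_mob.
Qed.

Lemma zpow_additive (U V : R -> R) (Th : R -> R) lam k x :
  cancel U V -> cancel V U -> (forall y, Th (U y) = Th y + lam) ->
  Th (zpow U V k x) = Th x + k%:~R * lam.
Proof.
move=> UV VU ThU; have ThV y : Th (V y) = Th y - lam.
  by rewrite -{2}(VU y) ThU addrK.
elim/int_rec: k => [|n ih|n ih]; first by rewrite mul0r addr0.
  by rewrite -addn1 PoszD zpowD1// ThU ih intrD; ring.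
by rewrite -addn1 PoszD opprD zpowB1// ThV ih intrB; ring.
Qed.

Definition crossing_at (G : R -> R) z := forall e, 0 < e ->
  (exists2 y, `|y - z| < e & G y < y) /\ (exists2 y, `|y - z| < e & y < G y).

(** This makes the sign of [G x - x] alternate between two adjacent intervals on which it is
    constant. *)
Lemma crossing_at_sides (G : R -> R) u v w : crossing_at G v -> G v = v ->
  u < v -> v < w ->
  ~ (forall x, u < x < v \/ v < x < w -> x < G x) /\
  ~ (forall x, u < x < v \/ v < x < w -> G x < x).
Proof.
move=> cr Gv uv vw.
pose e := Num.min (v - u) (w - v).
have e0 : 0 < e by rewrite lt_min !subr_gt0 uv.
have near y : `|y - v| < e -> y != v -> u < y < v \/ v < y < w.
  rewrite ltr_norml lt_min ltrNl lt_min => /andP[/andP[? ?] /andP[? ?]] yv.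
  have [h|h|h] := ltgtP y v; [left|right|by rewrite h eqxx in yv];
    apply/andP; split; lra.
have [[y1 yv1 Gy1] [y2 yv2 Gy2]] := cr _ e0.
split=> h.
  have /near : y1 != v by apply: contraTneq Gy1 => ->; rewrite Gv ltxx.
  by move=> /(_ yv1) /h /(lt_trans Gy1); rewrite ltxx.
have /near : y2 != v by apply: contraTneq Gy2 => ->; rewrite Gv ltxx.
by move=> /(_ yv2) /h /(lt_trans Gy2); rewrite ltxx.
Qed.

(** The fixed points of [G] cut [z0, W z0) into [l] cells. Each cell is sent onto a unit interval by
    [interval_conj]; the pieces are glued and extended by equivariance under [W], which commutes
    with [G]. *)
Lemma normal_form (G G' W W' : R -> R) z0 :
  {homo G : x y / x < y} -> {homo G' : x y / x < y} ->
  cancel G G' -> cancel G' G ->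
  {homo W : x y / x < y} -> {homo W' : x y / x < y} ->
  cancel W W' -> cancel W' W -> (forall x, G (W x) = W (G x)) ->
  G z0 = z0 -> z0 < W z0 -> (forall x, zspan W W' z0 x) ->
  finite_set [set z | G z = z /\ z0 <= z < W z0] ->
  (forall z, G z = z -> crossing_at G z) ->
  exists (l : nat) (Th : R -> R), [/\ (0 < l)%N /\ ~~ odd l,
    {homo Th : x y / x < y}, (forall y, exists x, Th x = y),
    (forall x, Th (W x) = Th x + l%:R) & forall x, Th (G x) = model (Th x)].
Proof.
move=> iG iG' GG' G'G iW iW' WW' W'W GW Gz0 z0W span /finite_seqP[s0 s0E] cr.
pose s := sort <=%R (undup s0); pose l := size s.
have ms z : (z \in s) <-> (G z = z /\ z0 <= z < W z0).
  by rewrite mem_sort mem_undup; have := congr1 (fun A => A z) s0E; rewrite /= => ->.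
have ss : sorted <%R s.
  by rewrite lt_sorted_uniq_le sort_uniq undup_uniq sort_le_sorted.
(* The default value closes the last cell: [e l] is [W z0]. *)
pose e i := nth (W z0) s i.
have e_in i : (i < l)%N -> G (e i) = e i /\ z0 <= e i < W z0.
  by move=> il; apply/ms/mem_nth.
have el : e l = W z0 by rewrite /e nth_default.
have Ge i : (i <= l)%N -> G (e i) = e i.
  by rewrite leq_eqVlt => /predU1P[->|/e_in[]//]; rewrite el GW Gz0.
have e_lt i j : (i < j)%N -> (j <= l)%N -> e i < e j.
  move=> ij; rewrite leq_eqVlt => /predU1P[jl|jl].
    by rewrite jl el; have [|_ /andP[]] := e_in i => //; rewrite -jl.
  by apply: (sorted_ltn_nth lt_trans) => //; rewrite inE ?(ltn_trans ij).
have e_le i j : (i <= j)%N -> (j <= l)%N -> e i <= e j.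
  by rewrite leq_eqVlt => /predU1P[->//|ij jl]; exact/ltW/e_lt.
have e_surj z : G z = z -> z0 <= z < W z0 -> exists2 i, (i < l)%N & e i = z.
  move=> Gz zz; have /ms zs := conj Gz zz.
  by exists (index z s); rewrite ?index_mem// /e nth_index.
have [|i0 i0l ei0] := e_surj z0 Gz0; first by rewrite lexx.
have l0 : (0 < l)%N by exact: leq_ltn_trans i0l.
have e0 : e 0%N = z0.
  apply/eqP; rewrite eq_le; have [_ /andP[-> _]] := e_in _ l0.
  by rewrite andbT -ei0 e_le// ltnW.
have cell x : z0 <= x < W z0 -> exists i, (i < l)%N /\ e i <= x < e i.+1.
  move=> /andP[x0 xW].
  have exP : exists i, (i < l)%N && (e i <= x) by exists 0%N; rewrite l0 e0.
  have bP i : (i < l)%N && (e i <= x) -> (i <= l)%N by case/andP=> /ltnW.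
  case: (ex_maxnP exP bP) => i /andP[il ix] hmax; exists i; split=> //; rewrite ix/=.
  move: il; rewrite leq_eqVlt => /predU1P[->|il]; first by rewrite el.
  rewrite ltNge; apply/negP => h; have := hmax i.+1; rewrite il h => /(_ isT).
  by rewrite ltnn.
have cell_uniq x i j : (i < l)%N -> (j < l)%N ->
    e i <= x < e i.+1 -> e j <= x < e j.+1 -> i = j.
  move=> il jl /andP[i1 i2] /andP[j1 j2]; have [ij|ij|//] := ltngtP i j; exfalso.
    by have := e_le _ _ ij (ltnW jl); lra.
  by have := e_le _ _ ij (ltnW il); lra.
have cG : continuous G.
  by apply: incr_surj_continuous => // y; exists (G' y).
clearbody e.
have nofix i x : (i < l)%N -> e i < x < e i.+1 -> G x != x.
  move=> il /andP[x1 x2]; apply/eqP => Gx.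
  have z0x : z0 <= x by rewrite -e0 (le_trans (e_le _ _ (leq0n i) (ltnW il)))// ltW.
  have xW : x < W z0 by rewrite -el (lt_le_trans x2)// e_le.
  have [|j jl ej] := e_surj x Gx; first by rewrite z0x.
  have ij : i = j.
    by apply: (@cell_uniq x); rewrite // ?(ltW x1)// -ej lexx e_lt.
  by rewrite ij ej ltxx in x1.
(* Without a fixed point inside the cell, one point moved down forces all of them down. *)
pose b i := `[< exists2 x, e i < x < e i.+1 & G x < x >].
have sgn i x : (i < l)%N -> e i < x < e i.+1 -> if b i then G x < x else x < G x.
  move=> il xi; case: ifPn => [/asboolP[y yi Gy]|/asboolPn h].
    rewrite ltNge; apply/negP => xG.
    pose g x := G x - x; have cg : continuous g.
      by move=> u; apply: cvgB; [exact: cG|exact: cvg_id].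
    have [c ci gc] : exists2 c, e i < c < e i.+1 & g c = 0.
      case/andP: xi yi => x1 x2 /andP[y1 y2].
      have [xy|yx] := leP x y.
        have [|c /andP[c1 c2] gc] := itv_ivt_opp (v := 0) cg xy.
          by rewrite /g subr_le0 (ltW Gy) subr_ge0.
        by exists c => //; apply/andP; split; lra.
      have [|c /andP[c1 c2] gc] := itv_ivt (v := 0) cg (ltW yx).
        by rewrite /g subr_le0 (ltW Gy) subr_ge0.
      by exists c => //; apply/andP; split; lra.
    by have := nofix i c il ci; move/eqP: gc; rewrite subr_eq0 => ->.
  have := nofix i x il xi; rewrite neq_lt => /orP[Gx|//].
  by exfalso; apply: h; exists x.
clearbody b.
have alt i : (i.+1 < l)%N -> b i.+1 = ~~ b i.
  move=> il; have il' := ltnW il.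
  have [h1 h2] := crossing_at_sides (cr _ (Ge _ (ltnW il))) (Ge _ (ltnW il))
    (e_lt _ _ (ltnSn i) il') (e_lt _ _ (ltnSn i.+1) il).
  have s1 := sgn i ^~ il'; have s2 := sgn i.+1 ^~ il.
  case: (b i) s1 (b i.+1) s2 => s1 [] s2 //; exfalso.
    by apply: h2 => x []; [exact: s1|exact: s2].
  by apply: h1 => x []; [exact: s1|exact: s2].
(* The last cell is adjacent, at the crossing point [W z0], to the image under [W] of the first one,
   which has the sign of the first. Together with [alt] this makes [l] even. *)
have wrap : b l.-1 = ~~ b 0%N.
  have ll : (l.-1 < l)%N by rewrite ltn_predL.
  have lp : l.-1.+1 = l by rewrite prednK.
  have h01 : e l < W (e 1%N) by rewrite el -e0; apply: iW; apply: e_lt.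
  have crW : crossing_at G (e l) by apply: cr; exact: Ge.
  have [h1 h2] := crossing_at_sides crW (Ge _ (leqnn l))
    (e_lt _ _ ll (leqnn l)) h01.
  rewrite el in h1 h2.
  have s1 := sgn _ ^~ ll; rewrite lp el in s1.
  have s2 x : W z0 < x < W (e 1%N) -> if b 0%N then G x < x else x < G x.
    rewrite -e0 -(W'W x) !(incr_mono iW) => /(sgn _ _ l0).
    by rewrite GW !(incr_mono iW).
  case: (b 0%N) s2 (b l.-1) s1 => s2 [] s1 //; exfalso.
    by apply: h2 => x []; [exact: s1|exact: s2].
  by apply: h1 => x []; [exact: s1|exact: s2].
have bE i : (i < l)%N -> b i = b 0%N (+) odd i.
  elim: i => [|i ih] il; first by rewrite addbF.
  by rewrite alt// ih ?addbN// ltnW.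
have evenl : ~~ odd l.
  have := wrap; rewrite bE ?ltn_predL// -[in ~~ odd l](prednK l0) /=.
  by case: (b 0%N) (odd _) => -[].
have hex i : exists h : R -> R, (i < l)%N ->
  [/\ h (e i) = 0, (forall x, e i < x < e i.+1 -> 0 < h x < 1),
      (forall x y, e i < x -> x < y -> y < e i.+1 -> h x < h y),
      (forall r, 0 < r < 1 -> exists2 x, e i < x < e i.+1 & h x = r) &
      forall x, e i <= x < e i.+1 -> h (G x) = mob (parity_rate (b i)) (h x)].
  have [il|il] := ltnP i l; last by exists id.
  have [h hh] := interval_conj iG iG' GG' G'G (e_lt _ _ (ltnSn i) il)
    (Ge _ (ltnW il)) (Ge _ il) (sgn i ^~ il).
  by exists h.
have {hex} [hh hhP] := choice hex.
have hh01 i x : (i < l)%N -> e i <= x < e i.+1 -> 0 <= hh i x < 1.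
  move=> il /andP[]; have [h0 h1 _ _ _] := hhP _ il.
  rewrite le_eqVlt => /predU1P[<- _|x1 x2]; first by rewrite h0 lexx ltr01.
  by have /h1 /andP[/ltW -> ->] : e i < x < e i.+1 by rewrite x1.
have thex x : exists y, z0 <= x < W z0 -> exists i, [/\ (i < l)%N, e i <= x < e i.+1 &
    y = i%:R + hh i x].
  have [xz|xz] := boolP (z0 <= x < W z0); last by exists 0.
  by have [i [il ix]] := cell x xz; exists (i%:R + hh i x) => _; exists i.
have {thex} [th thP] := choice thex.
have thE x i : (i < l)%N -> e i <= x < e i.+1 -> th x = i%:R + hh i x.
  move=> il ix; have /thP : z0 <= x < W z0.
    case/andP: ix => h1 h2; rewrite -{1}e0 -el; apply/andP; split.
      by rewrite (le_trans (e_le _ _ (leq0n i) (ltnW il))).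
    by rewrite (lt_le_trans h2)// e_le.
  by move=> [j [jl jx ->]]; rewrite (cell_uniq _ _ _ jl il jx ix).
have [||||Th [Th0 ThW Thi Ths]] := @abel_extension R W W' z0 l%:R th iW iW' WW' W'W z0W.
- by rewrite ltr0n.
- move=> x y xz xy yW.
  have [|i [il ix]] := cell x; first by rewrite xz (lt_trans xy).
  have [|j [jl jy]] := cell y; first by rewrite yW (le_trans xz)// ltW.
  rewrite (thE _ _ il ix) (thE _ _ jl jy).
  have [ij|ij|ij] := ltngtP i j; last first.
  + subst j; rewrite ltrD2l; have [h0 h1 h2 _ _] := hhP _ il.
    case/andP: ix => ix1 ix2; case/andP: jy => jy1 jy2.
    move: ix1; rewrite le_eqVlt => /predU1P[ex|ix1]; last exact: h2.
    rewrite -ex h0; have /h1/andP[] // : e i < y < e i.+1.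
    by rewrite jy2 ex xy.
  + have := e_le _ _ ij (ltnW il); case/andP: ix jy => ? ? /andP[? ?].
    by move=> ?; exfalso; lra.
  + have /andP[_ h1] := hh01 _ _ il ix; have /andP[h2 _] := hh01 _ _ jl jy.
    have : i.+1%:R <= j%:R :> R by rewrite ler_nat.
    by rewrite -natr1 => ?; lra.
- move=> x xz; have [i [il ix]] := cell x xz; rewrite (thE _ _ il ix).
  have /andP[h1 h2] := hh01 _ _ il ix; rewrite addr_ge0//=.
  have : i.+1%:R <= l%:R :> R by rewrite ler_nat.
  by rewrite -natr1 => ?; lra.
- move=> y /andP[y0 yl]; have := truncn_itv y0.
  set i := Num.truncn y => /andP[i1 i2].
  have il : (i < l)%N by rewrite -(ltr_nat R) (le_lt_trans i1).
  have [h0 h1 _ hs _] := hhP _ il.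
  have [x ix hx] : exists2 x, e i <= x < e i.+1 & hh i x = y - i%:R.
    have [/eqP yi|yi] := eqVneq (y - i%:R) 0.
      by exists (e i); rewrite ?h0 ?(eqP yi)// lexx e_lt.
    have [|x /andP[x1 x2] <-] := hs (y - i%:R).
      by rewrite lt_neqAle eq_sym yi subr_ge0 i1 ltrBlDr addrC natr1.
    by exists x => //; rewrite x2 ltW.
  exists x; last by rewrite (thE _ _ il ix) hx addrC subrK.
  case/andP: ix => h1' h2'; rewrite -{1}e0 -el; apply/andP; split.
    by rewrite (le_trans (e_le _ _ (leq0n i) (ltnW il))).
  by rewrite (lt_le_trans h2')// e_le.
have {}ThW x : Th (W x) = Th x + l%:R by apply: ThW.
(* The model moves points up on even cells; adding [b 0] shifts the indices by one when the first
   cell is of the other kind. *)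
exists l, (fun x => Th x + (b 0%N)%:R); split.
- by rewrite l0.
- by move=> x y xy; rewrite ltrD2r; apply: Thi.
- by move=> y; have [x _ hx] := Ths (y - (b 0%N)%:R); exists x; rewrite hx subrK.
- by move=> x; rewrite ThW addrAC.
move=> x; have [k kx] := zspan_cell iW iW' WW' W'W z0W (span x).
have [x0 [hx0 xE]] : exists x0, z0 <= x0 < W z0 /\ x = zpow W W' k x0.
  exists (zpow W W' (- k) x); split; last by rewrite -zpow_add// addrN.
  exact: (zpow_cell0 iW iW' WW' W'W kx).
have [i [il ix]] := cell x0 hx0.
have iGx : e i <= G x0 < e i.+1.
  by rewrite -(Ge i (ltnW il)) -(Ge i.+1 il) (le_mono iG) (incr_mono iG).
have cl u : e i <= u < e i.+1 -> z0 <= u < W z0.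
  move=> /andP[u1 u2]; rewrite -{1}e0 -el; apply/andP; split.
    by rewrite (le_trans (e_le _ _ (leq0n i) (ltnW il))).
  by rewrite (lt_le_trans u2)// e_le.
rewrite xE (zpow_comm _ _ WW' W'W GW) !(zpow_additive _ _ WW' W'W ThW).
rewrite !Th0 ?cl// !(thE _ _ il)//.
have [_ _ _ _ ->] := hhP _ il; last exact: ix.
(* The cell of the model that contains the point: cell [i], moved by W^k, with the initial shift.
   Since [l] is even, [k * l] does not affect its parity. *)
pose n : int := i%:Z + k * l%:Z + (b 0%N)%:Z.
have nE r : i%:R + r + k%:~R * l%:R + (b 0%N)%:R = n%:~R + r.
  by rewrite /n !intrD intrM -!pmulrn; ring.
rewrite !nE model_int_add ?hh01//; congr (_ + mob (parity_rate _) _).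
by rewrite bE// /n !odd_absz_add odd_absz_even//= addbF addbC; case: (b 0%N).
Qed.

End normal_form.

(** * Normal form of a lift with rational translation number *)

Section lift_normal_form.
Context {R : realType}.
Implicit Types (F : R -> R) (x y z : R) (p q l : nat).

Lemma lifting_subn F x n : lifting F -> F (x - n%:R) = F x - n%:R.
Proof. by move=> lF; rewrite -{2}(subrK n%:R x) lifting_nat// addrK. Qed.

Lemma incr_iter_fixed F n x : {homo F : x y / x < y} -> (0 < n)%N ->
  iter n F x = x -> F x = x.
Proof.
move=> iF; case: n => // n _ h; have le_iter k u v : u < v -> iter k F u < iter k F v.
  by move=> uv; elim: k => //= k; exact: iF.
have up k : x < F x -> x < iter k.+1 F x.
  by move=> xF; elim: k => //= k ih; apply: (lt_trans xF); exact: iF.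
have dn k : F x < x -> iter k.+1 F x < x.
  by move=> xF; elim: k => //= k ih; apply: lt_trans xF; exact: iF.
have [/(dn n)|/(up n)|//] := ltgtP (F x) x; by rewrite h ltxx.
Qed.

Lemma iter_cancel (F F' : R -> R) n : cancel F F' -> cancel (iter n F) (iter n F').
Proof.
move=> FF'; elim: n => // n ih x.
by rewrite [iter n.+1 F' _]iterSr iterS FF' ih.
Qed.

Definition return_map p q F x := iter q F x - p%:R.

(* With a p = v q + 1, F^a - v generates together with the return map the same
   group as F and x |-> x + 1. *)
Definition shift_map p q F x := iter (egcdn p q).1 F x - (egcdn p q).2%:R.

Lemma lifting_return p q F : lifting F -> lifting (return_map p q F).
Proof. by move=> lF; apply: lifting_shift; exact: lifting_iter. Qed.

Lemma lifting_shiftmap p q F : lifting F -> lifting (shift_map p q F).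
Proof. by move=> lF; apply: lifting_shift; exact: lifting_iter. Qed.

Lemma iter_subn F m n k x : lifting F ->
  iter k (fun x => iter m F x - n%:R) x = iter (k * m) F x - (k * n)%:R.
Proof.
move=> lF; rewrite iter_shift; last first.
  by move=> y; rewrite lifting_subn//; exact: lifting_iter.
by rewrite iterM natrM mulNrn mulr_natl.
Qed.

Section egcd.
Context (p q : nat) (p0 : (0 < p)%N) (q0 : (0 < q)%N) (pq : coprime p q).
Local Notation a := (egcdn p q).1.
Local Notation v := (egcdn p q).2.

Lemma egcd_bezout : (a * p = v * q + 1)%N.
Proof. by case: egcdnP => // u w -> _ /=; move/eqP: pq => ->. Qed.

(** Both sides are F^(qa) up to an integer, and q v = a p - 1. With [iter_shift_p] this recovers the
    unit translation and [F] from the two commuting maps. *)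
Lemma iter_shift_return F x : lifting F ->
  iter q (shift_map p q F) x = iter a (return_map p q F) x + 1.
Proof.
move=> lF; rewrite !iter_subn// egcd_bezout mulnC [(q * v)%N]mulnC natrD.
by ring.
Qed.

Lemma iter_shift_p F x : lifting F ->
  iter p (shift_map p q F) x = F (iter v (return_map p q F) x).
Proof.
move=> lF; rewrite !iter_subn// lifting_subn// -iterS.
by rewrite mulnC egcd_bezout addn1 mulnC [(v * p)%N]mulnC.
Qed.

Lemma shift_return_comm F x : lifting F ->
  return_map p q F (shift_map p q F x) = shift_map p q F (return_map p q F x).
Proof.
move=> lF; rewrite /return_map /shift_map !lifting_subn//; try exact: lifting_iter.
by rewrite -!iterD addnC addrAC.
Qed.

(** [Th] is not a lift: the unit translation is W^q G^(-a), which [Th] carries to a translation by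
    [l q] only on the fixed points of [G]. *)
Definition has_normal_form l F := exists Th : R -> R,
  [/\ {homo Th : x y / x < y}, (forall y, exists x, Th x = y),
      (forall x, Th (shift_map p q F x) = Th x + l%:R) &
      forall x, Th (return_map p q F x) = model (Th x)].

(** On the fixed point [z0], W^(nq) adds [n]. Hence [W] moves [z0] up, its orbit is unbounded on
    both sides, and the fundamental interval lies in one period, where the fixed points are finitely
    many. *)
Lemma crossing_normal_form F z0 : lifting F ->
  return_map p q F z0 = z0 ->
  finite_set [set z | return_map p q F z = z /\ z0 <= z < z0 + 1] ->
  (forall z, return_map p q F z = z -> crossing_at (return_map p q F) z) ->
  exists l, [/\ (0 < l)%N, ~~ odd l & has_normal_form l F].
Proof.
move=> lF Gz0 fin cr; set G := return_map p q F in Gz0 fin cr *.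
set W := shift_map p q F.
have lG : lifting G by exact: lifting_return.
have lW : lifting W by exact: lifting_shiftmap.
have [G' [lG' GG' G'G]] := lifting_inv lG.
have [W' [lW' WW' W'W]] := lifting_inv lW.
have iterGz0 n : iter n G z0 = z0 by elim: n => //= n ->.
have Wq : iter q W z0 = z0 + 1 by rewrite iter_shift_return// iterGz0.
have WqM n : iter (n * q) W z0 = z0 + n%:R.
  elim: n => [|n ih]; first by rewrite addr0.
  rewrite mulSn iterD ih lifting_nat ?Wq; last exact: lifting_iter.
  by rewrite -natr1; ring.
have z0W : z0 < W z0.
  rewrite ltNge; apply/negP => h.
  have : iter q W z0 <= z0.
    elim: (q) => //= n ih; apply: le_trans h; rewrite (lifting_le lW)//.
  by rewrite Wq; lra.
have Wz01 : W z0 <= z0 + 1.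
  rewrite -Wq -(prednK q0) iterSr.
  by elim: q.-1 => //= n ih; rewrite (lifting_le lW) (le_trans (ltW z0W)).
have WqN n : iter (n * q) W' z0 = z0 - n%:R.
  rewrite -(iter_cancel (n * q) WW' (z0 - n%:R)) lifting_subn; last first.
    exact: lifting_iter.
  by rewrite WqM addrK.
have span x : zspan W W' z0 x.
  have := archi_boundP (normr_ge0 (x - z0)); set n := Num.bound _.
  rewrite ltr_norml => /andP[h1 h2].
  exists (- (n * q)%N%:Z), (n * q)%N.
  rewrite /= WqM; apply/andP; split; last by lra.
  rewrite (_ : zpow _ _ _ _ = iter (n * q) W' z0); last by case: (n * q)%N.
  by rewrite WqN; lra.
have [iG _ _] := lG; have [iG' _ _] := lG'.
have [iW _ _] := lW; have [iW' _ _] := lW'.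
have GW x : G (W x) = W (G x) by exact: shift_return_comm.
have [|l [Th [[l0 el] iT sT TW TG]]] := @normal_form R G G' W W' z0 iG iG' GG' G'G
    iW iW' WW' W'W GW Gz0 z0W span _ cr.
  apply: sub_finite_set fin => z [Gz /andP[h1 h2]]; split=> //.
  by rewrite h1 (lt_le_trans h2).
by exists l; split=> //; exists Th.
Qed.

Lemma mob_fixed (b : bool) (r : R) : 0 < r < 1 -> mob (parity_rate b) r != r.
Proof.
move=> r01; apply/eqP => h; have [x hx] := logistic_surj r01.
move: h; rewrite -hx -logistic_mob => /(inc_inj (le_mono (@logistic_incr R)))/eqP.
by rewrite -subr_eq0 addrAC subrr add0r signr_eq0.
Qed.

Lemma model_fixed (y : R) : model y = y <-> exists i : int, y = i%:~R.
Proof.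
split=> [|[i ->]]; last first.
  by rewrite -[i%:~R]addr0 model_int_add ?lexx ?ltr01// /mob mulr0 mul0r.
have [i /andP[i1 i2]] := int_floor y; move=> h; exists i.
have yE : y = i%:~R + (y - i%:~R) by ring.
have [->//|yi] := eqVneq y i%:~R.
have r01 : 0 < y - i%:~R < 1.
  by rewrite lt_neqAle eq_sym subr_eq0 yi subr_ge0 i1 ltrBlDl.
move: h; rewrite yE model_int_add; last by case/andP: r01 => /ltW -> ->.
by move=> /addrI /eqP; rewrite (negbTE (mob_fixed _ _)).
Qed.

Lemma mob_gt (r : R) : 0 < r < 1 -> r < mob (parity_rate false) r.
Proof.
move=> r01; have [x <-] := logistic_surj r01.
by rewrite -logistic_mob logistic_incr// expr0 ltrDl ltr01.
Qed.

Lemma mob_lt (r : R) : 0 < r < 1 -> mob (parity_rate true) r < r.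
Proof.
move=> r01; have [x <-] := logistic_surj r01.
by rewrite -logistic_mob logistic_incr// expr1 gtrBl ltr01.
Qed.

Lemma model_sides (i : int) (y : R) : i%:~R < y < i%:~R + 1 ->
  if odd `|i|%N then model y < y else y < model y.
Proof.
move=> iy; have r01 : 0 < y - i%:~R < 1 by case/andP: iy => ? ?; apply/andP; split; lra.
rewrite (_ : y = i%:~R + (y - i%:~R)); last by ring.
rewrite model_int_add; last by case/andP: r01 => /ltW -> ->.
by case: (odd _); rewrite ltrD2l ?mob_gt ?mob_lt.
Qed.

Section normal_form_facts.
Context (l : nat) (F : R -> R) (lF : lifting F) (Th : R -> R)
  (iT : {homo Th : x y / x < y}) (sT : forall y, exists x, Th x = y)
  (TW : forall x, Th (shift_map p q F x) = Th x + l%:R)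
  (TG : forall x, Th (return_map p q F x) = model (Th x)).

Lemma nf_fixed z : return_map p q F z = z <-> exists i : int, Th z = i%:~R.
Proof.
rewrite -model_fixed -TG; split=> [->//|].
exact: (inc_inj (le_mono iT)).
Qed.

Lemma nf_iter_shift n x : Th (iter n (shift_map p q F) x) = Th x + (n * l)%:R.
Proof.
elim: n => [|n ih] /=; first by rewrite addr0.
by rewrite TW ih mulSn natrD; ring.
Qed.

Lemma nf_fixed_add1 z : return_map p q F z = z -> Th (z + 1) = Th z + (l * q)%:R.
Proof.
move=> Gz; have /esym := iter_shift_return z lF.
have -> : iter a (return_map p q F) z = z by elim: (a) => //= n ->.
by move=> ->; rewrite nf_iter_shift mulnC.
Qed.

(** For odd [l] the translation by [l] would exchange the cells where [model] goes up and down, yet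
    it has to commute with [model]; the contradiction is read at 1/2. *)
Lemma nf_even : ~~ odd l.
Proof.
have [z0 Tz0] := sT 2^-1; apply/negP => ol.
have half : (2^-1 : R) = 0%:~R + 2^-1 by rewrite add0r.
have h01 : 0 <= (2^-1 : R) < 1 by rewrite invr_ge0 ler0n/= invf_lt1// ltr1n.
have h01' : 0 < (2^-1 : R) < 1 by rewrite invr_gt0 ltr0n/= invf_lt1// ltr1n.
have := congr1 Th (shift_return_comm z0 lF).
rewrite !(TG, TW) Tz0 {2}half model_int_add// add0r.
rewrite (_ : 2^-1 + l%:R = l%:Z%:~R + 2^-1); last by rewrite addrC pmulrn.
rewrite model_int_add//= ol [RHS]addrC => /addrI => h.
by have := lt_trans (mob_lt h01') (mob_gt h01'); rewrite h ltxx.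
Qed.

Lemma nf_crossing z : return_map p q F z = z -> crossing_at (return_map p q F) z.
Proof.
move=> Gz e e0; have /nf_fixed[i Ti] := Gz.
have [u Tu] := sT (i%:~R - 1); have [w Tw] := sT (i%:~R + 1).
have uz : u < z by rewrite -(incr_mono iT) Tu Ti; lra.
have zw : z < w by rewrite -(incr_mono iT) Tw Ti; lra.
(* The midpoints keep the two witnesses inside the cells adjacent to [z], the terms in [e / 2] keep
   them within [e] of it. *)
pose y1 := Num.max ((u + z) / 2) (z - e / 2).
pose y2 := Num.min ((w + z) / 2) (z + e / 2).
have [e1 [e2 e3]] : `|y1 - z| < e /\ u < y1 /\ y1 < z.
  rewrite /y1 /Num.max; case: ifPn => h; rewrite ltr_norml;
    (split; [apply/andP; split|split]); lra.
have [f1 [f2 f3]] : `|y2 - z| < e /\ z < y2 /\ y2 < w.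
  rewrite /y2 /Num.min; case: ifPn => h; rewrite ltr_norml;
    (split; [apply/andP; split|split]); lra.
have T1 : (i - 1)%:~R < Th y1 < (i - 1)%:~R + 1.
  by rewrite intrB subrK -Tu -Ti !(incr_mono iT) e2.
have T2 : i%:~R < Th y2 < i%:~R + 1 by rewrite -Tw -Ti !(incr_mono iT) f2.
have := model_sides T1; have := model_sides T2.
rewrite odd_absz_add addbT -!TG !(incr_mono iT).
case: (odd `|i|) => /= h2 h1.
  by split; [exists y2|exists y1].
by split; [exists y1|exists y2].
Qed.

Lemma nf_rot b : rot F b -> q%:R * b = p%:R.
Proof.
move=> rb; have [z Tz] := sT 0.
have /nf_fixed Gz : exists i : int, Th z = i%:~R by exists 0.
rewrite (@rot_periodic _ F b z q p lF rb) -?pmulrn//.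
by move: Gz; rewrite /return_map => /eqP; rewrite subr_eq addrC => /eqP ->; rewrite addrC.
Qed.

End normal_form_facts.

(** Comparing the two coordinates conjugates both commuting maps. Since each iterate of the return
    map is onto, the identities W^p = F G^v and W^q = G^a + 1 then give conjugacy of [F] and
    compatibility with the unit translation. *)
Lemma nf_conj l F F' : lifting F -> lifting F' ->
  has_normal_form l F -> has_normal_form l F' ->
  exists H, lifting H /\ forall x, H (F x) = F' (H x).
Proof.
move=> lF lF' [T [iT sT TW TG]] [T' [iT' sT' TW' TG']].
have [V' [T'V' V'T' iV']] := incr_surj_inv iT' sT'.
pose H x := V' (T x).
have HG x : H (return_map p q F x) = return_map p q F' (H x).
  by rewrite /H TG -{1}(V'T' (T x)) -TG' T'V'.
have HW x : H (shift_map p q F x) = shift_map p q F' (H x).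
  by rewrite /H TW -{1}(V'T' (T x)) -TW' T'V'.
have iterH A B n x : (forall y, H (A y) = B (H y)) -> H (iter n A x) = iter n B (H x).
  by move=> h; elim: n => //= n <-; rewrite h.
have lGa F0 n : lifting F0 -> lifting (iter n (return_map p q F0)).
  by move=> ?; apply: lifting_iter; exact: lifting_return.
exists H; split; last first.
  move=> x; have [_ sG _] := lGa F v lF; have [y <-] := sG x.
  rewrite -iter_shift_p// (iterH _ _ _ _ HW) iter_shift_p//.
  by rewrite (iterH _ _ _ _ HG).
split=> [x y xy|y|x].
- by apply: iV'; exact: iT.
- by have [x Tx] := sT (T' y); exists x; rewrite /H Tx T'V'.
- have [_ sG _] := lGa F a lF; have [y <-] := sG x.
  rewrite -iter_shift_return// (iterH _ _ _ _ HW) iter_shift_return//.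
  by rewrite (iterH _ _ _ _ HG).
Qed.

Lemma nf_comp l F F' H : lifting F -> lifting F' -> lifting H ->
  (forall x, H (F x) = F' (H x)) -> has_normal_form l F' -> has_normal_form l F.
Proof.
move=> lF lF' lH HF [T [iT sT TW TG]].
have HFn n x : H (iter n F x) = iter n F' (H x) by elim: n => //= n <-.
have [iH sH _] := lH.
exists (T \o H); split=> [x y xy|y|x|x] /=.
- by apply: iT; exact: iH.
- by have [x <-] := sT y; have [u <-] := sH x; exists u.
- by rewrite -TW /shift_map lifting_subn// HFn.
- by rewrite -TG /return_map lifting_subn// HFn.
Qed.

End egcd.
End lift_normal_form.

(** * Circle homeomorphisms and their lifts *)

Section circle_lifts.
Context {R : realType}.
Implicit Types (F G : R -> R) (f g : homeoS1 R) (a b : R).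

Lemma circle_ofP a b :
  circle_of a = circle_of b <-> exists k : int, a = b + k%:~R.
Proof.
rewrite circle_of_eq; split=> [/intrP[k kE]|[k ->]].
  by exists k; rewrite -kE addrC subrK.
by rewrite addrAC subrr add0r; apply/intrP; exists k.
Qed.

Lemma circle_ofDint a (k : int) : circle_of (a + k%:~R) = circle_of a.
Proof. by apply/circle_ofP; exists k. Qed.

Lemma circle_gaps_inf (x y : circle R) : has_inf (circle_gaps x y).
Proof.
have [a ax] := circle_of_surj x; have [b yb] := circle_of_surj y.
split; first by exists `|a - b|, a, b.
by exists 0 => _ [c [d [_ _ ->]]].
Qed.

Lemma circle_dist_le a b : circle_dist (circle_of a) (circle_of b) <= `|a - b|.
Proof.
by apply: ge_inf; [case: (circle_gaps_inf (circle_of a) (circle_of b))|exists a, b].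
Qed.

Lemma circle_dist_lt a (y : circle R) e : circle_dist (circle_of a) y < e ->
  exists2 b, circle_of b = y & `|a - b| < e.
Proof.
move=> d; have e0 : 0 < e - circle_dist (circle_of a) y by rewrite subr_gt0.
have [_ [a' [b [aa' yb ->]]]] := inf_adherent e0 (circle_gaps_inf (circle_of a) y).
rewrite addrCA subrr addr0 => ab.
have [k kE] := (circle_ofP a' a).1 aa'.
exists (b - k%:~R); first by rewrite -mulrNz circle_ofDint.
by rewrite (_ : a - _ = a' - b)// kE; ring.
Qed.

Lemma is_liftP (f : circle R -> circle R) F :
  is_lift f F <-> lifting F /\ forall x, circle_of (F x) = f (circle_of x).
Proof.
split=> [[[G [FG GF _ _]] iF Ff F1]|[lF Ff]].
  by split=> //; split=> // y; exists (G y).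
by have [iF _ F1] := lF; split=> //; exact: lifting_homeo.
Qed.

Lemma homeo_mulE f g x : homeo_fun (f * g)%g x = f (g x).
Proof. by []. Qed.

Lemma homeo_invgK f x : homeo_fun f^-1%g (f x) = x.
Proof. by rewrite -homeo_mulE mulVg. Qed.

Lemma homeo_lift f : exists2 F, lifting F & forall x, circle_of (F x) = f (circle_of x).
Proof. by have [_ [F /is_liftP[lF Ff]]] := homeoS1P f; exists F. Qed.

Definition descend F (x : circle R) : circle R := circle_of (F (repr x)).

Lemma descendE F x : lifting F -> descend F (circle_of x) = circle_of (F x).
Proof.
move=> lF; rewrite /descend.
have [k ->] := (circle_ofP (repr (circle_of x)) x).1 (reprK _).
by rewrite lifting_int// circle_ofDint.
Qed.

Lemma descend_continuous F : lifting F -> continuous (descend F).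
Proof.
move=> lF x; have [a <-] := circle_of_surj x.
move=> A /nbhs_ballP[e /= e0 eA].
have /cvgrPdist_lt /(_ e e0) := lifting_continuous lF (x := a).
move=> /nbhs_ballP[d /= d0 hd].
apply/nbhs_ballP; exists d => //= y /circle_dist_lt[b <- ab].
rewrite /= descendE//; apply: eA; rewrite descendE// /ball/=.
apply: le_lt_trans (circle_dist_le _ _) _.
by apply: hd; rewrite /ball/=.
Qed.

Lemma homeo_of_lift F : lifting F -> exists f : homeoS1 R, is_lift f F.
Proof.
move=> lF; have [G [lG FG GF]] := lifting_inv lF.
have lfF : is_lift (descend F) F.
  by apply/is_liftP; split=> // x; rewrite descendE.
suff fP : homeomorphism (descend F) /\ exists F0, is_lift (descend F) F0.
  by exists (mk_homeo fP).
split; last by exists F.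
exists (descend G); split; try exact: descend_continuous.
- by move=> x; have [a <-] := circle_of_surj x; rewrite !descendE// FG.
- by move=> x; have [a <-] := circle_of_surj x; rewrite !descendE// GF.
Qed.

Lemma homeo_eq_lift f g F : (forall x, circle_of (F x) = f (circle_of x)) ->
  (forall x, circle_of (F x) = g (circle_of x)) -> f = g.
Proof.
move=> Ff Fg; apply: homeo_inj => x; have [a <-] := circle_of_surj x.
by rewrite -Ff Fg.
Qed.

Lemma lift_iter f F n x : (forall x, circle_of (F x) = f (circle_of x)) ->
  homeo_fun (f ^+ n)%g (circle_of x) = circle_of (iter n F x).
Proof.
move=> Ff; elim: n => [|n ih]; first by rewrite expg0.
have -> : homeo_fun (f ^+ n.+1)%g (circle_of x) =
  f (homeo_fun (f ^+ n)%g (circle_of x)) by rewrite expgS.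
by rewrite ih /= Ff.
Qed.

(** Staying within 1/4 of the integers, [D] never takes a half-integer value; by the intermediate
    value theorem its nearest integer cannot jump. *)
Lemma near_int_const (D : R -> R) x0 (k0 : int) : continuous D ->
  (forall x, exists k : int, `|D x - k%:~R| < 4^-1) ->
  `|D x0 - k0%:~R| < 4^-1 -> forall x, `|D x - k0%:~R| < 4^-1.
Proof.
move=> cD near h0 x; have [k hk] := near x.
have half j : forall z, D z <> j%:~R + 2^-1.
  move=> z hz; have [m] := near z; rewrite hz.
  have -> : j%:~R + 2^-1 - m%:~R = (j - m)%:~R + 2^-1 :> R by rewrite intrB; ring.
  have [h|h] : j - m <= -1 \/ 0 <= j - m by lia.
    have : (j - m)%:~R <= (-1)%:~R :> R by rewrite ler_int.
    by rewrite ltr_norml => ? /andP[? ?]; lra.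
  have : 0%:~R <= (j - m)%:~R :> R by rewrite ler_int.
  by rewrite ltr_norml => ? /andP[? ?]; lra.
suff -> : k0 = k by [].
move: h0 hk; rewrite !ltr_norml => /andP[a1 a2] /andP[b1 b2].
have [kk|kk|//] := ltgtP k0 k; exfalso.
  have : (k0 + 1)%:~R <= k%:~R :> R by rewrite ler_int lezD1.
  rewrite intrD => h; have [xx|/ltW xx] := leP x0 x.
    by have [|c _ hc] := itv_ivt (v := k0%:~R + 2^-1) cD xx;
      [apply/andP; split; lra|exact: (half _ _ hc)].
  by have [|c _ hc] := itv_ivt_opp (v := k0%:~R + 2^-1) cD xx;
    [apply/andP; split; lra|exact: (half _ _ hc)].
have : (k + 1)%:~R <= k0%:~R :> R by rewrite ler_int lezD1.
rewrite intrD => h; have [xx|/ltW xx] := leP x0 x.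
  by have [|c _ hc] := itv_ivt_opp (v := k%:~R + 2^-1) cD xx;
    [apply/andP; split; lra|exact: (half _ _ hc)].
by have [|c _ hc] := itv_ivt (v := k%:~R + 2^-1) cD xx;
  [apply/andP; split; lra|exact: (half _ _ hc)].
Qed.

Lemma lift_unique (f : circle R -> circle R) F G : lifting F -> lifting G ->
  (forall x, circle_of (F x) = f (circle_of x)) ->
  (forall x, circle_of (G x) = f (circle_of x)) ->
  exists k : int, forall x, G x = F x + k%:~R.
Proof.
move=> lF lG Ff Gf.
have int x : exists k : int, G x - F x = k%:~R.
  have [k ->] := (circle_ofP (G x) (F x)).1 (etrans (Gf x) (esym (Ff x))).
  by exists k; ring.
have [k0 hk0] := int 0; exists k0 => x.
have : `|G x - F x - k0%:~R| < 4^-1.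
  apply: (near_int_const (D := fun y => G y - F y) (x0 := 0)) => [y|y|].
  - by apply: cvgB; [exact: (lifting_continuous lG)|exact: (lifting_continuous lF)].
  - by have [k ->] := int y; exists k; rewrite subrr normr0 invr_gt0.
  - by rewrite hk0 subrr normr0 invr_gt0.
have [k hk] := int x; rewrite hk -intrB -intr_norm => h.
have : (`|k - k0|%:~R < 1%:~R :> R) by apply: (lt_trans h); lra.
rewrite ltr_int => h1; have : k = k0 by lia.
by move=> kk; rewrite kk in hk; rewrite -hk; ring.
Qed.

Lemma rotation_numberE f F b : is_lift f F -> rot F b ->
  rotation_number f = b - (Num.floor b)%:~R.
Proof.
move=> /is_liftP[lF Ff] rb.
have /is_liftP[lL Lf] := projT2 (cid (homeoS1P f).2).
have [k hk] := lift_unique lF lL Ff Lf.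
have := rot_shift_int k lF rb.
rewrite (_ : (fun x => _) = lift_of f); last by apply/funext => x; rewrite -hk.
move=> /rot_translation_number; rewrite /rotation_number => ->.
have -> : Num.floor (b + k%:~R) = Num.floor b + k.
  apply: floor_def; have /andP[h1 h2] := floor_itv b.
  by move: h2; rewrite !intrD => h2; apply/andP; split; lra.
by rewrite intrD; ring.
Qed.

Lemma conj_lift f f' F F' H : is_lift f F -> is_lift f' F' -> lifting H ->
  (forall x, H (F x) = F' (H x)) -> conjugacy_class f f'.
Proof.
move=> /is_liftP[lF Ff] /is_liftP[lF' Ff'] lH HF.
have [h /is_liftP[_ Hh]] := homeo_of_lift lH; exists h => //.
have hf : (h * f)%g = (f' * h)%g.
  apply: (@homeo_eq_lift _ _ (fun x => H (F x))) => x.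
    by rewrite Hh Ff.
  by rewrite HF Ff' Hh.
by rewrite hf mulgK.
Qed.

Lemma conj_lift_ex f f' : conjugacy_class f f' ->
  exists F F' H, [/\ is_lift f F, is_lift f' F', lifting H &
    forall x, H (F x) = F' (H x)].
Proof.
move=> [h _ hf].
have [F lF Ff] := homeo_lift f; have [H lH Hh] := homeo_lift h.
have [K [lK HK KH]] := lifting_inv lH.
exists F, (H \o F \o K), H; split=> //; first exact/is_liftP.
  apply/is_liftP; split=> [|x]; first by do 2 apply: lifting_comp => //.
  by rewrite /= Hh Ff -hf !homeo_mulE -{2}(KH x) Hh homeo_invgK.
by move=> x; rewrite /= HK.
Qed.

End circle_lifts.

(** * Periodic points as fixed points of the return map *)

Section rational_rotation.
Context {R : realType}.
Implicit Types (F G : R -> R) (f g : homeoS1 R) (p q l : nat).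

(* p is taken in 1..q rather than 0..q-1, so that the Bezout coefficients of
   egcdn p q are natural numbers. *)
Lemma rotation_number_rat (r : rat) : 0 <= r < 1 -> exists p q : nat,
  [/\ (0 < p)%N, (0 < q)%N, coprime p q &
  forall f, rotation_number f = ratr r <->
    exists2 F, is_lift f F & rot F (p%:R / q%:R)].
Proof.
move=> /andP[r0 r1].
have [p [q [p0 q0 pq [j hj]]]] : exists p q : nat, [/\ (0 < p)%N, (0 < q)%N,
    coprime p q & exists j : int, p%:R / q%:R = ratr r + j%:~R :> R].
  have [->|rn0] := eqVneq r 0.
    by exists 1%N, 1%N; split=> //; exists 1; rewrite rmorph0 divr1 add0r.
  exists `|numq r|%N, `|denq r|%N; split.
  - by rewrite absz_gt0 numq_eq0.
  - by rewrite absz_gt0 denq_eq0.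
  - exact: coprime_num_den.
  exists 0; rewrite addr0 -[in RHS](divq_num_den r) fmorph_div/= !ratr_int.
  by rewrite !pmulrn !gez0_abs// ?numq_ge0// ltW ?denq_gt0.
have rr : 0 <= (ratr r : R) < 1 by rewrite ler0q r0 -(ltr_rat R) rmorph1 in r1 *.
exists p, q; split=> // f; split; last first.
  move=> [F lF rF]; rewrite (rotation_numberE lF rF) hj.
  have -> : Num.floor (ratr r + j%:~R : R) = j.
    apply: floor_def; rewrite intrD; move: rr; set u : R := ratr r.
    by move=> /andP[? ?]; apply/andP; split; lra.
  by rewrite addrK.
have [_ [F lF]] := homeoS1P f; have /is_liftP[liF Ff] := lF.
have [b rb] := rot_exists liF; rewrite (rotation_numberE lF rb) => hb.
pose k := j - Num.floor b.
exists (fun x => F x + k%:~R); last first.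
  have := rot_shift_int k liF rb; congr rot.
  by rewrite hj -hb /k intrB; ring.
apply/is_liftP; split; first exact: lifting_shift.
by move=> x; rewrite circle_ofDint.
Qed.

Lemma rotation_number_itv f : 0 <= rotation_number f < 1.
Proof.
rewrite /rotation_number; set t := translation_number _.
by have := floor_itv t; rewrite intrD subr_ge0 ltrBlDl => /andP[-> ->].
Qed.

Lemma ratr_rotation_itv f (r : rat) : ratr r = rotation_number f -> 0 <= r < 1.
Proof.
move=> rE; have := rotation_number_itv f; rewrite -rE.
by rewrite -[X in X <= _](rmorph0 (ratr : rat -> R)) ler_rat
  -[X in _ && (_ < X)](rmorph1 (ratr : rat -> R)) ltr_rat.
Qed.

Section periodic.
Context (p q : nat) (p0 : (0 < p)%N) (q0 : (0 < q)%N) (pq : coprime p q).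
Context (f : homeoS1 R) (F : R -> R) (lF : lifting F)
  (Ff : forall x, circle_of (F x) = f (circle_of x)).

Lemma returnP x : return_map p q F x = x <-> iter q F x = x + p%:R.
Proof.
by rewrite /return_map; split=> [/eqP|->]; rewrite ?addrK// subr_eq => /eqP.
Qed.

Lemma return_periodic x : return_map p q F x = x -> periodic_points f (circle_of x).
Proof.
move=> /returnP Fx; exists q => //.
by rewrite (lift_iter _ _ Ff) Fx -[p%:R]/(p%:~R) circle_ofDint.
Qed.

Context (rF : rot F (p%:R / q%:R)).

(** From F^n x = x + m one gets n p = m q; coprimality gives n = d q and m = d p, so [x] is fixed by
    the d-th iterate of the return map, hence by that map itself, which is increasing. *)
Lemma iter_period x n : (0 < n)%N -> homeo_fun (f ^+ n)%g (circle_of x) = circle_of x ->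
  (q %| n)%N /\ return_map p q F x = x.
Proof.
move=> n0; rewrite (lift_iter _ _ Ff) => /circle_ofP[m Fx].
have := rot_periodic lF rF Fx; have qn0 : q%:R != 0 :> R by rewrite pnatr_eq0 -lt0n.
move=> /(congr1 ( *%R^~ q%:R)); rewrite -mulrA mulfVK// => h.
have mE : (n * p)%N%:Z = m * q%:Z.
  by apply: (@intr_inj R); rewrite intrM -!pmulrn natrM.
have m0 : 0 <= m by move: mE q0; case: m {Fx h} => // k; lia.
have [k mk] : exists k : nat, m = k%:Z by exists `|m|%N; rewrite gez0_abs.
move: mE; rewrite mk => -[] mE.
have qn : (q %| n)%N.
  by rewrite -(@Gauss_dvdl q n p) ?mE ?dvdn_mull// coprime_sym.
split=> //; have [d nE] := dvdnP qn.
have kE : k = (d * p)%N.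
  by apply/eqP; rewrite -(eqn_pmul2r q0) -mE nE mulnAC.
have d0 : (0 < d)%N by move: n0; rewrite nE muln_gt0 => /andP[].
have [iG _ _] := lifting_return p q lF.
apply: (incr_iter_fixed iG d0); rewrite iter_subn// -nE Fx mk kE.
by rewrite -pmulrn addrK.
Qed.

Lemma periodic_return x :
  periodic_points f (circle_of x) <-> return_map p q F x = x.
Proof.
split; last exact: return_periodic.
by move=> [n n0 /(iter_period n0)[]].
Qed.

Lemma return_minimal_period x : return_map p q F x = x ->
  minimal_period f (circle_of x) q.
Proof.
move=> /returnP Fx; split=> //.
  by rewrite (lift_iter _ _ Ff) Fx -[p%:R]/(p%:~R) circle_ofDint.
by move=> m m0 /(iter_period m0)[/(dvdn_leq m0)].
Qed.

Lemma minimal_period_eq x n : minimal_period f (circle_of x) n -> n = q.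
Proof.
move=> [n0 fn hn]; have [qn /return_minimal_period[_ fq hq]] := iter_period n0 fn.
by apply/eqP; rewrite eqn_leq hn//= hq.
Qed.

Lemma return_lift : is_lift (homeo_fun (f ^+ q)%g) (iter q F).
Proof.
apply/is_liftP; split; first exact: lifting_iter.
by move=> x; rewrite -(lift_iter _ _ Ff).
Qed.

(** The lift and the representative in the definition are arbitrary, but differ from F^q and [x] by
    integers [j] and [i]; translating by [i] turns [F' - k] into the return map. *)
Lemma crossing_return x : return_map p q F x = x ->
  crossing_periodic_point f (circle_of x) <-> crossing_at (return_map p q F) x.
Proof.
move=> Gx; split.
  move=> [n /minimal_period_eq ->] [_ [F' [x' [k [/is_liftP[lF' Ff'] x'x Fx' cr]]]]].
  have /is_liftP[lFq Ffq] := return_lift.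
  have [j jE] := lift_unique lFq lF' Ffq Ff'.
  have [i iE] := (circle_ofP x' x).1 x'x.
  have kE : k%:~R = p%:R + j%:~R :> R.
    move: Fx'; rewrite jE iE lifting_int// (returnP x).1// => h; lra.
  move=> e e0; have := cr (ball x' e); case; first exact: nbhsx_ballx.
  have shift y : F' y - k%:~R = return_map p q F (y - i%:~R) + i%:~R.
    rewrite /return_map jE kE.
    by have := lifting_int y (- i) lFq; rewrite mulrNz => ->; ring.
  move=> [y1 y1x y1F] [y2 y2x y2F]; split.
    exists (y1 - i%:~R); last by have := shift y1; lra.
    by move: y1x; rewrite /ball/= distrC iE; congr (`| _ | < _); ring.
  exists (y2 - i%:~R); last by have := shift y2; lra.
  by move: y2x; rewrite /ball/= distrC iE; congr (`| _ | < _); ring.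
move=> cr; exists q; first exact: return_minimal_period.
split; first by case: (return_minimal_period Gx).
exists (iter q F), x, p%:Z; split=> //.
- exact: return_lift.
- exact/returnP.
move=> U /nbhs_ballP[e /= e0 eU]; have [[y1 y1x y1F] [y2 y2x y2F]] := cr e e0.
split.
  exists y1; first by apply: eU; rewrite /ball/= distrC.
  by move: y1F; rewrite /return_map -pmulrn; lra.
exists y2; first by apply: eU; rewrite /ball/= distrC.
by move: y2F; rewrite /return_map -pmulrn; lra.
Qed.

Lemma finite_return_fixed z0 : finite_set (periodic_points f) ->
  finite_set [set z | return_map p q F z = z /\ z0 <= z < z0 + 1].
Proof.
move=> fin.
apply: (@sub_finite_set _ _ ([set z | z0 <= z < z0 + 1] `&` (@circle_of R @^-1` periodic_points f))).
  by move=> z [/return_periodic ? ?]; split.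
(* The projection is injective only on a half-open period; sending the other points to [None] makes
   the preimage of a finite set finite. *)
pose g z := if (z0 <= z < z0 + 1) then Some (circle_of z) else None.
apply: (@sub_finite_set _ _ (g @^-1` (Some @` periodic_points f))).
  by move=> z [/= zz pz]; rewrite /g zz; exists (circle_of z).
apply: finite_preimage; last exact: finite_image.
move=> x y; rewrite !inE /g /= => -[c _]; case: ifP => // /andP[x1 x2] _.
move=> [d _]; case: ifP => // /andP[y1 y2] _ [/circle_ofP[k kE]].
have : `|k%:~R| < 1%:~R :> R by rewrite ltr_norml; apply/andP; split; lra.
rewrite -intr_norm ltr_int => k1; have k0 : k = 0 by lia.
by rewrite kE k0 addr0.
Qed.

End periodic.

End rational_rotation.

(** * Normal form classes *)

Section nf_classes.
Context {R : realType}.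
Implicit Types (F G : R -> R) (f g : homeoS1 R) (l : nat).

Lemma int_cell (m : int) (n : nat) : (0 < n)%N ->
  exists i (k : int), (i < n)%N /\ m = i%:Z + k * n%:Z.
Proof.
move=> n0; have nz : n%:Z != 0 by rewrite eqz_nat -lt0n.
exists `|(m %% n%:Z)%Z|%N, (m %/ n%:Z)%Z; split.
  by rewrite -ltz_nat gez0_abs ?modz_ge0// ltz_pmod.
by rewrite gez0_abs ?modz_ge0// addrC -divz_eq.
Qed.

Definition good f := [/\ rational (rotation_number f),
  finite_set (periodic_points f) &
  forall x, periodic_points f x -> crossing_periodic_point f x].

Lemma full_orbit_step f (x : circle R) n :
  full_orbit f (homeo_fun (f ^+ n)%g x) = full_orbit f x.
Proof.
have fK m : forall y, homeo_fun (f ^- m)%g (homeo_fun (f ^+ m)%g y) = y.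
  exact: homeo_invgK.
have fKV m : forall y, homeo_fun (f ^+ m)%g (homeo_fun (f ^- m)%g y) = y.
  by move=> y; rewrite -homeo_mulE mulgV.
have fD m k : forall y, homeo_fun (f ^+ (m + k))%g y =
    homeo_fun (f ^+ m)%g (homeo_fun (f ^+ k)%g y).
  by move=> y; rewrite expgnDr.
have fVD m k : forall y, homeo_fun (f ^- (m + k))%g y =
    homeo_fun (f ^- m)%g (homeo_fun (f ^- k)%g y).
  by move=> y; rewrite addnC expgnDr invgM.
have fVS m k y : (m <= k)%N -> homeo_fun (f ^- k)%g (homeo_fun (f ^+ m)%g y) =
    homeo_fun (f ^- (k - m))%g y.
  by move=> mk; rewrite -{1}(subnK mk) fVD fK.
have fVS' m k y : (k <= m)%N -> homeo_fun (f ^- k)%g (homeo_fun (f ^+ m)%g y) =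
    homeo_fun (f ^+ (m - k))%g y.
  by move=> mk; rewrite -{1}(subnKC mk) fD fK.
apply/seteqP; split=> y [m [->|->]].
- by exists (m + n)%N; left; rewrite fD.
- have [mn|mn] := leqP n m; first by exists (m - n)%N; right; exact: fVS.
  by exists (n - m)%N; left; exact: fVS' (ltnW mn).
- have [mn|mn] := leqP n m.
    by exists (m - n)%N; left; rewrite -fD subnK.
  exists (n - m)%N; right.
  by rewrite (fVS' _ _ _ (leq_subr m n)) (subKn (ltnW mn)).
- by exists (m + n)%N; right; rewrite fVD fK.
Qed.

Section nf_class.
Context (p q : nat) (p0 : (0 < p)%N) (q0 : (0 < q)%N) (pq : coprime p q).

(** By [nf_rot] such a lift has translation number p / q, so at most one lift of [f] qualifies. *)
Definition nf_class l f := exists2 F, is_lift f F & has_normal_form p q l F.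

Lemma nf_class_conj l f g : nf_class l f -> nf_class l g -> conjugacy_class f g.
Proof.
move=> [F lF nF] [G lG nG]; have [/is_liftP[liF _] /is_liftP[liG _]] := (lF, lG).
have [H [lH HF]] := nf_conj p0 pq liF liG nF nG.
exact: conj_lift lF lG lH HF.
Qed.

Lemma conj_nf_class l f g : conjugacy_class f g -> nf_class l g -> nf_class l f.
Proof.
move=> /conj_lift_ex[F [G [H [lF lG lH HF]]]] [G' lG' nG'].
have [/is_liftP[liF Ff] /is_liftP[liG Gg] /is_liftP[liG' Gg']] := And3 lF lG lG'.
have [k GE] := lift_unique liG liG' Gg Gg'.
exists (fun x => F x + k%:~R); first apply/is_liftP.
  split; first exact: lifting_shift.
  by move=> x; rewrite circle_ofDint.
apply: (nf_comp _ liG' lH _ nG'); first exact: lifting_shift.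
by move=> x; rewrite lifting_int// HF GE.
Qed.

Lemma good_nf_class f : good f ->
  (exists2 F, is_lift f F & rot F (p%:R / q%:R)) ->
  exists l, [/\ (0 < l)%N, ~~ odd l & nf_class l f].
Proof.
move=> [_ fin cr] [F lF rF]; have /is_liftP[liF Ff] := lF.
have [z0 Fz0] : exists x, iter q F x = x + p%:~R.
  apply: (rot_rational_periodic liF rF q0).
  by rewrite mulrC divfK// pnatr_eq0 -lt0n.
have Gz0 : return_map p q F z0 = z0 by apply/returnP.
have [|z Gz|l [l0 el nF]] := @crossing_normal_form R p q p0 q0 pq F z0 liF Gz0.
- exact: (finite_return_fixed p0 q0 pq Ff).
- apply/(crossing_return p0 q0 pq liF Ff rF Gz).
  by apply: cr; apply/(periodic_return p0 q0 pq liF Ff rF).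
- by exists l; split=> //; exists F.
Qed.

Section facts.
Context (l : nat) (f : homeoS1 R) (F : R -> R) (lF : lifting F)
  (Ff : forall x, circle_of (F x) = f (circle_of x)) (Th V : R -> R)
  (iT : {homo Th : x y / x < y}) (TV : cancel Th V) (VT : cancel V Th)
  (TW : forall x, Th (shift_map p q F x) = Th x + l%:R)
  (TG : forall x, Th (return_map p q F x) = model (Th x)).

Let sT y : exists x, Th x = y. Proof. by exists (V y). Qed.

Lemma nf_rotE : rot F (p%:R / q%:R).
Proof.
have [b rb] := rot_exists lF; have <- // : b = p%:R / q%:R.
rewrite -(nf_rot lF iT sT TG rb) mulrC mulKf// pnatr_eq0 -lt0n//.
Qed.

Lemma nf_pt (i : int) : return_map p q F (V i%:~R) = V i%:~R.
Proof. by apply/(nf_fixed iT TG); exists i; rewrite VT. Qed.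

Lemma nf_l_gt0 : (0 < l)%N.
Proof.
have := nf_fixed_add1 p0 pq lF TW (nf_pt 0).
have : Th (V 0%:~R) < Th (V 0%:~R + 1) by rewrite (incr_mono iT) ltrDl.
by move=> + h; rewrite h ltrDl ltr0n muln_gt0 => /andP[].
Qed.

Lemma return_addn x n : return_map p q F (x + n%:R) = return_map p q F x + n%:R.
Proof. by rewrite lifting_nat//; exact: lifting_return. Qed.

Lemma nf_add_nat x n : return_map p q F x = x -> Th (x + n%:R) = Th x + (n * (l * q))%:R.
Proof.
move=> Gx; elim: n => [|n ih]; first by rewrite !addr0.
rewrite -natr1 addrA (nf_fixed_add1 p0 pq lF TW).
  by rewrite ih mulSn [(l * q + _)%N]addnC natrD addrA.
by rewrite return_addn Gx.
Qed.

Lemma nf_add_int x (k : int) : return_map p q F x = x ->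
  Th (x + k%:~R) = Th x + (k * (l * q)%N%:Z)%:~R.
Proof.
move=> Gx; case: k => n; first by rewrite -!pmulrn nf_add_nat.
rewrite intrM (_ : (Negz n)%:~R = - n.+1%:R); last by rewrite NegzE mulrNz -pmulrn.
rewrite -pmulrn mulNr -natrM.
have Gxn : return_map p q F (x - n.+1%:R) = x - n.+1%:R.
  by rewrite lifting_subn ?Gx//; exact: lifting_return.
by have := nf_add_nat n.+1 Gxn; rewrite subrK => ->; rewrite addrK.
Qed.

Lemma circle_of_nf (i j : int) : circle_of (V i%:~R) = circle_of (V j%:~R) ->
  exists k : int, i = j + k * (l * q)%N%:Z.
Proof.
move=> /circle_ofP[k /(congr1 Th)]; rewrite nf_add_int ?nf_pt// !VT -intrD.
by move=> /intr_inj ->; exists k.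
Qed.

Lemma nf_periodic_pt (x : circle R) : periodic_points f x <->
  exists i : int, x = circle_of (V i%:~R).
Proof.
have [x' <-] := circle_of_surj x.
rewrite (periodic_return p0 q0 pq lF Ff nf_rotE) (nf_fixed iT TG).
split=> [[i Ti]|[i /circle_ofP[k ->]]]; first by exists i; rewrite -Ti TV.
by exists (i + k * (l * q)%N%:Z); rewrite nf_add_int ?nf_pt// VT -intrD.
Qed.

(** Integers index the fixed points of the return map through [V], and the unit translation adds
    [l q] to the index. *)
Lemma nf_periodic_card : (periodic_points f #= `I_(l * q))%card.
Proof.
have lq0 : (0 < l * q)%N by rewrite muln_gt0 nf_l_gt0.
have -> : periodic_points f = (fun i : nat => circle_of (V i%:R)) @` `I_(l * q).
  apply/seteqP; split=> x.
    move=> /nf_periodic_pt[m ->]; have [i [k [il mE]]] := int_cell m lq0.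
    exists i => //; apply/circle_ofP; exists (- k); apply: (inc_inj (le_mono iT)).
    by rewrite nf_add_int ?nf_pt// !VT -intrD mE pmulrn; congr (_%:~R); ring.
  by move=> [i _ <-]; apply/nf_periodic_pt; exists i%:Z.
apply: inj_card_eq => i j; rewrite !inE /= => il jl /(@circle_of_nf i j)[k kE].
move: kE il jl; set n := (l * q)%N => kE il jl.
have [k0|k0|k0] := ltgtP k 0; last by move: kE; rewrite k0 mul0r addr0 => -[].
  by exfalso; nia.
by exfalso; nia.
Qed.

Lemma nf_lift_fixed x : return_map p q F x = x -> Th (F x) = Th x + (p * l)%:R.
Proof.
move=> Gx; rewrite -(nf_iter_shift TW) iter_shift_p//; congr (Th (F _)).
by elim: (egcdn p q).2 => //= n <-.
Qed.

Lemma nf_iter_fixed x n : return_map p q F x = x ->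
  Th (iter n F x) = Th x + (n * (p * l))%:R.
Proof.
move=> Gx; elim: n => [|n ih]; first by rewrite addr0.
rewrite iterS nf_lift_fixed; first by rewrite ih mulSn addnC natrD addrA.
apply/(nf_fixed iT TG); have /(nf_fixed iT TG)[i Ti] := Gx.
by exists (i + (n * (p * l))%N%:Z); rewrite ih Ti intrD.
Qed.

Lemma orbit_shift_map x n : return_map p q F x = x ->
  full_orbit f (circle_of (iter n (shift_map p q F) x)) = full_orbit f (circle_of x).
Proof.
move=> Gx; rewrite iter_subn// pmulrn -mulrNz circle_ofDint.
by rewrite -(lift_iter _ _ Ff) full_orbit_step.
Qed.

(** On indices [F] adds [p l] and the unit translation adds [q l]. As [p] and [q] are coprime, these
    generate the multiples of [l], the step [l] being realised by [shift_map]; orbits are indices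
    modulo [l]. *)
Lemma nf_orbits_card : (periodic_orbits f #= `I_l)%card.
Proof.
have l0 := nf_l_gt0.
have Viter (i n : nat) : V (i + n * l)%:R = iter n (shift_map p q F) (V i%:R).
  by apply: (inc_inj (le_mono iT)); rewrite (nf_iter_shift TW) !VT natrD.
have Viterz (i k : int) : full_orbit f (circle_of (V (i + k * l%:Z)%:~R)) =
    full_orbit f (circle_of (V i%:~R)).
  have nonneg (j : int) (n : nat) : full_orbit f (circle_of (V (j + n%:Z * l%:Z)%:~R)) =
      full_orbit f (circle_of (V j%:~R)).
    rewrite -(orbit_shift_map n (nf_pt j)); congr (full_orbit f (circle_of _)).
    apply: (inc_inj (le_mono iT)); rewrite (nf_iter_shift TW) !VT intrD.
    by rewrite -PoszM -pmulrn.
  case: k => n; first exact: nonneg.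
  by rewrite -(nonneg (i + Negz n * l%:Z) n.+1) NegzE mulNr subrK.
have -> : periodic_orbits f =
    (fun i : nat => full_orbit f (circle_of (V i%:R))) @` `I_l.
  apply/seteqP; split=> x.
    move=> [c /nf_periodic_pt[m ->] <-]; have [i [k [il mE]]] := int_cell m l0.
    by exists i => //; rewrite mE Viterz.
  move=> [i il <-]; exists (circle_of (V i%:R)) => //.
  by apply/nf_periodic_pt; exists i%:Z.
apply: inj_card_eq => i j; rewrite !inE /= => il jl ij.
have modl (u v n : nat) : homeo_fun (f ^+ n)%g (circle_of (V u%:R)) = circle_of (V v%:R) ->
    exists k : int, v%:Z = u%:Z + k * l%:Z.
  rewrite (lift_iter _ _ Ff) => /circle_ofP[k /(congr1 Th)].
  rewrite nf_iter_fixed; last exact: (nf_pt u).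
  rewrite nf_add_int; last exact: (nf_pt v).
  rewrite !VT => h; exists ((n * p)%N%:Z - k * q%:Z).
  apply: (@intr_inj R); move: h.
  by rewrite intrD !intrM intrB intrM -!pmulrn !natrM => h; lra.
have eqm (u v : nat) (k : int) : (u < l)%N -> (v < l)%N -> v%:Z = u%:Z + k * l%:Z -> u = v.
  move=> ul vl kE; have [k0|k0|k0] := ltgtP k 0; last first.
  - by move: kE; rewrite k0 mul0r addr0 => -[].
  - by exfalso; nia.
  - by exfalso; nia.
have : full_orbit f (circle_of (V i%:R)) (circle_of (V j%:R)).
  by rewrite ij; exists 0%N; left; rewrite expg0.
move=> [n [jE|jE]].
  by have [k /(eqm _ _ _ il jl)] := modl i j n (esym jE).
have [|k /(eqm _ _ _ jl il)//] := modl j i n.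
by rewrite jE -homeo_mulE mulgV.
Qed.

End facts.

Lemma nf_classP l f : nf_class l f ->
  [/\ good f, (0 < l)%N /\ ~~ odd l, (periodic_points f #= `I_(l * q))%card,
      (periodic_orbits f #= `I_l)%card &
      exists2 F, is_lift f F & rot F (p%:R / q%:R)].
Proof.
move=> [F lfF [Th [iT sT TW TG]]]; have /is_liftP[lF Ff] := lfF.
have [V [TV VT _]] := incr_surj_inv iT sT.
have rF := nf_rotE lF iT VT TG.
have card := nf_periodic_card lF Ff iT TV VT TW TG.
split=> //.
- split.
  + rewrite (rotation_numberE lfF rF).
    exists (p%:R / q%:R - (Num.floor (p%:R / q%:R : R))%:~R) => //.
    by rewrite rmorphB/= fmorph_div/= !ratr_nat ratr_int.
  + by apply/finite_setP; exists (l * q)%N.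
  + move=> x; have [x' <-] := circle_of_surj x => px.
    have Gx := (periodic_return p0 q0 pq lF Ff rF x').1 px.
    apply: (crossing_return p0 q0 pq lF Ff rF Gx).2.
    exact: (nf_crossing iT sT TG Gx).
- by split; [exact: (nf_l_gt0 lF iT VT TW TG)|exact: (nf_even lF sT TW TG)].
- exact: (nf_orbits_card lF Ff iT TV VT TW TG).
- by exists F.
Qed.

End nf_class.

Lemma good_nf f : good f -> exists p q l : nat,
  [/\ (0 < p)%N, (0 < q)%N, coprime p q & nf_class p q l f].
Proof.
move=> gf; have [[r _ rE] _ _] := gf.
have r01 := ratr_rotation_itv rE.
have [p [q [p0 q0 pq h]]] := @rotation_number_rat R r r01.
have [l [_ _ nf]] := good_nf_class p0 q0 pq gf ((h f).1 (esym rE)).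
by exists p, q, l.
Qed.

End nf_classes.

(** * Topology and Borel structure of the homeomorphism group *)

Section homeo_topology.
Context {R : realType}.
Implicit Types (f g : homeoS1 R).

Lemma homeo_nbhs f (A : set (homeoS1 R)) : nbhs f A <->
  exists2 e, 0 < e & forall g, (forall x, circle_dist (f x) (g x) < e) -> A g.
Proof.
split.
  rewrite nbhsE => -[B [oB Bf] BA]; case: oB => W oW WB.
  have : nbhs (set_val f : {uniform circle R -> circle R}) W.
    by apply: open_nbhs_nbhs; split=> //; rewrite -WB in Bf.
  move=> /uniform_nbhs[E [entE EW]].
  have [e /= e0 eE] : exists2 e, 0 < e & forall x y : circle R, ball x e y -> E (x, y).
    move: entE; rewrite -entourage_ballE => -[e /= e0 eE]; exists e => // x y xy.
    exact: (eE (x, y)).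
  exists e => // g fg; apply: BA; rewrite -WB; apply: EW => y _; apply: eE.
  exact: fg.
move=> [e e0 eA].
have cv : continuous (set_val : homeoS1 R -> {uniform circle R -> circle R}).
  exact: initial_continuous.
have : nbhs (set_val f : {uniform circle R -> circle R})
    [set h | forall y, ball (homeo_fun f y) e (h y)].
  apply/uniform_nbhs; exists [set xy : circle R * circle R | ball xy.1 e xy.2].
  split; last by move=> h /= hf y; exact: hf.
  by rewrite -entourage_ballE; exists e.
move=> /(cv f) h; rewrite nbhsE in h *; case: h => B oB BA; exists B => // g /BA fg.
by apply: eA => x; exact: fg.
Qed.

Lemma circle_dist_lift f g F G :
  (forall x, circle_of (F x) = f (circle_of x)) ->
  (forall x, circle_of (G x) = g (circle_of x)) ->
  forall x, circle_dist (f (circle_of x)) (g (circle_of x)) <= `|F x - G x|.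
Proof. by move=> Ff Gg x; rewrite -Ff -Gg circle_dist_le. Qed.

(** The bound 1/4 ensures that one integer correction of a lift of [g] serves at all points. *)
Lemma near_lift f g F e : lifting F -> (forall x, circle_of (F x) = f (circle_of x)) ->
  e <= 4^-1 -> (forall x, circle_dist (f x) (g x) < e) ->
  exists G, [/\ lifting G, forall x, circle_of (G x) = g (circle_of x) &
    forall x, `|G x - F x| < e].
Proof.
move=> lF Ff e4 fg; have [G lG Gg] := homeo_lift g.
have near x : exists k : int, `|G x - F x - k%:~R| < e.
  have := fg (circle_of x); rewrite -Ff => /circle_dist_lt[b bg Fb].
  have [k kE] := (circle_ofP (G x) b).1 (etrans (Gg x) (esym bg)).
  by exists k; rewrite kE distrC; move: Fb; congr (`| _ | < _); ring.
have [k0 hk0] := near 0.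
have cD : continuous (fun x => G x - F x).
  by move=> y; apply: cvgB; [exact: (lifting_continuous lG)|exact: (lifting_continuous lF)].
exists (fun x => G x - k0%:~R); split.
- exact: lifting_shift.
- by move=> x; rewrite -mulrNz circle_ofDint.
move=> x; have [k hk] := near x.
have : `|G x - F x - k0%:~R| < 4^-1.
  apply: (near_int_const (D := fun x => G x - F x) (x0 := 0)) => //.
    by move=> y; have [j hj] := near y; exists j; exact: lt_le_trans hj e4.
  exact: lt_le_trans hk0 e4.
have hk' := lt_le_trans hk e4; move=> hk0'.
have kk : k = k0.
  have : `|k%:~R - k0%:~R| < 1%:~R :> R.
    rewrite (_ : _ - _ = (G x - F x - k0%:~R) - (G x - F x - k%:~R)); last by ring.
    by apply: le_lt_trans (ler_normB _ _) _; lra.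
  by rewrite -intrB -intr_norm ltr_int => ?; lia.
by rewrite kk in hk; rewrite addrAC.
Qed.

(** The modulus is read on the inverse: K (y + e) - K y is continuous, positive and periodic, so it
    has a positive minimum. *)
Lemma lifting_uniform (G : R -> R) (e : R) : lifting G -> 0 < e ->
  exists2 d, 0 < d & forall a b, `|a - b| < d -> `|G a - G b| < e.
Proof.
move=> lG e0; have [K [lK GK KG]] := lifting_inv lG.
pose h y := K (y + e) - K y.
have ch : continuous h.
  move=> y; apply: cvgB; last exact: (lifting_continuous lK).
  exact: (lifting_continuous (lifting_comp lK (lifting_addr e))).
have [|m m01 hm] := EVT_min (@ler01 R) (f := h); first exact: continuous_subspaceT.
have hge y : h m <= h y.
  have [k /andP[k1 k2]] := int_floor y.
  have -> : h y = h (y - k%:~R).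
    rewrite /h (_ : y - k%:~R + e = y + e + (- k)%:~R); last by rewrite mulrNz; ring.
    by rewrite -mulrNz !(lifting_int _ _ lK); ring.
  by apply: hm; rewrite in_itv/=; apply/andP; split; lra.
exists (h m); first by rewrite subr_gt0 (lifting_lt lK) ltrDl.
suff one a b : a <= b -> b - a < h m -> G b - G a < e.
  move=> a b; have [ab|/ltW ab] := leP a b.
    rewrite distrC ger0_norm ?subr_ge0// => /(one _ _ ab).
    by rewrite distrC ger0_norm// subr_ge0 (lifting_le lG).
  rewrite ger0_norm ?subr_ge0// => /(one _ _ ab).
  by rewrite ger0_norm// subr_ge0 (lifting_le lG).
move=> ab bah; have := lt_le_trans bah (hge (G a)).
rewrite /h GK ltrD2r => bK.
by rewrite ltrBlDl -[X in _ < X](KG (G a + e)) (lifting_lt lG).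
Qed.

Lemma homeo_uniform g e : 0 < e -> exists2 d, 0 < d &
  forall x y, circle_dist x y < d -> circle_dist (g x) (g y) < e.
Proof.
move=> e0; have [G lG Gg] := homeo_lift g.
have [d d0 hd] := lifting_uniform lG e0; exists d => // x y.
have [a <-] := circle_of_surj x => /circle_dist_lt[b <- /hd].
by rewrite -!Gg; apply: le_lt_trans; exact: circle_dist_le.
Qed.

Lemma continuous_homeo_mul (g h : homeoS1 R) :
  continuous (fun k : homeoS1 R => (g * k * h)%g).
Proof.
move=> k A /homeo_nbhs[e e0 eA]; have [d d0 hd] := homeo_uniform g e0.
apply/homeo_nbhs; exists d => // k' kk'; apply: eA => x.
by rewrite !homeo_mulE; apply: hd.
Qed.

Definition rotate (t : R) : homeoS1 R := projT1 (cid (homeo_of_lift (lifting_addr t))).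

Lemma rotateE t x : rotate t (circle_of x) = circle_of (x + t).
Proof. by rewrite /rotate; case: cid => /= f /is_liftP[_ ->]. Qed.

Lemma rotate_dist s t (x : circle R) : circle_dist (rotate s x) (rotate t x) <= `|s - t|.
Proof.
have [a <-] := circle_of_surj x; rewrite !rotateE.
by apply: (le_trans (circle_dist_le _ _)); rewrite opprD addrACA subrr add0r.
Qed.

Lemma continuous_rotate (g : homeoS1 R) : continuous (fun t => (rotate t * g)%g).
Proof.
move=> t A /homeo_nbhs[e e0 eA]; apply/nbhs_ballP; exists e => //= s ts.
apply: eA => x; rewrite !homeo_mulE; exact: le_lt_trans (rotate_dist _ _ _) ts.
Qed.

End homeo_topology.

(** * Measurability of translations *)

Section homeo_measurability.
Context {R : realType}.
Implicit Types (f g : homeoS1 R) (U : set (homeoS1 R)).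
Local Notation borelH := (borelType (homeoS1 R)).

Lemma open_borel U : open U -> measurable (U : set borelH).
Proof. by move=> oU; exact: sub_sigma_algebra. Qed.

Lemma closed_borel U : closed U -> measurable (U : set borelH).
Proof.
by move=> cU; rewrite -[U]setCK; apply: measurableC; apply: open_borel; exact: closed_openC.
Qed.

Lemma open_nbhs_sub U : (forall x, U x -> nbhs x U) -> open U.
Proof. by rewrite openE. Qed.

Lemma measurable_homeo_mul (g h : homeoS1 R) :
  measurable_fun setT (fun k : borelH => (g * k * h)%g : borelH).
Proof.
apply: (@measurability _ _ _ borelH _ _ (@open (homeoS1 R))) => //.
move=> _ [U oU <-]; rewrite setTI; apply: open_borel.
by apply: open_comp => // x _; exact: continuous_homeo_mul.
Qed.

Lemma measurable_rotate (g : homeoS1 R) :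
  measurable_fun setT (fun t : R => (rotate t * g)%g : borelH).
Proof.
apply: (@measurability _ _ _ borelH _ _ (@open (homeoS1 R))) => //.
move=> _ [U oU <-]; rewrite setTI; apply: measurable_realfun.open_measurable.
by apply: open_comp => // x _; exact: continuous_rotate.
Qed.

Definition inner U (d : R) : set (homeoS1 R) :=
  [set f | forall g, (forall x, circle_dist (f x) (g x) < d) -> U g].

(** Tonelli's theorem needs the product sigma-algebra, not the Borel sets of the product topology.
    The preimage of an open set is therefore written as a countable union of rectangles, using only
    that the parameter [t] can be approximated by rationals. *)
Lemma measurable_rotate_mul (g h : homeoS1 R) :
  measurable_fun setT (fun tk : R * borelH => (rotate tk.1 * (g * tk.2 * h))%g : borelH).
Proof.
apply: (@measurability _ _ _ borelH _ _ (@open (homeoS1 R))) => //.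
move=> _ [U oU <-]; rewrite setTI.
pose e (n : nat) : R := n.+1%:R^-1.
have e0 n : 0 < e n by rewrite invr_gt0.
pose A n (s : rat) : set (R * borelH) := ball (ratr s : R) (e n) `*`
  ((fun k : homeoS1 R => ((rotate (ratr s) * g) * k * h)%g) @^-1` (inner U (2 * e n))^°).
rewrite (_ : _ @^-1` U = \bigcup_n \bigcup_s A n s).
  apply: bigcupT_measurable => n; apply: bigcupT_measurable_rat => s.
  apply: measurableX; first exact: measurable_ball.
  apply: open_borel; apply: open_comp; last exact: open_interior.
  by move=> x _; exact: continuous_homeo_mul.
have dist_tr (x y z : homeoS1 R) (a b : R) :
    (forall c, circle_dist (x c) (y c) < a) -> (forall c, circle_dist (y c) (z c) < b) ->
    forall c, circle_dist (x c) (z c) < a + b.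
  by move=> xy yz c; apply: le_lt_trans (circle_dist_triangle (y c) _ _) _; rewrite ltrD.
have rot_cl (s t : R) (d : R) (k : homeoS1 R) : `|s - t| < d ->
    forall c, circle_dist (homeo_fun (rotate s * (g * k * h))%g c)
      (homeo_fun (rotate t * (g * k * h))%g c) < d.
  by move=> st c; rewrite !homeo_mulE; apply: le_lt_trans st; exact: rotate_dist.
apply/seteqP; split=> [[t k] /= Utk|[t k] [n _ [s _ [/= st]]]].
  have /homeo_nbhs[d d0 dU] : nbhs (rotate t * (g * k * h))%g U.
    by apply: open_nbhs_nbhs.
  (* The margin pays [e n] for replacing [t] by a rational, [e n] for an open neighbourhood, and
     [2 * e n] for [inner]. *)
  have [n hn] : exists n, 4 * e n < d.
    exists (Num.bound (d / 4)^-1); rewrite mulrC -ltr_pdivlMr// invf_plt ?posrE ?divr_gt0//.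
    apply: (@lt_trans _ _ (Num.bound (d / 4)^-1)%:R); last by rewrite ltr_nat.
    by rewrite archi_boundP// invr_ge0 ltW// divr_gt0.
  have [|s] := rat_in_itvoo (_ : t < t + e n); first by rewrite ltrDl.
  rewrite in_itv/= => /andP[ts st].
  exists n => //; exists s => //; split=> /=.
    by rewrite /ball/= ger0_norm; lra.
  rewrite /interior; apply/homeo_nbhs; exists (e n) => // x xs y xy; apply: dU.
  have ->: d = e n + (e n + (d - 2 * e n)) by ring.
  apply: (dist_tr _ (rotate (ratr s) * (g * k * h))%g).
    by apply: rot_cl; rewrite ltr0_norm; lra.
  apply: (dist_tr _ x); first by move=> c; have := xs c; rewrite !mulgA.
  by move=> c; apply: lt_trans (xy c) _; lra.
move=> /interior_subset; apply => x; rewrite -!mulgA [(g * _)%g]mulgA.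
by apply: rot_cl; apply: lt_trans st _; have := e0 n; lra.
Qed.

End homeo_measurability.

(** * Borel sets defined through the canonical lift *)

Section canonical_lift.
Context {R : realType}.
Implicit Types (f g : homeoS1 R) (F G : R -> R) (q : nat) (p : int) (r s : R).
Local Notation borelH := (borelType (homeoS1 R)).

Lemma clift_subproof f : exists F, [/\ lifting F,
  forall x, circle_of (F x) = f (circle_of x) & 0 <= F 0 < 1].
Proof.
have [F lF Ff] := homeo_lift f; have [k /andP[k1 k2]] := int_floor (F 0).
exists (fun x => F x - k%:~R); split; first exact: lifting_shift.
  by move=> x; rewrite -mulrNz circle_ofDint.
by apply/andP; split; lra.
Qed.

Definition clift f : R -> R := projT1 (cid (clift_subproof f)).

Lemma cliftP f : [/\ lifting (clift f),
  forall x, circle_of (clift f x) = f (circle_of x) & 0 <= clift f 0 < 1].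
Proof. exact: (projT2 (cid (clift_subproof f))). Qed.

Lemma clift_eq f F : lifting F -> (forall x, circle_of (F x) = f (circle_of x)) ->
  0 <= F 0 < 1 -> clift f = F.
Proof.
move=> lF Ff F0; have [lC Cf C0] := cliftP f.
have [k kE] := lift_unique lF lC Ff Cf.
suff k0 : k = 0 by apply/funext => x; rewrite kE k0 addr0.
have : `|k%:~R| < 1%:~R :> R.
  by have := kE 0; rewrite ltr_norml => ?; apply/andP; split; lra.
by rewrite -intr_norm ltr_int => ?; lia.
Qed.

(** The canonical lift varies continuously except on the closed set [D], near which it may jump by
    1. The set is thus an open part of the complement of [D] together with a relatively open part of
    [D]. *)
Lemma measurable_clift (Q : (R -> R) -> Prop) :
  (forall F, lifting F -> Q F -> exists2 e, 0 < e &
     forall G, lifting G -> (forall x, `|G x - F x| < e) -> Q G) ->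
  measurable ([set f | Q (clift f)] : set borelH).
Proof.
move=> openQ; pose D := [set f : homeoS1 R | clift f 0 = 0].
pose P := [set f : homeoS1 R | Q (clift f)].
have nearby f e : 0 < e -> e <= 4^-1 -> nbhs f [set g : homeoS1 R |
    exists G, [/\ lifting G, forall x, circle_of (G x) = g (circle_of x) &
      forall x, `|G x - clift f x| < e]].
  move=> e0 e4; apply/homeo_nbhs; exists e => // g fg.
  by have [lF Ff _] := cliftP f; exact: near_lift lF Ff e4 fg.
have nD f : ~ D f -> exists2 d, 0 < d & forall g G, lifting G ->
    (forall x, circle_of (G x) = g (circle_of x)) ->
    (forall x, `|G x - clift f x| < d) -> clift g = G /\ ~ D g.
  move=> Df; have [lF Ff /andP[F0 F1]] := cliftP f.
  have {}F0 : 0 < clift f 0 by rewrite lt_neqAle F0 andbT eq_sym; apply/eqP.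
  exists (Num.min (clift f 0) (1 - clift f 0)); first by rewrite lt_min F0 subr_gt0.
  move=> g G lG Gg GF; have := GF 0.
  rewrite ltr_norml lt_min ltrNl lt_min => /andP[/andP[h1 h2] /andP[h3 h4]].
  have gG : clift g = G by apply: clift_eq => //; apply/andP; split; lra.
  by split=> //; rewrite /D /= gG; lra.
have oDC : open (~` D).
  apply: open_nbhs_sub => f Df; have [d d0 hd] := nD f Df.
  have e0 : 0 < Num.min d 4^-1 by rewrite lt_min d0 invr_gt0 ltr0n.
  apply: filterS (nearby f _ e0 _); last by rewrite ge_min lexx orbT.
  move=> g [G [lG Gg GF]].
  by have [|_ //] := hd g G lG Gg; move=> x; apply: lt_le_trans (GF x) _; rewrite ge_min lexx.
have P1 f : P f -> ~ D f -> nbhs f P.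
  move=> Pf Df; have [d d0 hd] := nD f Df; have [lF _ _] := cliftP f.
  have [e e0 he] := openQ _ lF Pf.
  have m0 : 0 < Num.min e (Num.min d 4^-1) by rewrite !lt_min e0 d0 invr_gt0 ltr0n.
  apply: filterS (nearby f _ m0 _); last by rewrite !ge_min lexx !orbT.
  move=> g [G [lG Gg GF]].
  have [|gG _] := hd g G lG Gg.
    by move=> x; apply: lt_le_trans (GF x) _; rewrite !ge_min lexx !orbT.
  rewrite /P /= gG; apply: he => // x; apply: lt_le_trans (GF x) _.
  by rewrite ge_min lexx.
have P2 f : P f -> D f -> nbhs f (P `|` ~` D).
  move=> Pf Df; have [lF _ _] := cliftP f; have [e e0 he] := openQ _ lF Pf.
  have m0 : 0 < Num.min e 4^-1 by rewrite !lt_min e0 invr_gt0 ltr0n.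
  apply: filterS (nearby f _ m0 _); last by rewrite !ge_min lexx !orbT.
  move=> g [G [lG Gg GF]].
  have [Dg|Dg] := pselect (D g); [left|by right].
  have [lC Cg _] := cliftP g; have [k kE] := lift_unique lC lG Cg Gg.
  have := GF 0; rewrite kE Df Dg subr0 add0r lt_min => /andP[_ k4].
  have k0 : k = 0.
    have : `|k%:~R| < 1%:~R :> R by apply: lt_trans k4 _; lra.
    by rewrite -intr_norm ltr_int => ?; lia.
  have gG : clift g = G by apply/funext => x; rewrite kE k0 addr0.
  rewrite /P /= gG; apply: he => // x; apply: lt_le_trans (GF x) _.
  by rewrite ge_min lexx.
rewrite [X in measurable X](_ : _ = (P° `&` ~` D) `|` ((P `|` ~` D)° `&` D)).
  have mD : measurable (D : set borelH).
    by apply: closed_borel; rewrite -[D]setCK; exact: open_closedC.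
  apply: measurableU; apply: measurableI => //.
  - by apply: open_borel; exact: open_interior.
  - exact: measurableC.
  - by apply: open_borel; exact: open_interior.
apply/seteqP; split=> f.
  by move=> Pf; have [Df|Df] := pselect (D f); [right; split=> //; exact: P2|left; split=> //; exact: P1].
by case=> [[/interior_subset]//|[/interior_subset[//|nDf] Df]].
Qed.

Lemma iter_near F q e : lifting F -> 0 < e -> exists2 d, 0 < d &
  forall G, (forall x, `|G x - F x| < d) -> forall x, `|iter q G x - iter q F x| < e.
Proof.
move=> lF; elim: q e => [|q ih] e e0.
  by exists 1 => // G _ x; rewrite subrr normr0.
have e20 : 0 < e / 2 by rewrite divr_gt0.
have [d1 d10 h1] := lifting_uniform lF e20; have [d2 d20 h2] := ih _ d10.
exists (Num.min d2 (e / 2)); first by rewrite lt_min d20.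
move=> G GF x; rewrite !iterS (splitr e).
rewrite (_ : _ - _ = (G (iter q G x) - F (iter q G x)) +
  (F (iter q G x) - F (iter q F x))); last by ring.
apply: (le_lt_trans (ler_normD _ _)); apply: ltrD.
  by have := GF (iter q G x); rewrite lt_min => /andP[].
by apply: h1; apply: h2 => y; have := GF y; rewrite lt_min => /andP[].
Qed.

(** The interval is closed so that the absence of a solution is, by compactness, an open condition
    on [F]. *)
Definition has_zero F q p r s := exists2 x, r <= x <= s & iter q F x = x + p%:~R.

Lemma measurable_has_zero q p r s : r < s ->
  measurable ([set f | has_zero (clift f) q p r s] : set borelH).
Proof.
move=> rs; rewrite -[X in measurable X]setCK; apply: measurableC.
apply: (@measurable_clift (fun F => ~ has_zero F q p r s)) => F lF nz.
have lq := lifting_iter q lF.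
pose h x := `|iter q F x - x - p%:~R|.
have ch : continuous h.
  move=> x; apply: cvg_norm; apply: cvgB; last exact: cvg_cst.
  by apply: cvgB; [exact: lifting_continuous|exact: cvg_id].
have [|m mrs hm] := EVT_min (ltW rs) (f := h); first exact: continuous_subspaceT.
have hm0 : 0 < h m.
  rewrite normr_gt0 subr_eq0 subr_eq addrC; apply/eqP => zm; apply: nz.
  by exists m => //; rewrite in_itv in mrs.
have [d d0 hd] := iter_near q lF hm0; exists d => // G lG GF [x xrs zx].
have := hd G GF x; rewrite zx.
have /hm hx : x \in `[r, s] by rewrite in_itv.
by move=> /lt_le_trans /(_ hx); rewrite /h distrC opprD addrA ltxx.
Qed.

Lemma measurable_exists_lt q p r s :
  measurable ([set f | exists2 x, r <= x <= s & iter q (clift f) x < x + p%:~R]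
    : set borelH).
Proof.
apply: (@measurable_clift (fun F => exists2 x, r <= x <= s & iter q F x < x + p%:~R)).
move=> F lF [x xrs Fx]; have e0 : 0 < x + p%:~R - iter q F x by rewrite subr_gt0.
have [d d0 hd] := iter_near q lF e0; exists d => // G lG GF; exists x => //.
by have := hd G GF x; rewrite ltr_norml => /andP[? ?]; lra.
Qed.

Lemma measurable_exists_gt q p r s :
  measurable ([set f | exists2 x, r <= x <= s & x + p%:~R < iter q (clift f) x]
    : set borelH).
Proof.
apply: (@measurable_clift (fun F => exists2 x, r <= x <= s & x + p%:~R < iter q F x)).
move=> F lF [x xrs Fx]; have e0 : 0 < iter q F x - (x + p%:~R) by rewrite subr_gt0.
have [d d0 hd] := iter_near q lF e0; exists d => // G lG GF; exists x => //.
by have := hd G GF x; rewrite ltr_norml => /andP[? ?]; lra.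
Qed.

Definition one_sided F q p r s := has_zero F q p r s /\
  ((~ exists2 x, r <= x <= s & iter q F x < x + p%:~R) \/
   (~ exists2 x, r <= x <= s & x + p%:~R < iter q F x)).

Lemma measurable_one_sided q p r s : r < s ->
  measurable ([set f | one_sided (clift f) q p r s] : set borelH).
Proof.
move=> rs; apply: measurableI; first exact: measurable_has_zero.
by apply: measurableU; apply: measurableC;
  [exact: measurable_exists_lt|exact: measurable_exists_gt].
Qed.

(** Two distinct solutions at arbitrarily small distance in a bounded window, separated by rational
    intervals to keep the condition countable. The window (-1, 2) leaves room for rational ends
    around solutions in [0, 1). *)
Definition accumulating F q p := forall n : nat, exists r s u v : rat,
  [/\ -1 < ratr r :> R, ratr v < 2 :> R, r < s, s < u & u < v] /\
  [/\ ratr v - ratr r < n.+1%:R^-1 :> R, has_zero F q p (ratr r) (ratr s) &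
      has_zero F q p (ratr u) (ratr v)].

Lemma measurable_accumulating q p :
  measurable ([set f | accumulating (clift f) q p] : set borelH).
Proof.
pose A n (x : rat * rat * (rat * rat)) : set borelH := [set f |
  [/\ -1 < ratr x.1.1 :> R, ratr x.2.2 < 2 :> R, x.1.1 < x.1.2, x.1.2 < x.2.1 & x.2.1 < x.2.2] /\
  [/\ ratr x.2.2 - ratr x.1.1 < n.+1%:R^-1 :> R,
      has_zero (clift f) q p (ratr x.1.1) (ratr x.1.2) &
      has_zero (clift f) q p (ratr x.2.1) (ratr x.2.2)]].
rewrite (_ : [set f | _] = \bigcap_n \bigcup_x A n x).
  apply: bigcapT_measurable => n; apply: countable_bigcupT_measurable => //.
  move=> [[r s] [u v]]; rewrite /A /=.
  set C1 := (X in [set f | X /\ _]); have [c1|nc1] := pselect C1; last first.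
    by rewrite (_ : [set f | _] = set0)//; apply/seteqP; split=> f // -[].
  set C2 : Prop := ratr v - ratr r < n.+1%:R^-1 :> R.
  have [c2|nc2] := pselect C2; last first.
    by rewrite (_ : [set f | _] = set0)//; apply/seteqP; split=> f // -[_ []].
  have [_ _ rs _ uv] := c1.
  rewrite (_ : [set f | _] = [set f | has_zero (clift f) q p (ratr r) (ratr s)] `&`
    [set f | has_zero (clift f) q p (ratr u) (ratr v)]).
    by apply: measurableI; apply: measurable_has_zero; rewrite ltr_rat.
  by apply/seteqP; split=> f [] // _ [].
apply/seteqP; split=> f h n; first by move=> _; have [r [s [u [v H]]]] := h n; exists (r, s, (u, v)).
by have [[[r s] [u v]] _ H] := h n I; exists r, s, u, v.
Qed.

Definition degenerate F := exists q p, (0 < q)%N /\ (accumulating F q p \/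
  exists r s : rat, r < s /\ one_sided F q p (ratr r) (ratr s)).

Lemma measurable_degenerate :
  measurable ([set f | degenerate (clift f)] : set borelH).
Proof.
pose A q p : set borelH := [set f | accumulating (clift f) q p] `|`
  \bigcup_(x : rat * rat) (if (x.1 < x.2)%R
     then [set f | one_sided (clift f) q p (ratr x.1) (ratr x.2)] else set0).
rewrite (_ : [set f | _] = \bigcup_q \bigcup_p A q.+1 p).
  apply: bigcupT_measurable => q; apply: countable_bigcupT_measurable => // p.
  apply: measurableU; first exact: measurable_accumulating.
  apply: countable_bigcupT_measurable => // -[r s] /=.
  by case: ifPn => // rs; apply: measurable_one_sided; rewrite ltr_rat.
apply/seteqP; split=> f.
  move=> [[|q] [p [// _ h]]]; exists q => //; exists p => //.
  by case: h => [h|[r [s [rs h]]]]; [left|right; exists (r, s) => //=; rewrite rs].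
move=> [q _ [p _ h]]; exists q.+1, p; split=> //.
case: h => [h|[[r s] _ /=]]; first by left.
by case: ifPn => // rs h; right; exists r, s.
Qed.

Lemma measurable_rot a : measurable ([set f | rot (clift f) a] : set borelH).
Proof.
rewrite (_ : [set f | _] = \bigcap_n ~` [set f | 1 < `|iter n (clift f) 0 - n%:R * a|]).
  apply: bigcapT_measurable => n; apply: measurableC.
  apply: (@measurable_clift (fun F => 1 < `|iter n F 0 - n%:R * a|)) => F lF h.
  have e0 : 0 < `|iter n F 0 - n%:R * a| - 1 by rewrite subr_gt0.
  have [d d0 hd] := iter_near n lF e0; exists d => // G lG GF.
  have := hd G GF 0; have := ler_distD (iter n G 0) (iter n F 0) (n%:R * a).
  by rewrite [`|iter n F 0 - iter n G 0|]distrC; lra.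
apply/seteqP; split=> f h n; first by move=> _ /=; apply/negP; rewrite -leNgt.
by have := h n I; rewrite /= => /negP; rewrite -leNgt.
Qed.

End canonical_lift.

(** * Counting preimages of levels *)

Section separation.
Context {R : realType}.

Lemma seq_separated (s : seq R) : exists2 d : R, 0 < d &
  forall x y, x \in s -> y \in s -> x != y -> d <= `|x - y|.
Proof.
have one (x : R) (r : seq R) : exists2 d : R, 0 < d & forall y, y \in r -> x != y -> d <= `|x - y|.
  elim: r => [|z r [d d0 hd]]; first by exists 1.
  have [xz|xz] := eqVneq x z.
    exists d => // y; rewrite in_cons => /predU1P[->|/hd//].
    by rewrite xz eqxx.
  exists (Num.min d `|x - z|); first by rewrite lt_min d0 normr_gt0 subr_eq0.
  move=> y; rewrite in_cons => /predU1P[-> _|yr xy]; first by rewrite ge_min lexx orbT.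
  by rewrite ge_min hd.
elim: s => [|x s [d d0 hd]]; first by exists 1.
have [e e0 he] := one x s.
exists (Num.min d e); first by rewrite lt_min d0.
move=> y z; rewrite !in_cons => /predU1P[->|ys] /predU1P[->|zs].
- by rewrite eqxx.
- by move=> xz; rewrite ge_min he ?orbT.
- by move=> yx; rewrite ge_min distrC he ?orbT// eq_sym.
- by move=> yz; rewrite ge_min hd.
Qed.

Lemma bounded_level_seq (T : eqType) (P : T -> Prop) (M : nat) :
  (forall s : seq T, uniq s -> (forall x, x \in s -> P x) -> (size s <= M)%N) ->
  exists s : seq T, forall x, P x -> x \in s.
Proof.
move=> h; apply: contrapT => /forallNP no.
have ext k : exists s : seq T, [/\ uniq s, (forall x, x \in s -> P x) & size s = k].
  elim: k => [|k [s [us Ps sk]]]; first by exists [::].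
  have [x /not_implyP[Px xs]] := (existsNP _).2 (no s).
  exists (x :: s); split => /=; rewrite ?sk//.
    by rewrite us andbT; apply/negP.
  by move=> y; rewrite in_cons => /predU1P[->|/Ps].
have [s [us Ps sM]] := ext M.+1.
by have := h s us Ps; rewrite sM ltnn.
Qed.

End separation.

Section indicatrix.
Context {R : realType}.
Local Notation mu := (@lebesgue_measure R).

(* Banach indicatrix: psi is the difference of x and of a nondecreasing
   function, hence has total variation at most 2 over a period; it covers a
   level as many times as this level has preimages. *)
Lemma indicatrix (psi : R -> R) :
  (forall x y, x <= y -> psi y - psi x <= y - x) ->
  (forall x, psi (x + 1) = psi x) ->
  exists g : R -> \bar R, [/\ measurable_fun setT g, forall t, (0 <= g t)%E,
    (\int[mu]_t g t <= 2%:E)%E &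
    forall t (s : seq R), uniq s -> (forall x, x \in s -> 0 <= x < 1 /\ psi x = t) ->
      ((size s)%:R%:E <= g t)%E].
Proof.
move=> psi_lip psi1; pose u x := x - psi x.
have u_le (x y : R) : x <= y -> u x <= u y by move=> /psi_lip; rewrite /u; lra.
pose a n (i : nat) : R := i%:R / n.+1%:R.
(* On the i-th cell [psi] rises by at most the mesh and falls by at most the increment of [u], so
   [K n i] contains its image. The lengths add up to 1 for the meshes and 1 for [u], that is 2. *)
pose K n i : set R := `[psi (a n i) - (u (a n i.+1) - u (a n i)),
                        psi (a n i) + n.+1%:R^-1]%classic.
pose N n t : \bar R := (\sum_(i < n.+1) (\1_(K n i) t)%:E)%E.
have mK n i : measurable (K n i) by exact: measurable_itv.
have mN1 n i : measurable_fun setT (fun t => (\1_(K n i) t)%:E : \bar R).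
  by apply/measurable_EFinP; exact: measurable_indic.
have mN n : measurable_fun setT (N n).
  by apply: emeasurable_sum => i; exact: mN1.
have N0 n t : (0 <= N n t)%E by apply: sume_ge0 => i _; rewrite lee_fin.
have aS n i : a n i.+1 = a n i + n.+1%:R^-1 by rewrite /a -natr1 mulrDl mul1r.
have a_le n i : a n i <= a n i.+1 by rewrite aS lerDl invr_ge0.
have intK n i : (\int[mu]_t (\1_(K n i) t)%:E =
    (n.+1%:R^-1 + (u (a n i.+1) - u (a n i)))%:E)%E.
  transitivity (mu (K n i)).
    apply: (etrans (@integral_indic _ _ _ mu setT measurableT (K n i) (mK n i))).
    by congr (mu _); exact: setIT.
  have lt1 : psi (a n i) - (u (a n i.+1) - u (a n i)) < psi (a n i) + n.+1%:R^-1.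
    have := u_le _ _ (a_le n i); have : 0 < n.+1%:R^-1 :> R by rewrite invr_gt0.
    by move: (u _) (u _) (psi _) _^-1 => u1 u2 w v v0 u12; lra.
  rewrite lebesgue_measure_itv/= lte_fin lt1.
  by rewrite -EFinB; congr EFin; ring.
have intN n : (\int[mu]_t N n t = 2%:E)%E.
  rewrite ge0_integral_sum//; last by move=> i; exact: mN1.
  rewrite (eq_bigr (fun i : 'I_n.+1 =>
    (n.+1%:R^-1 + (u (a n i.+1) - u (a n i)))%:E)%E); last by move=> i _; exact: intK.
  rewrite sumEFin big_split/= sumr_const card_ord -(big_mkord xpredT (fun i => u (a n i.+1) - u (a n i))).
  rewrite telescope_sumr//.
  have -> : n.+1%:R^-1 *+ n.+1 = 1 :> R by rewrite -[LHS]mulr_natr mulVf.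
  have -> : a n n.+1 = 1 by rewrite /a divff.
  have -> : a n 0%N = 0 by rewrite /a mul0r.
  by rewrite /u -[in psi 1](add0r 1) psi1; congr EFin; ring.
exists (fun t => limn_einf (N ^~ t)); split.
- rewrite /limn_einf; apply: measurableT_comp => //.
  by apply: measurable_fun_limn_esup => n; apply: measurableT_comp.
- move=> t; rewrite limn_einf_lim; apply: lime_ge; first exact: is_cvg_einfs.
  by apply: nearW => n; apply: le_ereal_inf_tmp => _ [m _ <-].
- apply: le_trans (fatou _ _ _ _) _ => //.
  rewrite (_ : (fun n => _) = cst 2%:E); last by apply/funext => n; rewrite intN.
  rewrite limn_einf_lim (_ : einfs _ = cst 2%:E) ?lim_cst//.
  apply/funext => n; rewrite /einfs /= (_ : sdrop _ _ = [set 2%:E]) ?ereal_inf1//.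
  by apply/seteqP; split=> x /= => [[m _ <-]//|->]; exists n => /=.
move=> t s us hs; have [d d0 hd] := seq_separated s.
pose n0 := Num.bound d^-1.
rewrite limn_einf_lim; apply: lime_ge; first exact: is_cvg_einfs.
(* Once the mesh is below the separation [d], the preimages of [t] lie in distinct cells and each
   one is counted. *)
exists n0 => // n n0n; apply: le_ereal_inf_tmp => _ [m nm <-].
have md : m.+1%:R^-1 < d.
  rewrite invf_plt ?posrE//; apply: (@lt_le_trans _ _ n0%:R).
    by rewrite archi_boundP// invr_ge0 ltW.
  by rewrite ler_nat (leq_trans n0n)// (leq_trans nm).
pose idx (x : R) : 'I_m.+1 := inord (Num.truncn (m.+1%:R * x)).
have idxP x : x \in s -> a m (idx x) <= x < a m (idx x).+1.
  move=> /hs[/andP[x0 x1] _].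
  have /truncn_itv/andP[h1 h2] : 0 <= m.+1%:R * x by rewrite mulr_ge0.
  have h3 : (Num.truncn (m.+1%:R * x) < m.+1)%N.
    by rewrite -(ltr_nat R) (le_lt_trans h1)// gtr_pMr.
  rewrite /a inordK// ler_pdivrMr// [x * _]mulrC h1/= ltr_pdivlMr//.
  by rewrite mulrC.
have idx_inj : {in s &, injective idx}.
  move=> x y xs ys xy; apply/eqP; rewrite -[_ == _]negbK; apply/negP => nxy.
  have := idxP x xs; have := idxP y ys; have := hd x y xs ys nxy.
  rewrite xy aS; move: (a m (idx y)) m.+1%:R^-1 md => A w md h /andP[? ?] /andP[? ?].
  have : `|x - y| < d by rewrite ltr_norml; apply/andP; split; lra.
  by rewrite ltNge h.
have inK x : x \in s -> K m (idx x) t.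
  move=> xs; have [_ <-] := hs x xs; have /andP[h1 h2] := idxP x xs.
  rewrite /K /= in_itv/=; have := psi_lip _ _ h1; have := psi_lip _ _ (ltW h2).
  have := u_le _ _ h1; have := u_le _ _ (ltW h2).
  move: h1 h2; rewrite /u aS; move: (a m _) m.+1%:R^-1 => A w.
  by move: (psi _) (psi _) (psi _) => *; apply/andP; split; lra.
rewrite -(size_map idx) /N sumEFin lee_fin.
have us' : uniq (map idx s) by rewrite map_inj_in_uniq.
rewrite -sum1_size natr_sum (big_uniq _ us')/=.
rewrite [leRHS](bigID (mem (map idx s)))/= ler_wpDr ?sumr_ge0//.
apply: ler_sum => i /mapP[x xs ->].
by rewrite indicE mem_set//; exact: inK.
Qed.

End indicatrix.

(** * Haar null sets *)

Lemma negligible_bigcup_countable d (T : measurableType d) (R : realType)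
    (nu : {measure set T -> \bar R}) (I : countType) (N : I -> set T) :
  (forall i, nu.-negligible (N i)) -> nu.-negligible (\bigcup_i N i).
Proof.
move=> hN; apply: (@negligibleS _ _ _ nu
    (\bigcup_n (if unpickle n is Some i then N i else set0))).
  by move=> t [i _ Nt]; exists (pickle i) => //; rewrite pickleK.
by apply: negligible_bigcup => n; case: unpickle => // ; exact: negligible_set0.
Qed.

Section degenerate_negligible.
Context {R : realType}.
Local Notation mu := (@lebesgue_measure R).
Implicit Types (F : R -> R) (x y t : R).

Lemma shift_iter F q x (s t : R) : lifting F -> (0 < q)%N -> s <= t ->
  iter q (fun y => F y + s) x + (t - s) <= iter q (fun y => F y + t) x.
Proof.
move=> lF; case: q => // q _ st.
have h : F (iter q (fun y => F y + s) x) <= F (iter q (fun y => F y + t) x).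
  rewrite (lifting_le lF).
  by apply: iter_le_mono => //; [exact: lifting_shift|move=> z; rewrite lerD2l].
by rewrite !iterS; lra.
Qed.

(** The q-th iterate at [x] is continuous in [t] and grows at least as fast as [t], so the equation
    has one solution. For the one-sided Lipschitz bound, raise the parameter at [x] from [psi x] to
    a larger [psi y]: the iterate gains at least the difference, yet stays below its value y + p at
    [y]. *)
Lemma level_fun F q (p : int) : lifting F -> (0 < q)%N -> exists psi : R -> R,
  [/\ forall x t, iter q (fun y => F y + t) x = x + p%:~R <-> psi x = t,
      forall x t, x + p%:~R < iter q (fun y => F y + t) x <-> psi x < t,
      (forall x y, x <= y -> psi y - psi x <= y - x) &
      forall x, psi (x + 1) = psi x].
Proof.
move=> lF q0; pose H x t := iter q (fun y => F y + t) x.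
have Hst x (s t : R) : s <= t -> H x s + (t - s) <= H x t by exact: shift_iter.
have cH x : continuous (H x).
  move=> t; apply/cvgrPdist_lt => e e0.
  have [d d0 hd] := iter_near q (lifting_shift t lF) e0.
  near=> s; rewrite distrC; apply: hd => y.
  rewrite opprD addrACA subrr add0r distrC.
  by near: s; apply: cvgr_dist_lt.
have ex x : exists t, H x t = x + p%:~R.
  have [h|h] := leP (H x 0) (x + p%:~R).
    have h0 : 0 <= x + p%:~R - H x 0 by rewrite subr_ge0.
    have := Hst x _ _ h0; rewrite subr0 addrC subrK => h1.
    have [|t _ tE] := itv_ivt (v := x + p%:~R) (cH x) h0; first by rewrite h.
    by exists t.
  have h0 : x + p%:~R - H x 0 <= 0 by rewrite subr_le0 ltW.
  have h1 := Hst x _ _ h0.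
  have [|t _ tE] := itv_ivt (v := x + p%:~R) (cH x) h0.
    by rewrite (ltW h) andbT; lra.
  by exists t.
have [psi psiE] := choice ex; exists psi.
have Hlt x s t : s < t -> H x s < H x t by move=> st; have := Hst x _ _ (ltW st); lra.
have lvl x t : H x t = x + p%:~R <-> psi x = t.
  split=> [h|<-//]; have [lt|lt|//] := ltgtP (psi x) t.
    by have := Hlt x _ _ lt; rewrite psiE h ltxx.
  by have := Hlt x _ _ lt; rewrite psiE h ltxx.
split=> //.
- move=> x t; split=> [h|/(Hlt x)]; last by rewrite psiE.
  rewrite ltNge le_eqVlt; apply/negP => /predU1P[tE|/(Hlt x) lt].
    by have := psiE x; rewrite /H -tE => h2; rewrite h2 ltxx in h.
  by rewrite psiE in lt; have := lt_trans h lt; rewrite ltxx.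
- move=> x y xy; have [le|lt] := leP (psi y) (psi x); first by lra.
  have := Hst x _ _ (ltW lt); rewrite psiE.
  have : H x (psi y) <= H y (psi y).
    by rewrite (lifting_le (lifting_iter q (lifting_shift _ lF))).
  by rewrite psiE; lra.
- move=> x; apply/lvl; have [_ _ h] := lifting_iter q (lifting_shift (psi x) lF).
  have h' : H (x + 1) (psi x) = H x (psi x) + 1 by exact: h.
  by apply: (etrans h'); rewrite psiE addrAC.
Unshelve. all: by end_near. Qed.

Lemma negligible_subsingleton (A : set R) :
  (forall s t, A s -> A t -> s = t) -> mu.-negligible A.
Proof.
move=> hA; have [->|/set0P[s As]] := eqVneq A set0; first exact: negligible_set0.
apply: (@negligibleS _ _ _ mu [set s]); first by move=> t At; exact: hA.
by apply/negligibleP => //; exact: lebesgue_measure_set1.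
Qed.

Lemma indicatrix_circle (psi : R -> R) :
  (forall x y, x <= y -> psi y - psi x <= y - x) ->
  (forall x, psi (x + 1) = psi x) ->
  exists g : R -> \bar R, [/\ measurable_fun setT g, forall t, (0 <= g t)%E,
    (\int[mu]_t g t <= 2%:E)%E &
    forall t (s : seq R), uniq [seq circle_of x | x <- s] ->
      (forall x, x \in s -> psi x = t) -> ((size s)%:R%:E <= g t)%E].
Proof.
move=> psi_lip psi1; have [g [mg g0 ig hg]] := indicatrix psi_lip psi1.
have psiz x (k : int) : psi (x + k%:~R) = psi x.
  have psin y n : psi (y + n%:R) = psi y.
    by elim: n => [|n ih]; rewrite ?addr0// -natr1 addrA psi1.
  case: k => n; first exact: psin.
  by rewrite NegzE mulrNz -pmulrn -(psin _ n.+1) subrK.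
exists g; split=> // t s us hs.
pose fr (x : R) := x + (- Num.floor x)%:~R.
have frE x : circle_of (fr x) = circle_of x by rewrite circle_ofDint.
rewrite -(size_map fr); apply: hg.
  apply: (@map_uniq _ _ (@circle_of R)); rewrite -map_comp.
  by rewrite (eq_map (g := @circle_of R)).
move=> _ /mapP[x xs ->]; rewrite psiz (hs _ xs); split=> //.
by have := floor_itv x; rewrite intrD /fr mulrNz => /andP[? ?]; apply/andP; split; lra.
Qed.

Lemma accumulating_zeros F q (p : int) (s : seq R) : lifting F ->
  (forall x, 0 <= x < 1 /\ iter q F x = x + p%:~R -> x \in s) ->
  ~ accumulating F q p.
Proof.
move=> lF hs acc; have lq := lifting_iter q lF; have [_ _ lq1] := lq.
(* Three consecutive periods cover the window (-1, 2) of [accumulating]. *)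
pose s3 := s ++ [seq x - 1 | x <- s] ++ [seq x + 1 | x <- s].
have in_s3 x : -1 < x -> x < 2 -> iter q F x = x + p%:~R -> x \in s3.
  move=> x1 x2 xz; rewrite !mem_cat.
  have [x0|x0] := ltP x 0.
    apply/orP; right; apply/orP; left; rewrite -[x](addrK 1).
    apply: (map_f (fun x => x - 1)); apply: hs; rewrite lq1 xz; split; last by ring.
    by apply/andP; split; lra.
  have [x01|x01] := ltP x 1; first by apply/orP; left; apply: hs; rewrite x0.
  apply/orP; right; apply/orP; right; rewrite -[x](subrK 1).
  apply: (map_f (fun x => x + 1)); apply: hs; split; first by apply/andP; split; lra.
  by have := lq1 (x - 1); rewrite subrK xz; lra.
have [d d0 hd] := seq_separated s3.
have [r [t [u [v [[r1 v2 rt tu uv] [vr [x /andP[x1 x2] xz] [y /andP[y1 y2] yz]]]]]]] :=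
  acc (Num.bound d^-1).
move: rt tu uv; rewrite -!(ltr_rat R) => rt tu uv.
have dn : (Num.bound d^-1).+1%:R^-1 < d.
  rewrite invf_plt ?posrE//; apply: (@lt_le_trans _ _ (Num.bound d^-1)%:R).
    by rewrite archi_boundP// invr_ge0 ltW.
  by rewrite ler_nat.
have xs : x \in s3 by apply: in_s3 => //; lra.
have ys : y \in s3 by apply: in_s3 => //; lra.
have := hd x y xs ys; rewrite lt_eqF; last by lra.
move=> /(_ isT); rewrite distrC gtr0_norm; last by lra.
by move=> h; have := lt_trans vr dn; lra.
Qed.

Section conjugated_family.
Context (F K K' : R -> R) (lF : lifting F) (lK : lifting K) (lK' : lifting K')
  (KK' : cancel K K') (K'K : cancel K' K).

(** With [K'] a lift of g, [K] its inverse and [F] a lift of h g, this is a lift of g R_t h,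
    displayed as a conjugate of F + t. *)
Definition conj_shift t y := K' (F (K y) + t).

Lemma lifting_conj_shift t : lifting (conj_shift t).
Proof.
exact: (lifting_comp lK' (lifting_comp (lifting_shift t lF) lK)).
Qed.

Lemma iter_conj_shift q t x :
  iter q (conj_shift t) x = K' (iter q (fun y => F y + t) (K x)).
Proof. by elim: q => [|q ih] /=; rewrite ?KK'// /conj_shift ih K'K. Qed.

Lemma conj_shift_zero q (p : int) t x :
  iter q (conj_shift t) x = x + p%:~R <->
  iter q (fun y => F y + t) (K x) = K x + p%:~R.
Proof.
rewrite iter_conj_shift -{2}(KK' x) -lifting_int//; split=> [|->//].
exact: (lifting_inj lK').
Qed.

(** Raising [t] raises the iterate everywhere, so a solution for one parameter is a strict
    inequality for any other. Each of the two kinds of one-sidedness therefore holds for at most one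
    [t]. *)
Lemma one_sided_negligible q (p : int) (r s : R) : (0 < q)%N ->
  mu.-negligible [set t | one_sided (conj_shift t) q p r s].
Proof.
move=> q0; have mono x (t t' : R) : t < t' ->
    iter q (conj_shift t) x < iter q (conj_shift t') x.
  move=> tt; rewrite !iter_conj_shift (lifting_lt lK').
  by have := shift_iter (K x) lF q0 (ltW tt); lra.
pose P1 := [set t | has_zero (conj_shift t) q p r s /\
  ~ exists2 x, r <= x <= s & iter q (conj_shift t) x < x + p%:~R].
pose P2 := [set t | has_zero (conj_shift t) q p r s /\
  ~ exists2 x, r <= x <= s & x + p%:~R < iter q (conj_shift t) x].
apply: (@negligibleS _ _ _ mu (P1 `|` P2)).
  by move=> t [z [h|h]]; [left|right].
apply: negligibleU; apply: negligible_subsingleton => t t'.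
  move=> [[x xrs xz] h] [[x' xrs' xz'] h']; have [lt|lt|//] := ltgtP t t'; exfalso.
    by apply: h; exists x' => //; rewrite -xz' mono.
  by apply: h'; exists x => //; rewrite -xz mono.
move=> [[x xrs xz] h] [[x' xrs' xz'] h']; have [lt|lt|//] := ltgtP t t'; exfalso.
  by apply: h'; exists x => //; rewrite -xz mono.
by apply: h; exists x' => //; rewrite -xz' mono.
Qed.

Lemma accumulating_negligible q (p : int) : (0 < q)%N ->
  mu.-negligible [set t | accumulating (conj_shift t) q p].
Proof.
move=> q0; have [psi [lvl _ psi_lip psi1]] := level_fun p lF q0.
have [g [mg g0 ig hg]] := indicatrix_circle psi_lip psi1.
have intg : mu.-integrable setT g.
  apply/integrableP; split=> //.
  under eq_integral do rewrite gee0_abs//.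
  by apply: le_lt_trans ig _; rewrite ltry.
have := integrable_ae measurableT intg; apply: negligibleS => t acc /= fing.
have {fing}fg := fing I.
(* An integrable [g] is finite almost everywhere and bounds the number of solutions modulo 1; [K]
   preserves this number because it commutes with integer translations. *)
have [|s hs] := @bounded_level_seq _ (fun x => 0 <= x < 1 /\ psi (K x) = t) (Num.bound (fine (g t))).
  move=> s us hs; have : ((size [seq K x | x <- s])%:R%:E <= g t)%E.
    apply: hg.
    rewrite -map_comp map_inj_in_uniq// => x y xs ys /circle_ofP[k].
    rewrite -lifting_int// => /(lifting_inj lK) kE.
    have [/andP[x0 x1] _] := hs x xs; have [/andP[y0 y1] _] := hs y ys.
    have : `|k%:~R| < 1%:~R :> R by rewrite ltr_norml; apply/andP; split; lra.
    by rewrite -intr_norm ltr_int => k1; have k0 : k = 0 by [lia]; rewrite kE k0 addr0.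
    by move=> _ /mapP[x xs ->]; have [] := hs x xs.
  rewrite size_map -(fineK fg) lee_fin => h.
  by rewrite -(ler_nat R) (le_trans h)// ltW// archi_boundP// fine_ge0.
apply: (accumulating_zeros (s := s) (lifting_conj_shift t) _ acc).
by move=> x [x01 /conj_shift_zero/lvl xt]; apply: hs.
Qed.

Lemma degenerate_negligible : mu.-negligible [set t | degenerate (conj_shift t)].
Proof.
apply: (@negligibleS _ _ _ mu (\bigcup_(qp : nat * int)
  ([set t | accumulating (conj_shift t) qp.1.+1 qp.2] `|` \bigcup_(rs : rat * rat)
     [set t | one_sided (conj_shift t) qp.1.+1 qp.2 (ratr rs.1) (ratr rs.2)]))).
  move=> t [[|q] [p [// _ h]]]; exists (q, p) => //.
  by case: h => [h|[r [s [rs h]]]]; [left|right; exists (r, s)].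
apply: negligible_bigcup_countable => -[q p]; apply: negligibleU.
  exact: accumulating_negligible.
by apply: negligible_bigcup_countable => -[r s]; exact: one_sided_negligible.
Qed.

Lemma irrational_negligible a :
  (forall q (p : int), (0 < q)%N -> q%:R * a <> p%:~R) ->
  mu.-negligible [set t | rot (conj_shift t) a].
Proof.
move=> irr; have rF t : rot (conj_shift t) a -> rot (fun y => F y + t) a.
  apply: (rot_conj (lifting_conj_shift t) (lifting_shift t lF) lK) => x.
  by rewrite /conj_shift K'K.
apply: negligible_subsingleton => s t /rF rs /rF rt.
have [st|ts|//] := ltgtP s t.
  by case: (rot_irrational_strict lF irr st rs rt).
by case: (rot_irrational_strict lF irr ts rt rs).
Qed.

End conjugated_family.

End degenerate_negligible.

Section haar_null_sets.
Context {R : realType}.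
Local Notation mu := (@lebesgue_measure R).
Local Notation borelH := (borelType (homeoS1 R)).
Implicit Types (f g h : homeoS1 R) (F : R -> R).

Lemma has_zero_shift F (j : int) q (p : int) (r s : R) : lifting F ->
  has_zero (fun y => F y + j%:~R) q p r s -> has_zero F q (p - j *+ q) r s.
Proof.
move=> lF [x xrs]; rewrite iter_shift_int// => h; exists x => //.
by rewrite intrB addrA -h addrK.
Qed.

Lemma degenerate_shift F (j : int) : lifting F ->
  degenerate (fun y => F y + j%:~R) -> degenerate F.
Proof.
move=> lF [q [p [q0 h]]]; exists q, (p - j *+ q); split=> //.
case: h => [acc|[r [s [rs [z side]]]]]; [left|right].
  move=> n; have [r [s [u [v [? [? z1 z2]]]]]] := acc n.
  by exists r, s, u, v; split=> //; split=> //; exact: has_zero_shift.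
exists r, s; split=> //; split; first exact: has_zero_shift.
by case: side => side; [left|right] => -[x xrs hx]; apply: side; exists x => //;
  rewrite iter_shift_int// -?ltrBrDr -?ltrBlDr;
  move: hx; rewrite intrB; lra.
Qed.

Lemma borel_haar_null_negligible (B : set (homeoS1 R)) :
  measurable (B : set borelH) ->
  (forall g h, mu.-negligible [set t | B (g * rotate t * h)%g]) ->
  borel_haar_null R B.
Proof.
move=> mB nB; split=> //.
(* The test measure is the law of [rotate t] for [t] uniform on [0, 1], so Lebesgue negligible sets
   of parameters have probability zero. *)
pose X (t : measurableTypeR R) : borelH := (rotate t * 1)%g.
have mX : measurable_fun setT X by exact: measurable_rotate.
pose Xm : {mfun measurableTypeR R >-> borelH} := HB.pack X (isMeasurableFun.Build _ _ _ _ X mX).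
exists (distribution (uniform_prob (@ltr01 R)) Xm) => g h.
rewrite /distribution /pushforward.
have mA : measurable (X @^-1` translate g h B).
  rewrite -[X @^-1` _]setTI; apply: (mX) => //.
  rewrite (_ : translate g h B = setT `&` (fun k : borelH => (g^-1 * k * h^-1)%g : borelH) @^-1` B).
    by apply: measurable_homeo_mul.
  apply/seteqP; split=> k /=.
    move=> [b Bb <-]; split=> //=.
    by rewrite -!mulgA mulgV mulg1 mulKg.
  move=> [_ Bk]; exists (g^-1 * k * h^-1)%g => //.
  by rewrite -!mulgA mulVg mulg1 mulVKg.
have dom := @dominates_uniform_prob R 0 1 ltr01.
move/null_content_dominatesP in dom.
apply: dom => //; apply: measure_negligible => //.
apply: negligibleS (nB g^-1%g h^-1%g) => t /= [b Bb].
rewrite /X mulg1 => <-.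
by rewrite -!mulgA mulgV mulg1 mulKg.
Qed.

Lemma clift_sandwich g h : exists F K K',
  [/\ lifting F, lifting K, lifting K', cancel K K' & cancel K' K] /\
  forall t, exists j : int, forall x,
    clift (g * rotate t * h)%g x = conj_shift F K K' t x + j%:~R.
Proof.
have [G lG Gg] := homeo_lift g; have [H lH Hh] := homeo_lift h.
have [K [lK GK KG]] := lifting_inv lG.
exists (H \o G), K, G; split; first by split=> //; exact: lifting_comp.
move=> t; have [lC Cf _] := cliftP (g * rotate t * h)%g.
have lS := lifting_conj_shift (lifting_comp lH lG) lK lG t.
apply: (lift_unique lS lC _ Cf) => x.
by rewrite /conj_shift /= KG Gg -rotateE Hh.
Qed.

Lemma haar_null_degenerate :
  borel_haar_null R [set f : homeoS1 R | degenerate (clift f)].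
Proof.
apply: borel_haar_null_negligible; first exact: measurable_degenerate.
move=> g h; have [F [K [K' [[lF lK lK' KK' K'K] hC]]]] := clift_sandwich g h.
apply: negligibleS (degenerate_negligible lF lK lK' KK' K'K) => t /=.
have [j jE] := hC t; rewrite (_ : clift _ = fun x => conj_shift F K K' t x + j%:~R).
  by apply: degenerate_shift; exact: lifting_conj_shift.
exact/funext.
Qed.

(** The union over [j] is taken because the rotation number determines the translation number of the
    canonical lift only modulo 1. *)
Lemma haar_null_irrational a : (forall q (p : int), (0 < q)%N -> q%:R * a <> p%:~R) ->
  borel_haar_null R [set f : homeoS1 R | exists j : int, rot (clift f) (a + j%:~R)].
Proof.
move=> irr; apply: borel_haar_null_negligible.
  rewrite (_ : [set f | _] = \bigcup_j [set f | rot (clift f) (a + j%:~R)]).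
    by apply: countable_bigcupT_measurable => // j; exact: measurable_rot.
  by apply/seteqP; split=> f [j]; [exists j|move=> _ ?; exists j].
move=> g h; have [F [K [K' [[lF lK lK' KK' K'K] hC]]]] := clift_sandwich g h.
apply: (@negligibleS _ _ _ mu (\bigcup_(k : int) [set t | rot (conj_shift F K K' t) (a + k%:~R)])).
  move=> t [k]; have [j jE] := hC t.
  rewrite (_ : clift _ = fun x => conj_shift F K K' t x + j%:~R); last exact/funext.
  move=> /(rot_shift_int (- j) (lifting_shift _ (lifting_conj_shift lF lK lK' t))) h'.
  exists (k - j) => //=; move: h'.
  rewrite (_ : (fun x => _) = conj_shift F K K' t).
    by rewrite intrB mulrNz addrA.
  by apply/funext => x; rewrite mulrNz addrK.
apply: negligible_bigcup_countable => k; apply: irrational_negligible => //.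
move=> q p q0; rewrite mulrDr => h'; apply: (irr q (p - k *+ q) q0).
by rewrite intrB rmorphMn/= -h' [q%:R * k%:~R]mulr_natl addrK.
Qed.

Lemma rational_gap (x y : R) : x < y -> exists r : rat, x < ratr r < y.
Proof. by move=> /rat_in_itvoo[r]; rewrite in_itv/= => ?; exists r. Qed.

Lemma many_zeros_cluster F q (p : int) :
  (forall n : nat, exists s : seq R, [/\ uniq s, (n < size s)%N &
    forall x, x \in s -> 0 <= x < 1 /\ iter q F x = x + p%:~R]) ->
  accumulating F q p.
Proof.
move=> many n; have [s [us ns hs]] := many n.+1.
have [x [y [xs ys xy yx]]] : exists x y, [/\ x \in s, y \in s, x < y & y - x < n.+1%:R^-1].
  pose c (z : R) := Num.truncn (n.+1%:R * z).
  have cP z : z \in s -> (c z)%:R <= n.+1%:R * z < (c z)%:R + 1.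
    move=> /hs[/andP[z0 _] _]; rewrite natr1; apply: truncn_itv.
    by rewrite mulr_ge0.
  have cn z : z \in s -> (c z < n.+1)%N.
    move=> zs; have [/andP[_ z1] _] := hs z zs; have /andP[h1 _] := cP z zs.
    by rewrite -(ltr_nat R) (le_lt_trans h1)// gtr_pMr.
  have close z w : z \in s -> w \in s -> c z = c w -> w - z < n.+1%:R^-1.
    move=> /cP /andP[z1 _] /cP /andP[_ w2] zw.
    rewrite -[X in _ < X]mulr1 ltr_pdivlMl// mulrBr; rewrite zw in z1; lra.
  have : ~~ uniq [seq c z | z <- s].
    apply/negP => uc; have : {subset [seq c z | z <- s] <= iota 0 n.+1}.
      by move=> _ /mapP[z zs ->]; rewrite mem_iota cn.
    by move=> /(uniq_leq_size uc); rewrite size_map size_iota leqNgt ns.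
  move=> nu; have [z [w [zs ws zw czw]]] : exists z w, [/\ z \in s, w \in s, z != w & c z = c w].
    apply: contrapT => /forallNP no; move/negP: nu; apply.
    rewrite map_inj_in_uniq// => z w zs ws czw; apply/eqP; apply: contrapT => /negP zw.
    by apply: (no z); exists w.
  have [lt|lt|eq] := ltgtP z w; last by rewrite eq eqxx in zw.
    by exists z, w; split=> //; exact: close.
  by exists w, z; split=> //; apply: close => //; rewrite czw.
have [/andP[x0 x1] zx] := hs x xs; have [/andP[y0 y1] zy] := hs y ys.
(* Outer rational ends within [d] of [x] and [y] stay in (-1, 2) and keep the total length below
   [w]. *)
set w := n.+1%:R^-1 in yx *; pose d := Num.min ((w - (y - x)) / 2) 1.
have d0 : 0 < d by rewrite lt_min ltr01 andbT divr_gt0// subr_gt0.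
have [dw d1] : d <= (w - (y - x)) / 2 /\ d <= 1 by rewrite !ge_min !lexx orbT.
have [|r /andP[r1 r2]] := @rational_gap (x - d) x; first by lra.
have [|t /andP[t1 t2]] := @rational_gap x ((x + y) / 2); first by lra.
have [|u /andP[u1 u2]] := @rational_gap ((x + y) / 2) y; first by lra.
have [|v /andP[v1 v2]] := @rational_gap y (y + d); first by lra.
exists r, t, u, v; split.
  by split; rewrite -1?(ltr_rat R); lra.
split; first by rewrite -/w; lra.
  by exists x => //; apply/andP; split; lra.
by exists y => //; apply/andP; split; lra.
Qed.

(** Infinitely many periodic points give infinitely many solutions in [0, 1), which accumulate; a
    periodic point that is not crossing gives a rational interval where one strict sign is
    missing. *)
Lemma not_good_degenerate f : rational (rotation_number f) -> ~ good f ->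
  degenerate (clift f).
Proof.
move=> ratf ngood; have [r _ rE] := ratf.
have r01 := ratr_rotation_itv rE.
have [p [q [p0 q0 pq h]]] := @rotation_number_rat R r r01.
have [F /is_liftP[lF Ff] rF] := (h f).1 (esym rE).
have [lC Cf _] := cliftP f; have [k kE] := lift_unique lF lC Ff Cf.
have FE : F = fun x => clift f x + (- k)%:~R.
  by apply/funext => x; rewrite kE mulrNz addrK.
suff : degenerate F by rewrite FE; exact: degenerate_shift.
exists q, p%:Z; split=> //.
have perE := periodic_return p0 q0 pq lF Ff rF.
have [fin|inf] := pselect (finite_set (periodic_points f)); last first.
  left; apply: many_zeros_cluster => n; apply: contrapT => /forallNP no.
  apply: inf.
  have [|s hs] := @bounded_level_seq _ (fun x => 0 <= x < 1 /\ return_map p q F x = x) n.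
    move=> s us Ps; rewrite leqNgt; apply/negP => ns; apply: (no s).
    by split=> // x /Ps[? /returnP]; rewrite pmulrn.
  apply: (@sub_finite_set _ _ (@circle_of R @` [set` s])); last first.
    by apply: finite_image; exact: finite_seq.
  move=> x; have [a <-] := circle_of_surj x => /perE Ga.
  have [j /andP[j1 j2]] := int_floor a.
  exists (a + (- j)%:~R); last by rewrite circle_ofDint.
  apply: hs; split; first by rewrite mulrNz; apply/andP; split; lra.
  by rewrite lifting_int ?Ga//; exact: lifting_return.
right; have [x px ncr] : exists2 x, periodic_points f x & ~ crossing_periodic_point f x.
  apply: contrapT => /forall2NP no; apply: ngood; split=> // x px.
  by have [//|/contrapT] := no x.
move: px ncr; have [a <-] := circle_of_surj x => /perE Ga.
rewrite (crossing_return p0 q0 pq lF Ff rF Ga) => /existsNP[e /not_implyP[e0 ncr]].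
have [|r1 /andP[a1 a2]] := @rational_gap (a - e) a; first by lra.
have [|s1 /andP[b1 b2]] := @rational_gap a (a + e); first by lra.
exists r1, s1; split; first by rewrite -(ltr_rat R); lra.
split.
  exists a; first by apply/andP; split; lra.
  by apply/returnP.
move/not_andP: ncr => [n|n]; [left|right] => -[y /andP[y1 y2] hy]; apply: n;
  exists y; rewrite ?ltr_norml; try (apply/andP; split); try lra;
  rewrite /return_map; move: hy; rewrite -pmulrn; lra.
Qed.

Lemma rotation_number_conj f g : conjugacy_class f g ->
  rotation_number g = rotation_number f.
Proof.
move=> /conj_lift_ex[F [G [H [lF lG lH HF]]]].
have [/is_liftP[liF _] /is_liftP[liG _]] := (lF, lG).
have [b rb] := rot_exists liF.
by rewrite (rotation_numberE lF rb) (rotation_numberE lG (rot_conj liF liG lH HF rb)).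
Qed.

Lemma good_conj f g : conjugacy_class f g -> good g -> good f.
Proof.
move=> fg /good_nf[p [q [l [p0 q0 pq nf]]]].
by have [] := nf_classP p0 q0 pq (conj_nf_class fg nf).
Qed.

Lemma non_haar_null_good f : ~ haar_null R (conjugacy_class f) -> good f.
Proof.
move=> nnull; apply: contrapT => ngood; apply: nnull.
have [rat|irr] := pselect (rational (rotation_number f)).
  exists [set g | degenerate (clift g)]; split; first exact: haar_null_degenerate.
  move=> g fg; apply: not_good_degenerate; first by rewrite (rotation_number_conj fg).
  by move=> /(good_conj fg).
exists [set g | exists j : int, rot (clift g) (rotation_number f + j%:~R)]; split.
  apply: haar_null_irrational => q p q0 h; apply: irr.
  exists (p%:Q / q%:R) => //; rewrite fmorph_div/= ratr_int ratr_nat -h mulrC mulKf//.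
  by rewrite pnatr_eq0 -lt0n.
move=> g fg; have [lC Cf _] := cliftP g; have [b rb] := rot_exists lC.
have lCg : is_lift (homeo_fun g) (clift g) by apply/is_liftP.
by exists (Num.floor b); rewrite -(rotation_number_conj fg) (rotation_numberE lCg rb) subrK.
Qed.

End haar_null_sets.

(** * Non-Haar null classes *)

Section step_map.
Context {R : realType}.

Lemma mob_itv (c r : R) : 0 < c -> 0 <= r < 1 -> 0 <= mob c r < 1.
Proof.
move=> c0 /andP[r0 r1]; have d0 : 0 < 1 - r + c * r.
  by rewrite ltr_pwDl ?subr_gt0// mulr_ge0// ltW.
rewrite /mob; apply/andP; split.
  by apply: divr_ge0; [apply: mulr_ge0 => //|]; exact: ltW.
by rewrite ltr_pdivrMr// mul1r ltrDr subr_gt0.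
Qed.

Lemma mob_incr (c : R) : 0 < c -> forall r s : R, 0 <= r -> r < s -> s < 1 -> mob c r < mob c s.
Proof.
move=> c0 r s r0 rs s1; have d1 : 0 < 1 - r + c * r.
  by rewrite ltr_pwDl ?subr_gt0// ?mulr_ge0// ?(lt_trans rs)// ltW.
have d2 : 0 < 1 - s + c * s.
  by rewrite ltr_pwDl ?subr_gt0// mulr_ge0// ltW// (le_lt_trans r0).
rewrite /mob ltr_pdivrMr// mulrAC ltr_pdivlMr//.
by rewrite -subr_gt0 (_ : _ - _ = c * (s - r)) ?mulr_gt0 ?subr_gt0//; ring.
Qed.

Lemma mob_surj (c y : R) : 0 < c -> 0 <= y < 1 -> exists2 r, 0 <= r < 1 & mob c r = y.
Proof.
move=> c0 /andP[y0 y1]; exists (mob c^-1 y).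
  by apply: mob_itv; rewrite ?invr_gt0// y0.
have d0 : 0 < c * (1 - y) + y.
  by rewrite ltr_pwDl// mulr_gt0// subr_gt0.
by rewrite /mob; field; rewrite !gt_eqF//; lra.
Qed.

(** A lift imitating the floor function: [mob c] on [0, 1), extended by the unit translation. The
    choice c = eta^2 gives mob c (1 - eta) <= eta. *)
Lemma step_map (eta : R) : 0 < eta < 1 -> exists2 s : R -> R, lifting s &
  forall (j : nat), (forall x, j%:R <= x -> j%:R <= s x) /\
    (forall x, x <= j%:R + 1 - eta -> s x <= j%:R + eta).
Proof.
move=> /andP[e0 e1]; pose c := eta * eta; have c0 : 0 < c by rewrite mulr_gt0.
pose U x : R := x + 1; pose V x : R := x - 1.
have iU : {homo U : x y / x < y} by move=> x y; rewrite ltrD2r.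
have iV : {homo V : x y / x < y} by move=> x y; rewrite ltrD2r.
have UV : cancel U V by move=> x; rewrite /V addrK.
have VU : cancel V U by move=> x; rewrite /U subrK.
have zpE k x : zpow U V k x = x + k%:~R.
  by have := @zpow_additive _ U V idfun 1 k x UV VU (fun=> erefl); rewrite mulr1.
have [||||s [s0 sU si ss]] := @abel_extension R U V 0 1 (mob c) iU iV UV VU _ ltr01.
- by rewrite /U add0r.
- by move=> x y x0 xy; rewrite /U add0r => y1; exact: mob_incr.
- by move=> x; rewrite /U add0r; exact: mob_itv.
- by move=> y; rewrite /U add0r; exact: mob_surj.
have span x : zspan U V 0 x.
  have [k /andP[k1 k2]] := int_floor x; exists k, (k + 1).
  by rewrite !zpE !add0r intrD k1.
have ls : lifting s.
  split=> [x y xy|y|x]; first exact: si.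
    by have [x _ <-] := ss y; exists x.
  exact: sU.
have sj (j : nat) x : s (x + j%:R) = s x + j%:R by exact: lifting_nat.
have s00 : s 0 = 0.
  by rewrite s0; [rewrite /mob mulr0 mul0r|rewrite /U add0r lexx ltr01].
exists s => // j; split=> x hx.
  by rewrite -[j%:R in leLHS]add0r -[0 in leLHS]s00 -sj add0r (lifting_le ls).
have -> : j%:R + eta = eta + j%:R by rewrite addrC.
apply: (@le_trans _ _ (s (1 - eta + j%:R))); first by rewrite (lifting_le ls); lra.
rewrite sj lerD2r s0; last by rewrite /U add0r; apply/andP; split; lra.
have d0 : 0 < 1 - (1 - eta) + c * (1 - eta) by rewrite ltr_pwDl// ?mulr_ge0; lra.
by rewrite /mob ler_pdivrMr// /c; nra.
Qed.

Lemma scaled_step_map (N : nat) (eta : R) : (0 < N)%N -> 0 < eta < 1 ->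
  exists2 S : R -> R, lifting S & forall j : nat,
    (forall x, j%:R / N%:R <= x -> j%:R / N%:R <= S x) /\
    (forall x, x <= (j%:R + 1 - eta) / N%:R -> S x <= (j%:R + eta) / N%:R).
Proof.
move=> N0 /step_map[s ls hs]; have N0' : 0 < N%:R :> R by rewrite ltr0n.
exists (fun x => s (x * N%:R) / N%:R).
  have [si ss s1] := ls; split=> [x y xy|y|x].
  - by rewrite ltr_pM2r ?invr_gt0// si// ltr_pM2r.
  - by have [x hx] := ss (y * N%:R); exists (x / N%:R); rewrite divfK ?gt_eqF// hx mulfK ?gt_eqF.
  - by rewrite mulrDl mul1r lifting_nat// mulrDl divff ?gt_eqF.
move=> j; have [h1 h2] := hs j; split=> x hx.
  by rewrite ler_pM2r ?invr_gt0// h1// -ler_pdivrMr.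
by rewrite ler_pM2r ?invr_gt0// h2// -ler_pdivlMr.
Qed.

End step_map.

(** * Solutions for perturbed step maps *)

Section counting.
Context {R : realType}.
Local Notation mu := (@lebesgue_measure R).

Lemma card_seq (T : choiceType) (A : set T) (n : nat) : (A #= `I_n)%card ->
  exists s : seq T, [/\ uniq s, size s = n & forall x, A x <-> x \in s].
Proof.
move=> An; have fA : finite_set A by apply/finite_setP; exists n.
exists (finmap.enum_fset (fset_set A)); split.
- exact: finmap.fset_uniq.
- exact: card_fset_set.
- by move=> x; rewrite in_fset_set// inE.
Qed.

Section steps.
Context (p q m : nat) (p0 : (0 < p)%N) (q0 : (0 < q)%N) (pq : coprime p q) (m0 : (0 < m)%N).
Let N := (q * m)%N.
Let N0 : (0 < N)%N. Proof. by rewrite muln_gt0 q0. Qed.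
Let NR0 : 0 < N%:R :> R. Proof. by rewrite ltr0n. Qed.
Context (eta : R) (eta0 : 0 < eta) (etaN : 4 * eta * (2 * N + 1)%:R < 1).
Context (S : R -> R) (lS : lifting S)
  (Sge : forall (j : nat) (x : R), j%:R / N%:R <= x -> j%:R / N%:R <= S x)
  (Sle : forall (j : nat) (x : R), x <= (j%:R + 1 - eta) / N%:R -> S x <= (j%:R + eta) / N%:R).
Context (K : R -> R) (lK : lifting K) (Kid : forall x, `|K x - x| < eta / N%:R).

Let eta4 : 4 * eta < 1.
Proof.
apply: le_lt_trans etaN; rewrite ler_peMr ?mulr_ge0 ?(ltW eta0)//.
by rewrite -[1]/(1%:R) ler_nat addn1.
Qed.

Let F x := S (K x) + p%:R / q%:R.
Let lF : lifting F.
Proof. by apply: lifting_shift; exact: (lifting_comp lS lK). Qed.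

Definition window : set R := `]eta / N%:R, (1 - 3 * eta) / N%:R[%classic.

(** Two test points per step, placed so that the error eta / N of [K] is harmless. At an even node
    [K] stays past the start of the step, and t > eta / N lifts the value above the node; at an odd
    node [K] stays in the flat part, and t < (1 - 3 eta) / N leaves the value below. The rotation by
    p / q shifts indices by the even number 2 p m, so these signs persist under iteration. *)
Definition node (i : nat) : R :=
  ((i./2)%:R + (if odd i then 1 - 2 * eta else eta)) / N%:R.

Lemma node_add i k : node (i + k.*2) = node i + k%:R / N%:R.
Proof.
rewrite /node halfD odd_double andbF add0n doubleK oddD odd_double addbF natrD.
by rewrite -mulrDl; congr (_ / _); ring.
Qed.

Lemma node_lt i : node i < node i.+1.
Proof.
rewrite /node ltr_pM2r ?invr_gt0//= uphalf_half.
by have := eta4; have := eta0; case: (odd i) => /= ? ?; rewrite ?add1n ?add0n -?(natr1 _ i./2); lra.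
Qed.

Lemma rotation_steps : p%:R / q%:R = (p * m)%:R / N%:R :> R.
Proof.
rewrite /N !natrM; have q0' : q%:R != 0 :> R by rewrite pnatr_eq0 -lt0n.
by have m0' : m%:R != 0 :> R by [rewrite pnatr_eq0 -lt0n]; field; apply/andP.
Qed.

Lemma node_even t i : window t -> ~~ odd i ->
  node (i + (p * m).*2) < F (node i) + t.
Proof.
rewrite /window /= in_itv/= => /andP[t1 _] ei; rewrite node_add /F rotation_steps.
have hK : (i./2)%:R / N%:R <= K (node i).
  have := Kid (node i); rewrite ltr_norml => /andP[h _].
  have -> : (i./2)%:R / N%:R = node i - eta / N%:R.
    by rewrite /node (negbTE ei) mulrDl addrK.
  by move: (eta / N%:R) (node i) (K _) h => w x y h; lra.
have h := Sge hK; rewrite {1}/node (negbTE ei) mulrDl.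
move: (eta / N%:R) (_ / N%:R) ((p * m)%:R / N%:R) (S _) t1 h => w x y z t1 h; lra.
Qed.

Lemma node_odd t i : window t -> odd i ->
  F (node i) + t < node (i + (p * m).*2).
Proof.
rewrite /window /= in_itv/= => /andP[_ t2] oi; rewrite node_add /F rotation_steps.
have hK : K (node i) <= ((i./2)%:R + 1 - eta) / N%:R.
  have := Kid (node i); rewrite ltr_norml => /andP[_ h].
  have -> : ((i./2)%:R + 1 - eta) / N%:R = node i + eta / N%:R.
    by rewrite /node oi -mulrDl; congr (_ / _); ring.
  by move: (eta / N%:R) (node i) (K _) h => w x y h; lra.
have := Sle hK; have -> : ((i./2)%:R + eta) / N%:R = node i - (1 - 3 * eta) / N%:R.
  by rewrite /node oi -mulrBl; congr (_ / _); ring.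
move: (_ / N%:R) (node i) ((p * m)%:R / N%:R) (S _) t2 => w x y z t2 h; lra.
Qed.

Lemma node_iter_even t i n : window t -> ~~ odd i ->
  node (i + n.+1 * (p * m).*2) < iter n.+1 (fun x => F x + t) (node i).
Proof.
move=> wt ei; have lFt := lifting_shift t lF; elim: n => [|n ih].
  by rewrite mul1n; exact: node_even.
have ei' : ~~ odd (i + n.+1 * (p * m).*2).
  by rewrite oddD (negbTE ei) oddM odd_double andbF.
have -> : (i + n.+2 * (p * m).*2 = i + n.+1 * (p * m).*2 + (p * m).*2)%N.
  by rewrite mulSn; lia.
apply: lt_trans (node_even wt ei') _.
by rewrite iterS (lifting_lt lFt).
Qed.

Lemma node_iter_odd t i n : window t -> odd i ->
  iter n.+1 (fun x => F x + t) (node i) < node (i + n.+1 * (p * m).*2).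
Proof.
move=> wt oi; have lFt := lifting_shift t lF; elim: n => [|n ih].
  by rewrite mul1n; exact: node_odd.
have oi' : odd (i + n.+1 * (p * m).*2).
  by rewrite oddD oi oddM odd_double andbF.
have -> : (i + n.+2 * (p * m).*2 = i + n.+1 * (p * m).*2 + (p * m).*2)%N.
  by rewrite mulSn; lia.
apply: lt_trans (node_odd wt oi').
by rewrite iterS (lifting_lt lFt).
Qed.

Lemma node_period i : node (i + q * (p * m).*2) = node i + p%:R.
Proof.
rewrite -doubleMr node_add; congr (_ + _).
rewrite mulnCA natrM mulfK//; exact: lt0r_neq0.
Qed.

Lemma zero_in_cell t i : window t -> exists2 x, node i < x < node i.+1 &
  iter q (fun x => F x + t) x = x + p%:~R.
Proof.
move=> wt; pose h x := iter q (fun x => F x + t) x - x.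
have lq := lifting_iter q (lifting_shift t lF).
have ch : continuous h.
  by move=> x; apply: cvgB; [exact: lifting_continuous|exact: cvg_id].
have he j : ~~ odd j -> p%:R < h (node j).
  move=> ej; have := node_iter_even q.-1 wt ej; rewrite prednK// node_period /h; lra.
have ho j : odd j -> h (node j) < p%:R.
  move=> oj; have := node_iter_odd q.-1 wt oj; rewrite prednK// node_period /h; lra.
have nn := node_lt i.
have [x /andP[x1 x2] hx] : exists2 x, node i <= x <= node i.+1 & h x = p%:R.
  have [oi|ei] := boolP (odd i).
    apply: itv_ivt => //; first exact: ltW.
    by rewrite !ltW ?ho ?he//= oi.
  apply: itv_ivt_opp => //; first exact: ltW.
  by rewrite !ltW ?ho ?he//= ei.
have hn j : h (node j) != p%:R.
  by have [/ho|/he] := boolP (odd j); rewrite neq_lt => ->; rewrite ?orbT.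
exists x; last by rewrite -pmulrn -hx /h addrC subrK.
rewrite !lt_neqAle x1 x2 !andbT; apply/andP; split; apply/eqP => xE.
  by have := hn i; rewrite xE hx eqxx.
by have := hn i.+1; rewrite -xE hx eqxx.
Qed.

Lemma zeros_seq t : window t -> exists s : seq R,
  [/\ uniq [seq circle_of x | x <- s], size s = (2 * N)%N &
      forall x, x \in s -> iter q (fun x => F x + t) x = x + p%:~R].
Proof.
move=> wt; have zex i : exists x, node i < x < node i.+1 /\
    iter q (fun x => F x + t) x = x + p%:~R.
  by have [x h1 h2] := zero_in_cell i wt; exists x.
have [z hz] := choice zex.
have node_le i j : (i <= j)%N -> node i <= node j.
  move=> /subnK <-; elim: (j - i)%N => [|k ih]; first exact: lexx.
  by rewrite addSn (le_trans ih)// ltW// node_lt.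
have z_lt i j : (i < j)%N -> z i < z j.
  move=> ij; have [/andP[_ h1] _] := hz i; have [/andP[h2 _] _] := hz j.
  by have := node_le _ _ ij; lra.
exists [seq z i | i <- iota 0 (2 * N)]; split.
- rewrite -map_comp map_inj_in_uniq ?iota_uniq// => i j.
  rewrite !mem_iota /= !add0n => iN jN.
  have zbd k : (k < 2 * N)%N -> node 0 < z k < node 0 + 1.
    move=> kN; have [/andP[h1 h2] _] := hz k; rewrite (le_lt_trans (node_le _ _ (leq0n k)) h1)/=.
    have := node_le _ _ kN; rewrite mul2n -[N.*2]add0n node_add divff ?gt_eqF//.
    exact: lt_le_trans.
  move=> /circle_ofP[k kE]; have /andP[? ?] := zbd i iN; have /andP[? ?] := zbd j jN.
  have : `|k%:~R| < 1%:~R :> R by rewrite ltr_norml; apply/andP; split; lra.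
  rewrite -intr_norm ltr_int => k1; have k0 : k = 0 by lia.
  rewrite k0 addr0 in kE; have [/z_lt|/z_lt|//] := ltngtP i j; rewrite kE ltxx//.
- by rewrite size_map size_iota.
- by move=> _ /mapP[i _ ->]; case: (hz i).
Qed.

(* The level count g has integral at most 2, is at least 2N on the window,
   and the window is longer than 2/(2N+1): it equals 2N on a set of positive
   measure. *)
Lemma window_positive (Y : set R) : measurable Y ->
  (forall t (f : homeoS1 R), window t -> (forall x, circle_of (F x + t) = f (circle_of x)) ->
     nf_class p q (2 * m) f -> Y t) ->
  (0 < mu (window `&` Y))%E.
Proof.
move=> mY hY; rewrite lt0e measure_ge0 andbT; apply/negP => /eqP Y0.
have [psi [lvl _ psi_lip psi1]] := level_fun p lF q0.
have [g [mg g0 ig hg]] := indicatrix_circle psi_lip psi1.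
have mT : measurable window by exact: measurable_itv.
pose len : R := (1 - 4 * eta) / N%:R.
have Tlen : mu window = len%:E.
  have lt1 : eta / N%:R < (1 - 3 * eta) / N%:R.
    by rewrite ltr_pM2r ?invr_gt0//; have := eta4 => h; lra.
  rewrite lebesgue_measure_itv/= lte_fin lt1.
  by rewrite -EFinB -mulrBl; congr ((_ / _)%:E); ring.
pose E : set R := window `&` [set t | ((2 * N).+1%:R%:E <= g t)%E].
have mE : measurable E.
  apply: measurableI => //; rewrite -[X in measurable X]setTI.
  exact: emeasurable_fun_c_infty.
(* Outside [E] and the degenerate parameters there are exactly 2N periodic points, and [l q = 2 q m]
   gives [l = 2 m]. *)
have covers : window `<=` (window `&` Y) `|` (E `|` [set t | degenerate (fun y => F y + t)]).
  move=> t wt; have [?|nE] := pselect (E t); first by right; left.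
  have [?|nd] := pselect (degenerate (fun y => F y + t)); first by right; right.
  left; split=> //; have lFt := lifting_shift t lF.
  have [f /is_liftP[_ Ff]] := homeo_of_lift lFt.
  apply: (hY t f) => //.
  have [s [us ss zs]] := zeros_seq wt.
  have rF : rot (fun y => F y + t) (p%:R / q%:R).
    have [b rb] := rot_exists lFt; suff <- : b = p%:R / q%:R by [].
    have N20 : (0 < 2 * N)%N by rewrite muln_gt0.
    have /zs/(rot_periodic lFt rb) : nth 0 s 0 \in s by rewrite mem_nth// ss.
    by rewrite -pmulrn => <-; rewrite mulrC mulKf// pnatr_eq0 -lt0n.
  have gf : good f.
    apply: contrapT => ngf; apply: nd; have [lC Cf _] := cliftP f.
    have [k kE] := lift_unique lFt lC Ff Cf.
    apply: (degenerate_shift (j := k) lFt).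
    rewrite (_ : (fun y => _) = clift f); last by apply/funext.
    apply: not_good_degenerate => //.
    have lfF : is_lift f (fun y => F y + t) by apply/is_liftP.
    rewrite (rotation_numberE lfF rF).
    exists (p%:R / q%:R - (Num.floor (p%:R / q%:R : R))%:~R) => //.
    by rewrite rmorphB/= fmorph_div/= !ratr_nat ratr_int.
  have [|l [_ _ nf]] := good_nf_class p0 q0 pq gf.
    by exists (fun y => F y + t) => //; apply/is_liftP.
  suff -> : (2 * m = l)%N by [].
  have [_ _ card _ _] := nf_classP p0 q0 pq nf.
  have [c [uc sc cP]] := card_seq card.
  have perE := periodic_return p0 q0 pq lFt Ff rF.
  have le1 : (2 * N <= l * q)%N.
    rewrite -ss -sc -(size_map (@circle_of R)); apply: uniq_leq_size => // x /mapP[y ys ->].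
    by apply/cP/perE/returnP; rewrite zs.
  have le2 : (l * q <= 2 * N)%N.
    rewrite leqNgt; apply/negP => lt; apply: nE; split=> //=.
    apply: (@le_trans _ _ ((l * q)%N%:R%:E)); first by rewrite lee_fin ler_nat.
    rewrite -sc -(size_map (fun x : circle R => repr x)); apply: hg.
      rewrite -map_comp (eq_map (g := id)) ?map_id// => x; exact: reprK.
    move=> _ /mapP[x xc ->]; apply/lvl; have /cP px := xc.
    by apply/returnP/perE; rewrite [circle_of _]reprK.
  apply/eqP; rewrite -(eqn_pmul2r q0) eqn_leq; apply/andP; split.
    by move: le1; rewrite /N; lia.
  by move: le2; rewrite /N; lia.
have nD : mu.-negligible [set t | degenerate (fun y => F y + t)].
  exact: (degenerate_negligible lF lifting_id lifting_id).
have leTE : (mu window <= mu E)%E.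
  have [D [mD D0 DE]] := nD.
  apply: (@le_trans _ _ (mu ((window `&` Y) `|` (E `|` D)))).
    apply: le_measure; rewrite ?inE//.
      by apply: measurableU; [exact: measurableI|exact: measurableU].
    by move=> t /covers[h|[h|/DE h]]; [left|right; left|right; right].
  have U2 (A B : set R) : measurable A -> measurable B ->
      (mu (A `|` B) <= mu A + mu B)%E.
    by move=> mA mB; exact: (@measureU2 _ _ _ mu A B mA mB).
  apply: (le_trans (U2 _ _ _ _)); [exact: measurableI|exact: measurableU|].
  by rewrite Y0 add0e; apply: (le_trans (U2 _ _ mE mD)); rewrite D0 adde0.
(* Pointwise, [g] is at least 2N on the window and at least 2N + 1 on [E]. *)
have intE : ((2 * N)%:R%:E * mu window + mu E <= 2%:E)%E.
  apply: le_trans ig.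
  have ind A : measurable A -> measurable_fun setT (fun t : R => (\1_A t)%:E : \bar R).
    by move=> mA; apply/measurable_EFinP; exact: measurable_indic.
  have i0 (A : set R) t : (0 <= (\1_A t)%:E :> \bar R)%E by rewrite lee_fin.
  have iI A : measurable A -> (\int[mu]_t (\1_A t)%:E = mu A)%E.
    move=> mA; apply: (etrans (@integral_indic _ _ _ mu setT measurableT A mA)).
    by congr (mu _); exact: setIT.
  rewrite -(iI _ mT) -(iI _ mE) -ge0_integralZl_EFin//; last exact: ind.
  rewrite -ge0_integralD//.
  - apply: ge0_le_integral => //.
    + by move=> t _; rewrite adde_ge0// mule_ge0.
    + by apply: emeasurable_funD; [apply: measurable_funeM|]; exact: ind.
    move=> t _; rewrite !indicE; have [wt|wt] := boolP (t \in window); last first.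
      have -> : (t \in E) = false.
        by apply/negbTE; apply: contra wt; rewrite !inE => -[].
      by rewrite mule0 adde0.
    rewrite mule1; have [tE|tE] := boolP (t \in E).
      by move: tE; rewrite inE => -[_ /=]; rewrite -natr1 EFinD.
    rewrite adde0; rewrite inE in wt; have [s [us ss zs]] := zeros_seq wt.
    by rewrite -ss; apply: hg => // x /zs/lvl.
  - by apply: measurable_funeM; exact: ind.
  - exact: ind.
have len0 : 0 < len by rewrite divr_gt0// subr_gt0.
(* This inequality is equivalent to [etaN], and is the reason for that bound on [eta]. *)
have lenN : 2 < len * (2 * N + 1)%:R.
  rewrite /len mulrAC ltr_pdivlMr// natrD mulrDr mulr1 natrM.
  have N1 : 1 <= N%:R :> R by rewrite ler1n.
  by move: etaN; rewrite natrD natrM; nra.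
have : ((2 * N)%:R%:E * mu window + mu window <= 2%:E)%E.
  by apply: le_trans intE; rewrite leeD2l.
rewrite Tlen -EFinM -EFinD lee_fin; move: lenN; rewrite natrD.
by generalize len => w; lra.
Qed.

End steps.
End counting.

(** * From small balls to Haar non-null classes *)

Section non_haar_null.
Context {R : realType}.
Local Notation mu := (@lebesgue_measure R).
Local Notation borelH := (borelType (homeoS1 R)).
Implicit Types (f g h : homeoS1 R).

(** A lift is sampled at equally spaced points and rounded to multiples of d / 8, which gives
    countably many codes; two maps with the same code are closer than d / 2 + d / 2. Each code in
    use selects one map as centre. *)
Lemma homeo_cover (d : R) : 0 < d -> exists c : seq int -> homeoS1 R,
  forall f, exists s, forall x, circle_dist (c s x) (f x) < d.
Proof.
move=> d0; pose e := d / 8; have e0 : 0 < e by rewrite divr_gt0.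
pose value (s : seq int) (x : R) : R :=
  (nth 0 s (Num.truncn ((size s)%:R * x)))%:~R * e.
pose code s f := exists F, [/\ lifting F, forall x, circle_of (F x) = f (circle_of x) &
  forall x, 0 <= x < 1 -> `|F x - value s x| < d / 2].
have codeP f : exists s, code s f.
  have [F lF Ff] := homeo_lift f.
  have d4 : 0 < d / 4 by rewrite divr_gt0.
  have [r r0 hr] := lifting_uniform lF d4.
  pose n := (Num.bound r^-1).+1.
  have nr : n%:R^-1 < r.
    rewrite invf_plt ?posrE ?ltr0n//; apply: (@lt_trans _ _ (Num.bound r^-1)%:R).
      by rewrite archi_boundP// invr_ge0 ltW.
    by rewrite ltr_nat.
  exists (mkseq (fun i => Num.floor (F (i%:R / n%:R) / e)) n); exists F; split=> // x /andP[x0 x1].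
  rewrite /value size_mkseq.
  have /truncn_itv : 0 <= n%:R * x by rewrite mulr_ge0.
  set i := Num.truncn _ => /andP[i1 i2].
  have iN : (i < n)%N by rewrite -(ltr_nat R) (le_lt_trans i1)// gtr_pMr// ltr0n.
  rewrite nth_mkseq//; have n0 : 0 < n%:R :> R by rewrite ltr0n.
  have xi : `|x - i%:R / n%:R| < r.
    apply: lt_trans nr; rewrite ger0_norm ?subr_ge0 ?ler_pdivrMr//; last by rewrite mulrC.
    rewrite -(ltr_pM2l n0) mulrBr [n%:R * (_ / _)]mulrCA divff ?gt_eqF// mulr1.
    by rewrite -natr1 in i2; rewrite ltrBlDl.
  have := hr _ _ xi; set y := F (i%:R / n%:R).
  have /andP[] := floor_itv (y / e); rewrite intrD ler_pdivlMr// ltr_pdivrMr// mulrDl mul1r.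
  set b := _%:~R * e; have eE : e = d / 8 by [].
  clearbody b y e; move: (F x) => a h1 h2; rewrite !ltr_norml => /andP[h3 h4].
  by apply/andP; split; lra.
have cex s : exists f, forall g, code s g -> code s f.
  have [[f fs]|no] := pselect (exists f, code s f); first by exists f.
  by exists 1%g => g gs; case: no; exists g.
have [c hc] := choice cex; exists c => f; have [s fs] := codeP f; exists s => x.
have [F [lF Ff hF]] := fs; have [G [lG Gg hG]] := hc s f fs.
have [a <-] := circle_of_surj x; have [k /andP[k1 k2]] := int_floor a.
have <- : circle_of (a + (- k)%:~R) = circle_of a by rewrite circle_ofDint.
apply: le_lt_trans (circle_dist_lift Gg Ff _) _.
have a01 : 0 <= a + (- k)%:~R < 1 by rewrite mulrNz; apply/andP; split; lra.
have := hF _ a01; have := hG _ a01; rewrite !ltr_norml => /andP[? ?] /andP[? ?].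
by apply/andP; split; lra.
Qed.

Lemma steps_param (N : nat) : (0 < N)%N -> exists2 eta : R,
  0 < eta < 1 & 4 * eta * (2 * N + 1)%:R < 1.
Proof.
move=> N0; have N1 : 1 <= (2 * N + 1)%:R :> R by rewrite ler1n addn1.
have N0' : 0 < (2 * N + 1)%:R :> R by rewrite ltr0n addn1.
move: (2 * N + 1)%:R N1 N0' => M M1 M0; exists (8 * M)^-1; last first.
  by rewrite (_ : 4 * _ * M = 2^-1); [lra|field; lra].
by rewrite invr_gt0 mulr_gt0//= invf_lt1 ?mulr_gt0//; lra.
Qed.

Section nf.
Context (p q m : nat) (p0 : (0 < p)%N) (q0 : (0 < q)%N) (pq : coprime p q) (m0 : (0 < m)%N).

(* Translating by g0, a rotation composed with a map close to a step function,
   and then by a rotation of the right amount, brings every homeomorphism close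
   to the identity into the class. *)
Lemma steps_near_id : exists (g0 : homeoS1 R) (d : R) (T : set R),
  [/\ 0 < d, measurable T & forall k : homeoS1 R, (forall x, circle_dist x (k x) < d) ->
  forall Y : set R, measurable Y ->
    (forall t, T t -> nf_class p q (2 * m) (rotate t * (g0 * k))%g -> Y t) ->
    (0 < mu (T `&` Y))%E].
Proof.
have N0 : (0 < q * m)%N by rewrite muln_gt0 q0.
have [eta eta01 etaN] := steps_param N0; have /andP[eta0 eta1] := eta01.
have [S lS hS] := scaled_step_map N0 eta01.
have [g0 /is_liftP[_ g0E]] := homeo_of_lift (lifting_shift (p%:R / q%:R) lS).
have w0 : 0 < eta / (q * m)%:R by rewrite divr_gt0// ltr0n.
exists g0, (Num.min 4^-1 (eta / (q * m)%:R)), (window q m eta); split.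
- by rewrite lt_min w0 invr_gt0 ltr0n.
- exact: measurable_itv.
move=> k hk Y mY hY.
have [K [lK Kk Kid]] : exists K, [/\ lifting K,
    forall x, circle_of (K x) = k (circle_of x) & forall x, `|K x - x| < eta / (q * m)%:R].
  have d4 : Num.min 4^-1 (eta / (q * m)%:R) <= 4^-1 by rewrite ge_min lexx.
  have [K [lK Kk Kid]] := near_lift (f := 1%g) (g := k) (@lifting_id R) (fun=> erefl) d4 hk.
  by exists K; split=> // x; have := Kid x; rewrite lt_min => /andP[].
apply: (@window_positive R p q m p0 q0 pq m0 eta eta0 etaN S lS _ _ K lK Kid Y mY).
- by move=> j x; exact: (hS j).1.
- by move=> j x; exact: (hS j).2.
move=> t f wt Ff nf; apply: hY => //.
rewrite (_ : (rotate t * (g0 * k))%g = f)//.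
apply: (homeo_eq_lift _ Ff) => x.
by rewrite !homeo_mulE -Kk -g0E rotateE.
Qed.

(** Were the class empty, the empty set [Y] would meet the requirement of [steps_near_id] and would
    have to leave positive measure. *)
Lemma nf_class_nonempty : exists f : homeoS1 R, nf_class p q (2 * m) f.
Proof.
have [g0 [d [T [d0 _ hT]]]] := steps_near_id; apply: contrapT => no.
have := hT 1%g _ set0 measurable0 _; rewrite setI0 measure0 ltxx => h.
suff : false by [].
apply: h => [x|t _ nf]; first by rewrite [X in circle_dist x X](_ : _ = x) ?circle_distxx.
by apply: no; exists (rotate t * (g0 * 1))%g.
Qed.

(** If all translates of a Borel set [B] containing the class were P-null, Tonelli's theorem would
    make every ball of radius [d] P-null; countably many balls cover the group, so P would
    vanish. *)
Lemma nf_class_non_haar_null f : nf_class p q (2 * m) f ->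
  ~ haar_null R (conjugacy_class f).
Proof.
move=> nf [B [[mB [P hP]] fB]].
have [g0 [d [T [d0 mT hT]]]] := steps_near_id.
suff null (f1 : homeoS1 R) : P.-negligible [set k : borelH | forall x, circle_dist (f1 x) (homeo_fun k x) < d].
  have [c hc] := homeo_cover d0.
  have : P.-negligible (\bigcup_s [set k : borelH | forall x, circle_dist (c s x) (homeo_fun k x) < d]).
    by apply: negligible_bigcup_countable => s; exact: null.
  rewrite (_ : \bigcup_s _ = [set: borelH]); last first.
    by apply/seteqP; split=> // k _; have [s hs] := hc k; exists s.
  move=> /(@measure_negligible _ _ _ P _ measurableT) PT0.
  have := etrans (esym (@probability_setT _ _ _ P)) PT0.
  by move=> /eqP; rewrite onee_eq0.
pose Phi (tk : R * borelH) : borelH := (rotate tk.1 * (g0 * tk.2 * f1^-1))%g.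
have mPhi : measurable_fun setT Phi by exact: measurable_rotate_mul.
pose M : set (R * borelH) := Phi @^-1` B.
have mM : measurable M by rewrite -[M]setTI; exact: mPhi.
pose ind (tk : measurableTypeR R * borelH) : \bar R := (\1_M tk)%:E.
have mind : measurable_fun setT ind.
  by apply/measurable_EFinP; exact: measurable_indic.
have ind0 tk : (0 <= ind tk)%E by rewrite lee_fin.
have sec1 t : (\int[P]_k ind (t, k) = 0)%E.
  rewrite (_ : (fun k => ind (t, k)) = (fun k => (\1_[set k : borelH | B (Phi (t, k))] k)%:E)); last first.
    by apply/funext => k; rewrite /ind !indicE /M; congr ((_ : bool)%:R%:E); apply/idP/idP; rewrite !inE.
  have eqT : [set k : borelH | B (Phi (t, k))] = translate (rotate t * g0)^-1%g f1 B.
    have [X XE] : exists X : homeoS1 R, X = (rotate t * g0)%g by eexists.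
    have PhiE k : Phi (t, k) = (X * k * f1^-1)%g by rewrite XE /Phi/= !mulgA.
    rewrite -XE; apply/seteqP; split=> k.
      rewrite /= PhiE => Bk; exists (X * k * f1^-1)%g => //.
      by rewrite -!mulgA mulVg mulg1 mulKg.
    by move=> [b Bb <-]; rewrite /= PhiE -!mulgA mulgV mulg1 mulVKg.
  rewrite integral_indic//.
    by rewrite setIT eqT; exact: hP.
  rewrite [X in measurable X](_ : _ = setT `&` (fun k : borelH => ((rotate t * g0) * k * f1^-1)%g : borelH) @^-1` B).
    by apply: measurable_homeo_mul.
  by rewrite setTI; apply/seteqP; split=> k; rewrite /= /Phi/= !mulgA.
have tonelli := @fubini_tonelli _ _ (measurableTypeR R) borelH R mu P ind mind ind0.
rewrite (eq_integral (cst 0%E)) in tonelli; last by move=> t _; exact: sec1.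
rewrite integral0 in tonelli.
have mG := @measurable_fun_fubini_tonelli_G _ _ (measurableTypeR R) borelH R mu ind mind ind0.
have /(ae_eq_integral_abs P measurableT mG) : (\int[P]_k `|fubini_G mu ind k| = 0)%E.
  rewrite tonelli; apply: eq_integral => k _; rewrite gee0_abs//.
  exact: integral_ge0.
apply: negligibleS => k /= kf1 /(_ I) Gk.
(* This section of the Borel set [B] is measurable; the parameters that land in the class itself
   need not form a measurable set, hence the quantification over [Y] in [steps_near_id]. *)
pose Y := [set t : R | B (Phi (t, k))].
have mY : measurable Y.
  rewrite (_ : Y = setT `&` (fun t : R => (rotate t * (g0 * k * f1^-1))%g : borelH) @^-1` B).
    exact: measurable_rotate.
  by rewrite setTI.
have Y0 : mu Y = 0%E.
  rewrite -[RHS]Gk /fubini_G.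
  rewrite (_ : (fun t => ind (t, k)) = (fun t => (\1_Y t)%:E)); last first.
    by apply/funext => t; rewrite /ind !indicE /M; congr ((_ : bool)%:R%:E); apply/idP/idP; rewrite !inE.
  apply: esym; apply: (etrans (@integral_indic _ _ _ mu setT measurableT Y mY)).
  by congr (mu _); exact: setIT.
have : (0 < mu (T `&` Y))%E.
  (* The uniform distance is invariant under composition on the right, so [k] close to [f1] makes
     [k * f1^-1] close to the identity. *)
  apply: (hT (k * f1^-1)%g) => //.
    move=> x; have := kf1 (homeo_fun f1^-1%g x).
    by rewrite -homeo_mulE mulgV.
  move=> t Tt nf'; rewrite /Y /= /Phi /= -mulgA; apply: fB.
  exact: nf_class_conj nf nf'.
rewrite ltNge => /negP; apply; rewrite -Y0; apply: le_measure; rewrite ?inE//.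
exact: measurableI.
Qed.

End nf.
End non_haar_null.

Section conclusion.
Context {R : realType}.
Implicit Types (f g : homeoS1 R).

Lemma conjugacy_class_refl (G : groupType) (f : G) : conjugacy_class f f.
Proof. by exists 1%g => //; rewrite mul1g invg1 mulg1. Qed.

Lemma conjugacy_class_sym (G : groupType) (f g : G) :
  conjugacy_class f g -> conjugacy_class g f.
Proof.
by move=> [h _ <-]; exists h^-1%g => //; rewrite invgK !mulgA mulVg mul1g mulgVK.
Qed.

Lemma conjugacy_class_trans (G : groupType) (f g h : G) :
  conjugacy_class f g -> conjugacy_class g h -> conjugacy_class f h.
Proof.
by move=> [a _ <-] [b _ <-]; exists (b * a)%g => //; rewrite invgM !mulgA.
Qed.

Lemma conjugacy_class_eq (G : groupType) (f g : G) :
  conjugacy_class f g -> conjugacy_class f = conjugacy_class g.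
Proof.
move=> fg; apply/seteqP; split=> h.
  by apply: conjugacy_class_trans; exact: conjugacy_class_sym.
exact: conjugacy_class_trans.
Qed.

Lemma good_non_haar_null f : good f -> ~ haar_null R (conjugacy_class f).
Proof.
move=> /good_nf[p [q [l [p0 q0 pq nf]]]].
have [_ [l0 el] _ _ _] := nf_classP p0 q0 pq nf.
have lE : l = (2 * l./2)%N by rewrite mul2n even_halfK.
rewrite lE in nf; apply: (nf_class_non_haar_null p0 q0 pq _ nf).
by move: l0; rewrite {1}lE muln_gt0.
Qed.

End conclusion.

Theorem theorem4p5 (R : realType) :
  [/\ (forall f : homeoS1 R,
         ~ haar_null R (conjugacy_class f) <->
         [/\ rational (rotation_number f),
             finite_set (periodic_points f) &
             forall x, periodic_points f x -> crossing_periodic_point f x]),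
      (forall C : set (homeoS1 R),
         conjugacy_classes C -> ~ haar_null R C ->
         forall f, C f ->
           exists n : nat, ~~ odd n /\ (periodic_orbits f #= `I_n)%card),
      (forall (r : rat) (k : nat), 0 <= r < 1 -> (0 < k)%N ->
         exists! C : set (homeoS1 R),
           [/\ conjugacy_classes C, ~ haar_null R C &
               forall f, C f ->
                 rotation_number f = ratr r /\
                 (periodic_orbits f #= `I_(2 * k))%card]) &
      co_haar_null R
        (\bigcup_(C in [set C : set (homeoS1 R) |
                          conjugacy_classes C /\ ~ haar_null R C]) C
         `|` [set f : homeoS1 R | ~ rational (rotation_number f)])].
Proof.
split.
- by move=> f; split; [exact: non_haar_null_good|exact: good_non_haar_null].
- move=> _ [f0 _ <-] /non_haar_null_good gf0 f f0f.
  have /good_nf[p [q [l [p0 q0 pq nf]]]] := good_conj (conjugacy_class_sym f0f) gf0.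
  by have [_ [_ el] _ card _] := nf_classP p0 q0 pq nf; exists l.
- move=> r k r01 k0; have [p [q [p0 q0 pq h]]] := @rotation_number_rat R r r01.
  have [f0 nf0] := @nf_class_nonempty R p q k p0 q0 pq k0.
  exists (conjugacy_class f0); split.
    split; [by exists f0|exact: nf_class_non_haar_null nf0|].
    move=> f /conjugacy_class_sym/conj_nf_class/(_ nf0) nf.
    have [_ _ _ card hF] := nf_classP p0 q0 pq nf.
    by split=> //; apply/h.
  (* Uniqueness: the rotation number fixes [p] and [q], the number of periodic orbits fixes [l], and
     maps with the same normal form are conjugate. *)
  move=> _ [[f1 _ <-] /non_haar_null_good gf1 hC].
  have [rot1 card1] := hC _ (conjugacy_class_refl f1).
  have [l [_ _ nf1]] := good_nf_class p0 q0 pq gf1 ((h f1).1 rot1).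
  have [_ _ _ card2 _] := nf_classP p0 q0 pq nf1.
  have lk : l = (2 * k)%N.
    by apply/card_eq_II; exact: card_eq_trans (card_esym card2) card1.
  rewrite lk in nf1; apply: conjugacy_class_eq.
  exact: nf_class_conj nf0 nf1.
- exists [set f | degenerate (clift f)]; split; first exact: haar_null_degenerate.
  move=> f /not_orP[nC /contrapT ratf]; apply: not_good_degenerate => // gf.
  apply: nC; exists (conjugacy_class f); last exact: conjugacy_class_refl.
  by split; [exists f|exact: good_non_haar_null].
Qed.
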